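(* Let ${\mathcal{O}}$ be the ring of integers of a number field, ${\mathfrak{p}}\trianglelefteq{\mathcal{O}}$ a non-zero prime ideal, and $q:=|{\mathcal{O}}/{\mathfrak{p}}|$. Let $G$ be a finite ${\mathfrak{p}}$-torsion ${\mathcal{O}}$-module. Then for every integer $u\ge 0$, $$P_{0,q}^{(u)}(G)=\frac{(q)_\infty}{(q)_u}\cdot\frac{1}{|G|^u\,|{\operatorname{Aut}}_{\mathcal{O}}(G)|}.$$
   Context: For integers $r\ge 1$ set $(q)_r:=\prod_{i=1}^r(1-q^{-i})$, $(q)_0:=1$, and $(q)_\infty:=\prod_{i=1}^\infty(1-q^{-i})$. ${\operatorname{Aut}}_{\mathcal{O}}(G)$ is the group of ${\mathcal{O}}$-module automorphisms of $G$. Let ${\mathcal{P}}$ be the set of isomorphism classes of finite ${\mathfrak{p}}$-torsion ${\mathcal{O}}$-modules. For integers $0\le m\le f$ and $n\ge1$, the $m$-th symplectic group is ${\operatorname{Sp}}^{(m)}_{2n}({\mathcal{O}}/{\mathfrak{p}}^f):=\{h\in{\operatorname{GL}}_{2n}({\mathcal{O}}/{\mathfrak{p}}^f) : h^tJ_nh\equiv J_n \pmod{{\mathfrak{p}}^m}\}$, where $J_n=\begin{pmatrix}0&\mathbf 1_n\\-\mathbf 1_n&0\end{pmatrix}$ (so for $m=0$ this is ${\operatorname{GL}}_{2n}({\mathcal{O}}/{\mathfrak{p}}^f)$). For $G\in{\mathcal{P}}$ define $$P_{m,q}(G):=\lim_{n\to\infty}\frac{|\{g\in{\operatorname{Sp}}^{(m)}_{2n}({\mathcal{O}}/{\mathfrak{p}}^f)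 : \ker(g-\mathbf 1_{2n})\cong G\}|}{|{\operatorname{Sp}}^{(m)}_{2n}({\mathcal{O}}/{\mathfrak{p}}^f)|},$$ where $f\ge \max(m,1)$ is any integer with ${\mathfrak{p}}^{f-1}G=0$; it is known that this limit exists, is independent of such $f$, and that $P_{0,q}(G)=(q)_\infty/|{\operatorname{Aut}}_{\mathcal{O}}(G)|$. For a probability distribution $P$ on ${\mathcal{P}}$, its $u$-probability distribution is defined recursively by $P^{(0)}:=P$ and, for $u\ge1$, $$P^{(u)}(G):=\sum_{H\in{\mathcal{P}}}\ \sum_{y\in H,\ H/\langle y\rangle\cong G}\frac{P^{(u-1)}(H)}{|H|},$$ where $\langle y\rangle$ is the ${\mathcal{O}}$-submodule generated by $y$ (one representative $H$ taken per isomorphism class). *)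

(* Defs.v *)
From HB Require Import structures.
From mathcomp Require Import all_boot all_order all_algebra perm fieldext.
From mathcomp Require Import finmap.
From mathcomp Require Import all_classical all_reals all_analysis.

Set Implicit Arguments.
Unset Strict Implicit.
Unset Printing Implicit Defensive.

Import Order.TTheory GRing.Theory Num.Theory.
Import numFieldNormedType.Exports.

Local Open Scope classical_set_scope.
Local Open Scope ring_scope.

(* A number field is a finite extension of rat, i.e. a fieldExtType rat. *)

Section RingOfIntegers.
Variable L : fieldExtType rat.

Definition integral_pred : {pred L} :=
  fun x => `[< integralOver (intr : int -> L) x >].

Lemma integral_pred_subring : subring_closed integral_pred.
Proof.
split=> [|x y /asboolP xI /asboolP yI|x y /asboolP xI /asboolP yI].
- by apply/asboolP; apply: integral1.
- by apply/asboolP; apply: integral_sub.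
- by apply/asboolP; apply: integral_mul.
Qed.

HB.instance Definition _ :=
  GRing.isSubringClosed.Build L integral_pred integral_pred_subring.

Record ringOfIntegers := RingOfIntegers {
  roi_val :> L;
  _ : roi_val \in integral_pred }.

HB.instance Definition _ := [isSub for roi_val].
HB.instance Definition _ := [Choice of ringOfIntegers by <:].
HB.instance Definition _ :=
  [SubChoice_isSubComNzRing of ringOfIntegers by <:].

End RingOfIntegers.

Section IdealPowers.
Variable A : comNzRingType.

Definition ideal_mul (I J : {pred A}) : {pred A} := fun x =>
  `[< exists2 s : seq (A * A), all (fun ab => (ab.1 \in I) && (ab.2 \in J)) s
      & x = \sum_(ab <- s) ab.1 * ab.2 >].

Fixpoint ideal_exp (I : {pred A}) (k : nat) : {pred A} :=
  if k is j.+1 then ideal_mul I (ideal_exp I j) else predT.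

Lemma ideal_exp_linear (I : idealr A) k a u v :
  u \in ideal_exp I k -> v \in ideal_exp I k -> a * u + v \in ideal_exp I k.
Proof.
case: k => //= k /asboolP[s sI ->] /asboolP[t tI ->].
apply/asboolP; exists ([seq (a * ab.1, ab.2) | ab <- s] ++ t).
  rewrite all_cat tI andbT all_map; apply: sub_all sI => ab /= /andP[? ->].
  by rewrite idealMr.
rewrite big_cat big_map mulr_sumr /=; congr (_ + _).
by apply: eq_bigr => ab _; rewrite mulrA.
Qed.

Lemma ideal_exp0 (I : {pred A}) k : 0 \in ideal_exp I k.
Proof.
by case: k => //= k; apply/asboolP; exists [::] => //; rewrite big_nil.
Qed.

Lemma ideal_exp_sub (I : idealr A) k u : u \in ideal_exp I k.+1 -> u \in I.
Proof.
move=> /asboolP[s sI ->]; elim: s sI => [|ab s IH] /=.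
  by rewrite big_nil rpred0.
by case/andP=> /andP[aI _] sI; rewrite big_cons rpredD ?IH// mulrC idealMr.
Qed.

Lemma ideal_expS_closed (I : idealr A) k : idealr_closed (ideal_exp I k.+1).
Proof.
split; first exact: ideal_exp0.
  by apply/negP => /ideal_exp_sub; rewrite idealr1.
by move=> a u v; apply: ideal_exp_linear.
Qed.

HB.instance Definition _ (I : idealr A) k :=
  isIdealr.Build A (ideal_exp I k.+1) (ideal_expS_closed I k).

End IdealPowers.

(* A / p^(k+1); the power 0, for which the quotient is the zero ring, is not
   needed. *)
Notation quot_exp I k := {ideal_quot (ideal_exp I k.+1)}.
Notation quot_pi I k := (\pi_(quot_exp I k)%qT).

Section Modules.
Variable A : comNzRingType.

Definition mod_iso (M N : lmodType A) : Prop :=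
  exists f : {linear M -> N}, bijective f.

Lemma mod_iso_sym (M N : lmodType A) : mod_iso M N -> mod_iso N M.
Proof.
case=> f [g fK gK]; have g_lin : linear g := can2_linear fK gK.
pose gM := GRing.isLinear.Build A N M *:%R g g_lin.
pose gL : {linear N -> M} := HB.pack g gM.
by exists gL; exists f.
Qed.

Lemma mod_iso_trans (M N K : lmodType A) :
  mod_iso M N -> mod_iso N K -> mod_iso M K.
Proof. by move=> [f fB] [g gB]; exists (g \o f); apply: bij_comp. Qed.

Definition automorphisms (G : finLmodType A) : {set {perm G}} :=
  [set s : {perm G} | `[< linear s >]].

Section Cyclic.
Variables (M : lmodType A) (y : M).

Definition cyclic_submod : {pred M} := fun x => `[< exists a : A, x = a *: y >].

Lemma cyclic_submod_closed : submod_closed cyclic_submod.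
Proof.
split; first by apply/asboolP; exists 0; rewrite scale0r.
move=> a _ _ /asboolP[b ->] /asboolP[c ->]; apply/asboolP.
by exists (a * b + c); rewrite scalerDl scalerA.
Qed.

HB.instance Definition _ :=
  GRing.isSubmodClosed.Build A M cyclic_submod cyclic_submod_closed.

Local Notation quo := (Quotient.quot cyclic_submod).

Definition quo_scale (a : A) (x : quo) : quo := \pi_quo%qT (a *: repr x).

Lemma quo_scale_pi a x : quo_scale a (\pi_quo%qT x) = \pi_quo%qT (a *: x).
Proof.
apply/eqP; rewrite -Quotient.idealrBE -scalerBr rpredZ//.
by rewrite Quotient.idealrBE reprK.
Qed.

Lemma quo_scaleA a b x : quo_scale a (quo_scale b x) = quo_scale (a * b) x.
Proof. elim/quotW: x => x. rewrite [quo_scale b _]quo_scale_pi. rewrite [LHS]quo_scale_pi. rewrite [RHS]quo_scale_pi. by rewrite scalerA. Qed.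
Lemma quo_scale1 : left_id 1 quo_scale.
Proof. by elim/quotW=> x; rewrite [LHS]quo_scale_pi scale1r. Qed.

Lemma quo_scaleDr : right_distributive quo_scale +%R.
Proof.
move=> a; elim/quotW=> x; elim/quotW=> y'.
rewrite -(raddfD \pi_quo%qT).
rewrite [LHS]quo_scale_pi.
rewrite [quo_scale _ (_ x)]quo_scale_pi.
rewrite [quo_scale _ _]quo_scale_pi.
by rewrite -raddfD scalerDr.
Qed.

Lemma quo_scaleDl x : {morph quo_scale^~ x : a b / a + b >-> a + b}.
Proof.
elim/quotW: x => x a b /=.
rewrite [LHS]quo_scale_pi.
rewrite [quo_scale a _]quo_scale_pi.
rewrite [quo_scale b _]quo_scale_pi.
by rewrite -raddfD scalerDl.
Qed.

HB.instance Definition _ := GRing.Zmodule_isLmodule.Build A quo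
  quo_scaleA quo_scale1 quo_scaleDr quo_scaleDl.
End Cyclic.

End Modules.

Section KernelModule.
Variables (B : comNzRingType) (m n : nat) (h : 'M[B]_(m, n)).

Definition ker_pred : {pred 'cV[B]_n} := fun v => h *m v == 0.

Lemma ker_pred_closed : submod_closed ker_pred.
Proof.
split=> [|a u v /eqP hu /eqP hv]; first by apply/eqP; rewrite mulmx0.
by apply/eqP; rewrite mulmxDr -scalemxAr hu hv scaler0 addr0.
Qed.

HB.instance Definition _ :=
  GRing.isSubmodClosed.Build B 'cV[B]_n ker_pred ker_pred_closed.

Record ker_mod := KerMod { ker_val :> 'cV[B]_n; _ : ker_val \in ker_pred }.

HB.instance Definition _ := [isSub for ker_val].
HB.instance Definition _ := [Choice of ker_mod by <:].
HB.instance Definition _ := [SubChoice_isSubLmodule of ker_mod by <:].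
End KernelModule.

Section FinLmodule.
Variables (A : comNzRingType) (T : finType).
Variables (zero : T) (opp : T -> T) (add : T -> T -> T) (scale : A -> T -> T).
Hypotheses (addA : associative add) (addC : commutative add).
Hypotheses (add0 : left_id zero add) (addN : left_inverse zero opp add).
Hypothesis scaleA : forall a b x, scale a (scale b x) = scale (a * b) x.
Hypothesis scale1 : left_id 1 scale.
Hypothesis scaleDr : right_distributive scale add.
Hypothesis scaleDl : forall x a b, scale (a + b) x = add (scale a x) (scale b x).

Let zmixin := GRing.isZmodule.Build T addA addC add0 addN.
Let zmod : zmodType := HB.pack (Finite.sort T) zmixin.

Definition fin_lmodule : finLmodType A :=
  HB.pack (Finite.sort T) zmixin
    (GRing.Zmodule_isLmodule.Build A zmod scaleA scale1 scaleDr scaleDl).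
End FinLmodule.

Section IsoClasses.
Variables (A : comNzRingType) (p : idealr A).

Definition killed_by_exp (k : nat) (G : lmodType A) : Prop :=
  forall a, a \in ideal_exp p k -> forall x : G, a *: x = 0.

(* For a finite module this is the same as every element being killed by some
   power of p. *)
Definition ptorsion (G : lmodType A) : Prop := exists k, killed_by_exp k G.

(* Finite p-torsion modules with carrier an ordinal: a small type meeting every
   isomorphism class (see fmod_exists).  The operations are spelled out since
   bundling a finLmodType here would make the type too large to be a choiceType
   consistently with the rest of the library. *)
Record fmod := Fmod {
  fmod_pred : nat;
  fmod_zero : 'I_fmod_pred.+1;
  fmod_opp : 'I_fmod_pred.+1 -> 'I_fmod_pred.+1;
  fmod_add : 'I_fmod_pred.+1 -> 'I_fmod_pred.+1 -> 'I_fmod_pred.+1;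
  fmod_scale : A -> 'I_fmod_pred.+1 -> 'I_fmod_pred.+1;
  fmod_addA : associative fmod_add;
  fmod_addC : commutative fmod_add;
  fmod_add0 : left_id fmod_zero fmod_add;
  fmod_addN : left_inverse fmod_zero fmod_opp fmod_add;
  fmod_scaleA : forall a b x,
    fmod_scale a (fmod_scale b x) = fmod_scale (a * b) x;
  fmod_scale1 : left_id 1 fmod_scale;
  fmod_scaleDr : right_distributive fmod_scale fmod_add;
  fmod_scaleDl : forall x a b,
    fmod_scale (a + b) x = fmod_add (fmod_scale a x) (fmod_scale b x);
  fmod_torsion : exists k, forall a, a \in ideal_exp p k ->
    forall x, fmod_scale a x = fmod_zero }.

Definition fmod_module (H : fmod) : finLmodType A :=
  fin_lmodule (fmod_addA (f := H)) (fmod_addC (f := H)) (fmod_add0 (f := H))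
    (fmod_addN (f := H)) (fmod_scaleA (f := H)) (fmod_scale1 (f := H))
    (fmod_scaleDr (f := H)) (fmod_scaleDl (f := H)).

Lemma fmod_ptorsion (H : fmod) : ptorsion (fmod_module H).
Proof. exact: fmod_torsion H. Qed.

HB.instance Definition _ := gen_eqMixin fmod.
HB.instance Definition _ := gen_choiceMixin fmod.

Definition fmod_iso : rel fmod :=
  fun H K => `[< mod_iso (fmod_module H) (fmod_module K) >].

Lemma fmod_iso_equiv : equiv_class_of fmod_iso.
Proof.
split=> [H|H K|K H M].
- by apply/asboolP; exists idfun; exists idfun.
- by apply/asboolP/asboolP; apply: mod_iso_sym.
- move=> /asboolP HK /asboolP KM; apply/asboolP.
  exact: mod_iso_trans HK KM.
Qed.

Canonical fmod_equiv := EquivRelPack fmod_iso_equiv.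

Definition isoclass := {eq_quot fmod_iso}%qT.

HB.instance Definition _ := Choice.on isoclass.

Definition class_repr (c : isoclass) : finLmodType A := fmod_module (repr c).

Lemma fmod_exists (G : finLmodType A) :
  ptorsion G -> exists H : fmod, mod_iso (fmod_module H) G.
Proof.
have [n Gn] : exists n, #|G| = n.+1.
  by case E : #|G| => [|n]; [have := fintype0 0 E | exists n].
pose f (x : G) := cast_ord Gn (enum_rank x).
pose g i : G := enum_val (cast_ord (esym Gn) i).
have fK : cancel f g by move=> x; rewrite /f /g cast_ordK enum_rankK.
have gK : cancel g f by move=> i; rewrite /f /g enum_valK cast_ordKV.
move=> [k kG].
pose add x y := f (g x + g y); pose opp x := f (- g x).
pose scale (a : A) x := f (a *: g x).
have addA : associative add by move=> x y z; rewrite /add !fK addrA.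
have addC : commutative add by move=> x y; rewrite /add addrC.
have add0 : left_id (f 0) add by move=> x; rewrite /add fK add0r.
have addN : left_inverse (f 0) opp add.
  by move=> x; rewrite /add /opp fK addNr.
have scA a b x : scale a (scale b x) = scale (a * b) x.
  by rewrite /scale fK scalerA.
have sc1 : left_id 1 scale by move=> x; rewrite /scale scale1r gK.
have scDr : right_distributive scale add.
  by move=> a x y; rewrite /scale /add !fK scalerDr.
have scDl x a b : scale (a + b) x = add (scale a x) (scale b x).
  by rewrite /scale /add !fK scalerDl.
have tors : exists k, forall a, a \in ideal_exp p k -> forall x, scale a x = f 0.
  by exists k => a ak x; rewrite /scale kG.
exists (Fmod addA addC add0 addN scA sc1 scDr scDl tors).
set V := fmod_module _.
have g_lin : linear (g : V -> G) by move=> a x y; rewrite /= !fK.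
pose gM := GRing.isLinear.Build A V G *:%R g g_lin.
pose gL : {linear V -> G} := HB.pack (g : V -> G) gM.
by exists gL; exists f.
Qed.

Lemma class_reprP (G : finLmodType A) : ptorsion G ->
  exists! c : isoclass, mod_iso (class_repr c) G.
Proof.
move=> /fmod_exists[H HG]; exists (\pi_isoclass%qT H); split.
  apply: mod_iso_trans HG; apply/asboolP.
  by rewrite -/(fmod_iso _ _) -[fmod_iso _ _]eqmodE reprK.
move=> c cG; rewrite -[c]reprK; apply/eqP; rewrite eqmodE.
apply/asboolP; apply: (mod_iso_trans HG); exact: mod_iso_sym.
Qed.

End IsoClasses.

Section SymplecticGroups.
Variables (A : comNzRingType) (p : idealr A).

Definition sympl_J (B : comNzRingType) (n : nat) : 'M[B]_(n + n) :=
  block_mx 0 1%:M (- 1%:M) 0.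

Definition GLset (B : comNzRingType) (N : nat) : set 'M[B]_N :=
  [set g | exists h, g *m h = 1%:M /\ h *m g = 1%:M].

(* Here and below the modulus is p^(k+1), that is f = k + 1. *)
Definition Sp_set (m k n : nat) : set 'M[quot_exp p k]_(n + n) :=
  [set h | GLset h /\
    forall i j, exists2 a, a \in ideal_exp p m &
      quot_pi p k a = (h^T *m sympl_J _ n *m h - sympl_J _ n) i j].

(* ker h is a module over A through the projection A -> A / p^(k+1). *)
Definition ker_iso (k N : nat) (h : 'M[quot_exp p k]_N) (G : lmodType A) : Prop :=
  exists f : {linear G -> ker_mod h | quot_pi p k \; *:%R}, bijective f.

End SymplecticGroups.

Arguments Sp_set {A} p m k n _.

Section Distributions.
Variables (R : realType) (A : comNzRingType) (p : idealr A).

Local Notation card S := (#|` fset_set S|%fset).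

Definition Sp_ratio (m k : nat) (G : lmodType A) (n : nat) : R :=
  (card [set g | Sp_set p m k n g /\ ker_iso (g - 1%:M) G])%:R
    / (card (Sp_set p m k n))%:R.

(* The common limit for all f = k + 1 >= max(m, 1) with p^k G = 0. *)
Definition Pm (m : nat) (G : lmodType A) : R :=
  get [set l : R | forall k, (m <= k.+1)%N -> killed_by_exp p k G ->
         Sp_ratio m k G n @[n --> \oo] --> l].

(* Distributions on isomorphism classes are represented by functions on
   modules; esum is the sum of a family of nonnegative extended reals. *)
Fixpoint udist (P : finLmodType A -> \bar R) (u : nat) (G : finLmodType A)
    : \bar R :=
  if u is v.+1 then
    \esum_(c in [set: isoclass p])
      (\sum_(y : class_repr c
             | `[< mod_iso (Quotient.quot (cyclic_submod y)) G >])
         udist P v (class_repr c) * (#|class_repr c|%:R^-1)%:E)%E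
  else P G.

Definition residue_card : nat := card [set: {ideal_quot p}].

Definition qfact (r : nat) : R :=
  \prod_(1 <= i < r.+1) (1 - residue_card%:R ^- i).

Definition qfact_oo : R := limn qfact.

End Distributions.

(* Main.v *)
(** The case u = 0.  Let B = O/p^(F+1), a finite chain ring with residue field
    of order q, and let p^F G = 0.  The matrices with a prescribed kernel K,
    K isomorphic to G, form one orbit of GL_N(B) acting by left multiplication,
    with stabilizers of order |G|^N; hence |Inj(G, B^N)| |GL_N(B)| / (|Aut G| |G|^N)
    matrices X have kernel isomorphic to G, and |Inj(G, B^N)| / |G|^N tends to 1.
    Averaging over left multiplication by GL_N(B), the proportion of those X for
    which 1 + X is invertible is the probability that Z + E is invertible, for Z
    uniform in GL_N(F_q) and E a fixed matrix of rank N - dim G[p].  A two-term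
    recursion in N and the rank shows that this probability tends to (q)_oo.

    The step from u to u + 1.  For fixed j the sum over the H with |H| = q^j |G|
    of #{y in H : H/<y> ~ G} / |Aut H| is 1 / |Aut G|: if G is the cokernel of S,
    then a pair (H, y) together with lifts of the generators of G is the cokernel
    of [[S, 0], [r, w^j]], where w is a uniformizer and r is an arbitrary row.
    Summing over j gives a geometric series of ratio q^-(u+1).

    The uniformizer.  If l is the prime number in p, some b outside l O satisfies
    b p <= l O.  As O is integrally closed, b p <= l p is impossible, so b w = l v
    with w in p and v outside p, whence v p <= w O. *)

From HB Require Import structures.
Require Import Defs.
From mathcomp Require Import all_boot all_order all_algebra perm fieldext.
From mathcomp Require Import finmap.
From mathcomp Require Import all_classical all_reals all_analysis.
From mathcomp Require Import finset mxabelem ring lra zify.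

Set Implicit Arguments.
Unset Strict Implicit.
Unset Printing Implicit Defensive.

Import Order.TTheory GRing.Theory Num.Theory.
Import numFieldNormedType.Exports.

Local Open Scope ring_scope.

(** The fixed matrix E has rank N - dim G[p], which grows with N. A limit for each fixed rank would
    therefore say nothing: the recursion must carry an error that is uniform in the rank, and 2 m /
    q^N for rank m is small enough even for m close to N. B has length F + 1 while p^F kills G. This
    spare power is what makes every Y with ker (Y X) = ker X invertible, so that the stabilizers are
    full cosets and their order is exactly |G|^N. No classification of modules by partitions enters.
    Over B every finite module is the cokernel of a square matrix T, and a dual matrix T', with ker
    T = im T' and ker T' = im T, replaces the injectivity of B. In the second part each row r has
    exactly one isomorphism class of cokernels, so a sum over the classes H turns into a count of
    all |B|^N rows. There the ring varies with j: if p^m G = 0, an extension by a cyclic module of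
    length j is killed by p^(m+j), and B is O / p^(m+j+1). *)

Lemma card_fibers (T U : finType) (f : T -> U) (A : {set T}) (C : {set U}) m :
  (forall a, a \in A -> f a \in C) ->
  (forall c, c \in C -> #|[set a in A | f a == c]| = m) ->
  #|A| = (m * #|C|)%N.
Proof.
move=> fA fC; rewrite -sum1_card (partition_big f (mem C))//=.
transitivity (\sum_(c in C) m)%N; last by rewrite sum_nat_const mulnC.
by apply: eq_bigr => c /fC <-; rewrite sum1dep_card; apply: eq_card => a; rewrite !inE.
Qed.

Lemma card_sum_pair (T U V : finType) (f : T * U -> V) (P : pred V) :
  bijective f -> #|[set v | P v]| = (\sum_x #|[set y | P (f (x, y))]|)%N.
Proof.
move=> bf; transitivity #|[set z | P (f z)]|.
  rewrite -(card_imset _ (bij_inj bf)); case: bf => g fK gK.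
  apply: eq_card => v; apply/idP/imsetP.
    by rewrite inE => Pv; exists (g v); rewrite ?inE gK.
  by case=> z; rewrite !inE => Pz ->.
rewrite -sum1dep_card; transitivity (\sum_x \sum_(y | P (f (x, y))) 1)%N.
  by rewrite pair_big_dep; apply: eq_bigl => -[].
by apply: eq_bigr => x _; rewrite sum1dep_card.
Qed.

Lemma card_left_kernel (k : finFieldType) m n (A : 'M[k]_(m, n)) :
  #|[set u : 'rV[k]_m | u *m A == 0]| = (#|k| ^ (m - \rank A))%N.
Proof.
rewrite -mxrank_ker -card_rowg; apply: eq_card => u.
by rewrite !inE; apply/eqP/sub_kermxP.
Qed.

(** * Invertible matrices with an invertible translate *)

Section ShiftedUnits.
Variable k : finFieldType.

Definition nshift n (E : 'M[k]_n) : nat :=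
  #|[set Z : 'M[k]_n | (Z \in unitmx) && (Z + E \in unitmx)]|.

Lemma nshift_equiv n (P Q E : 'M[k]_n) :
  P \in unitmx -> Q \in unitmx -> nshift (P *m E *m Q) = nshift E.
Proof.
move=> uP uQ; rewrite /nshift.
have inj : injective (fun Z : 'M[k]_n => P *m Z *m Q).
  apply: (can_inj (g := fun Z => invmx P *m Z *m invmx Q)) => Z.
  by rewrite !mulmxA mulVmx// mul1mx mulmxK.
rewrite -[RHS](card_imset _ inj); apply: eq_card => Z; apply/idP/imsetP.
  rewrite inE => /andP[uZ uE]; exists (invmx P *m Z *m invmx Q).
    rewrite inE !unitmx_mul !unitmx_inv uP uQ uZ /=.
    suff -> : invmx P *m Z *m invmx Q + E
        = invmx P *m (Z + P *m E *m Q) *m invmx Q.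
      by rewrite !unitmx_mul !unitmx_inv uP uQ uE.
    by rewrite mulmxDr mulmxDl !mulmxA mulVmx// mul1mx mulmxK.
  by rewrite !mulmxA mulmxV// mul1mx mulmxKV.
case=> Y; rewrite inE => /andP[uY uE] ->.
by rewrite inE -mulmxDl -mulmxDr !unitmx_mul uP uQ uY uE.
Qed.

Lemma nshift_rank n (E E' : 'M[k]_n) :
  \rank E = \rank E' -> nshift E = nshift E'.
Proof.
move=> eE.
rewrite -(mulmx_ebase E) -(mulmx_ebase E') eE.
by rewrite !nshift_equiv ?row_ebase_unit ?col_ebase_unit.
Qed.

Section Cofactor.
Variables (n : nat) (Y : 'M[k]_(n + 1, n)).

(** The cofactors along the last column, that is the linear form z -> det [Y | z]. The zero column
    is a placeholder: these cofactors only see Y. *)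
Definition last_cof : 'rV[k]_(n + 1) :=
  row (rshift n 0) (\adj (row_mx Y 0)).

Lemma last_cofE (z : 'cV[k]_(n + 1)) :
  last_cof = row (rshift n 0) (\adj (row_mx Y z)).
Proof.
apply/rowP => j; rewrite !mxE /cofactor; congr (_ * \det _).
apply/matrixP => a b; rewrite !mxE; case: splitP => // c.
case: c => c lc /= Ec; exfalso; move: Ec.
by rewrite /bump; case: b => b lb /=; case: leqP; lia.
Qed.

Lemma last_cof_mul (z : 'cV[k]_(n + 1)) :
  last_cof *m row_mx Y z = row_mx 0 (\det (row_mx Y z))%:M.
Proof.
rewrite (last_cofE z) -row_mul mul_adj_mx; apply/rowP => j.
rewrite !mxE; case: splitP => c Ec; rewrite !mxE.
  rewrite -val_eqE /= Ec; case: eqP => //; case: c {Ec} => c /=; lia.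
by rewrite -val_eqE /= Ec (ord1 c) /= addn0 eqxx.
Qed.

Lemma last_cof_col : last_cof *m Y = 0.
Proof.
have := last_cof_mul 0; rewrite mul_mx_row => /eq_row_mx[]//.
Qed.

Lemma last_cof_det z : last_cof *m z = (\det (row_mx Y z))%:M.
Proof. by have := last_cof_mul z; rewrite mul_mx_row => /eq_row_mx[]. Qed.

End Cofactor.
End ShiftedUnits.

(** * The recursion in the size and the rank *)

Section ShiftedUnitsRecursion.
Variable k : finFieldType.

Section TwoForms.
Variables (n : nat) (a b : 'rV[k]_n) (e : 'cV[k]_n).
Local Notation ev c z := ((c *m (z : 'cV[k]_n)) 0 0).

Lemma evD (c : 'rV[k]_n) (x y : 'cV[k]_n) : ev c (x + y) = ev c x + ev c y.
Proof. by rewrite mulmxDr mxE. Qed.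
Lemma evZ (c : 'rV[k]_n) t (x : 'cV[k]_n) : ev c (t *: x) = t * ev c x.
Proof. by rewrite -scalemxAr mxE. Qed.

Lemma card_hyperplane (c : k) : ev a e != 0 ->
  #|[set z : 'cV[k]_n | ev a z == c]| = (#|k| ^ n.-1)%N.
Proof.
move=> ae; have k0 : (0 < #|k|)%N by apply/card_gt0P; exists 0.
pose m d := #|[set z : 'cV[k]_n | ev a z == d]|.
have mE d : m d = m c.
  pose s := ((c - d) / ev a e) *: e.
  have inj : injective (fun z : 'cV[k]_n => z + s) := addIr s.
  rewrite /m -[LHS](card_imset _ inj) /s.
  apply: eq_card => z; apply/imsetP/idP.
    case=> x; rewrite !inE => /eqP ax ->.
    by rewrite evD evZ divfK// ax addrC subrK.
  rewrite inE => /eqP az; exists (z - ((c - d) / ev a e) *: e).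
    by rewrite inE -scaleNr evD evZ mulNr divfK// az opprB addrC subrK.
  by rewrite subrK.
have := @card_fibers _ _ (fun z : 'cV[k]_n => ev a z) [set: _] [set: k] (m c).
have n0 : (0 < n)%N.
  by case: (n) a e ae => // a' e'; rewrite mxE big_ord0 eqxx.
have qn : (#|k| ^ n = #|k| ^ n.-1 * #|k|)%N by rewrite -expnSr prednK.
rewrite !cardsT card_mx muln1 qn => /(_ (fun _ _ => in_setT _)) H.
apply/eqP; rewrite -(eqn_pmul2r k0) -[X in (X * _)%N]/(m c) -H// => d _.
by rewrite -(mE d); apply: eq_card => z; rewrite !inE.
Qed.

(** A vector z0 with a z0 = 0 and b z0 = b e gives a translation that exchanges the two conditions.
    Such a z0 exists unless a and b are proportional and neither vanishes at e; in that case both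
    conditions concern a alone, and they differ by the hyperplane a z = - a e. *)
Lemma card_two_forms :
  #|[set z : 'cV[k]_n | (ev a z != 0) && (ev b z != 0)]| =
  (#|[set z : 'cV[k]_n | (ev a z != 0)%R && (ev b (z + e) != 0)%R]| +
   #|k| ^ n.-1 * [&& ev a e != 0, ev b e != 0 & ev a e *: b == ev b e *: a]%R)%N.
Proof.
have shift z0 : ev a z0 = 0 -> ev b z0 = ev b e ->
    #|[set z : 'cV[k]_n | (ev a z != 0) && (ev b z != 0)]| =
    #|[set z : 'cV[k]_n | (ev a z != 0) && (ev b (z + e) != 0)]|.
  move=> az0 bz0; have inj : injective (fun z : 'cV[k]_n => z + z0) := addIr z0.
  rewrite -[RHS](card_imset _ inj).
  apply: eq_card => z; apply/idP/imsetP.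
    rewrite inE => /andP[az bz]; exists (z - z0); last by rewrite subrK.
    rewrite inE !evD -scaleN1r !evZ az0 mulr0 addr0 az bz0 mulN1r subrK.
    exact: bz.
  case=> x; rewrite !inE => /andP[ax bx] ->.
  by move: bx; rewrite !evD az0 addr0 bz0 ax.
case: eqP => [ae|/eqP ae]; first by rewrite muln0 addn0 (shift e).
case: eqP => [be|/eqP be].
  by rewrite muln0 addn0 (shift 0)// ?be mulmx0 mxE.
case: eqP => [ab|/eqP ab]; last first.
  have [z az bz] : exists2 z : 'cV[k]_n, ev a z = 0 & ev b z != 0.
    have [j Hj] : exists j, ev a e * b 0 j != ev b e * a 0 j.
      apply/existsP; apply: contraNT ab => /existsPn H.
      apply/eqP/rowP => j; rewrite [LHS]mxE [RHS]mxE.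
      by apply/eqP; rewrite -[_ == _]negbK; apply: H.
    pose x : 'cV[k]_n := delta_mx j 0.
    have evx c : ev c x = c 0 j by rewrite -colE mxE.
    exists (x - (ev a x / ev a e) *: e).
      by rewrite -scaleNr evD evZ mulNr divfK// subrr.
    rewrite -scaleNr evD evZ mulNr !evx subr_eq0 mulrAC.
    apply: contraNneq Hj => ->.
    by rewrite mulrCA mulfV// mulr1 mulrC.
  rewrite muln0 addn0 (shift ((ev b e / ev b z) *: z))//.
    by rewrite evZ az mulr0.
  by rewrite evZ divfK.
have bE z : ev b z = ev b e / ev a e * ev a z.
  have evZl t (c : 'rV[k]_n) : ev (t *: c) z = t * ev c z.
    by rewrite -scalemxAl mxE.
  apply: (mulfI ae); have := congr1 (fun c : 'rV_n => ev c z) ab.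
  by rewrite /= !evZl => ->; rewrite mulrA mulrCA mulfV// mulr1.
rewrite muln1 -(card_hyperplane (- ev a e) ae).
have nz0 : ev b e / ev a e != 0 by rewrite mulf_neq0// invr_eq0.
have bE0 z : (ev b z == 0) = (ev a z == 0) by rewrite bE mulf_eq0 (negPf nz0).
pose D := [set z : 'cV[k]_n | ev b (z + e) == 0].
rewrite -[LHS](cardsID D) addnC.
have -> : #|[set z | ev a z != 0 & ev b z != 0] :\: D| =
    #|[set z : 'cV[k]_n | (ev a z != 0) && (ev b (z + e) != 0)]|.
  by apply: eq_card => z; rewrite !inE !bE0 andbb andbC.
have -> // : #|[set z | ev a z != 0 & ev b z != 0] :&: D| =
    #|[set z : 'cV[k]_n | ev a z == - ev a e]|.
apply: eq_card => z; rewrite !inE !bE0 evD addr_eq0 andbb.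
by case: (_ =P - _) => [->|]; rewrite ?andbF// oppr_eq0 ae.
Qed.
End TwoForms.
End ShiftedUnitsRecursion.

Section ShiftedUnitsBlock.
Variables (k : finFieldType) (n : nat) (E : 'M[k]_n).

Let Ecol : 'M[k]_(n + 1, n) := col_mx E 0.
Let elast : 'cV[k]_(n + 1) := col_mx 0 1%:M.

Lemma last_cof_last (Y : 'M[k]_(n + 1, n)) :
  (last_cof Y *m elast) 0 0 = \det (usubmx Y).
Proof.
rewrite last_cof_det mxE eqxx mulr1n -{1}(vsubmxK Y) -block_mxEh.
by rewrite det_lblock det1 mulr1.
Qed.

(* The columns Y that count for the difference between the corner entries 0
   and 1: Y and Y + Ecol are injective with the same image, which misses elast. *)
Let kappa (Y : 'M[k]_(n + 1, n)) :=
  let a := last_cof Y in let b := last_cof (Y + Ecol) in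
  [&& (a *m elast) 0 0 != 0, (b *m elast) 0 0 != 0 &
    (a *m elast) 0 0 *: b == (b *m elast) 0 0 *: a].

(** Z is cut as [Y | z]. For fixed Y both determinants are linear forms in z, and the corner entry c
    only shifts the argument of the second one. *)
Lemma nshift_block_sum (c : k) : nshift (block_mx E 0 0 c%:M : 'M[k]_(n + 1)) =
  (\sum_(Y : 'M[k]_(n + 1, n)) #|[set z : 'cV[k]_(n + 1) |
     ((last_cof Y *m z) 0 0 != 0)%R &&
     ((last_cof (Y + Ecol) *m (z + c *: elast)) 0 0 != 0)%R]|)%N.
Proof.
have bf : bijective (fun p : 'M[k]_(n + 1, n) * 'cV[k]_(n + 1) => row_mx p.1 p.2).
  exists (fun Z => (lsubmx Z, rsubmx Z)) => [[Y z]|Z] /=.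
    by rewrite row_mxKl row_mxKr.
  by rewrite hsubmxK.
rewrite /nshift (card_sum_pair _ bf); apply: eq_bigr => Y _.
apply: eq_card => z; rewrite !inE /= !last_cof_det !unitmxE !unitfE.
rewrite ![(_%:M) 0 0]mxE !eqxx !mulr1n; congr (_ && (\det _ != 0)).
rewrite scale_col_mx scaler0 scale_scalar_mx mulr1.
by rewrite block_mxEh add_row_mx.
Qed.

(** If the top block Y is invertible, the cofactor row of [Y; Y2] is proportional to (u, 1), where
    Y2 = - u Y. Proportionality with the cofactor row of [Y + E; Y2] says that the same u serves Y +
    E, that is u E = 0. *)
Lemma card_kappa :
  #|[set Y | kappa Y]| = (#|k| ^ (n - \rank E) * nshift E)%N.
Proof.
rewrite -card_left_kernel /nshift mulnC -cardsX.
pose f (p : 'M[k]_n * 'rV[k]_n) : 'M[k]_(n + 1, n) := col_mx p.1 (- (p.2 *m p.1)).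
have inj : {in setX [set Z : 'M[k]_n | (Z \in unitmx) && (Z + E \in unitmx)]
                [set u : 'rV[k]_n | u *m E == 0] &, injective f}.
  move=> [Y a] [Y' a']; rewrite !inE /= => /andP[/andP[uY _] _] _.
  move=> /eq_col_mx[/= eY1 /oppr_inj /= eY]; subst Y'; congr (_, _).
  by rewrite -(mulmxK uY a) eY mulmxK.
rewrite -(card_in_imset inj); apply: eq_card => Y; rewrite inE.
rewrite -(vsubmxK Y); move: (usubmx Y) (dsubmx Y) => {}Y Y2.
have sumE : col_mx Y Y2 + Ecol = col_mx (Y + E) Y2 by rewrite add_col_mx addr0.
have cofE Z : last_cof (col_mx Z Y2) =
    row_mx (lsubmx (last_cof (col_mx Z Y2))) (\det Z)%:M.
  rewrite -{1}(hsubmxK (last_cof _)); congr row_mx; apply/rowP => j.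
  have := last_cof_last (col_mx Z Y2); rewrite col_mxKu.
  rewrite -{1}(hsubmxK (last_cof _)) mul_row_col mulmx0 add0r mulmx1.
  by rewrite (ord1 j) => ->; rewrite mxE eqxx.
have cof0 Z : lsubmx (last_cof (col_mx Z Y2)) *m Z = - (\det Z *: Y2).
  have := last_cof_col (col_mx Z Y2).
  rewrite cofE mul_row_col mul_scalar_mx row_mxKl => /eqP.
  by rewrite addr_eq0 => /eqP.
rewrite /kappa sumE !last_cof_last !col_mxKu (cofE Y) (cofE (Y + E)).
move: (cof0 Y) (cof0 (Y + E)).
move: (lsubmx (last_cof (col_mx (Y + E) Y2))) => b.
move: (lsubmx (last_cof (col_mx Y Y2))) => a aY bY.
apply/idP/imsetP.
  case/and3P => dY dYE /eqP; rewrite !scale_row_mx => /eq_row_mx[ab _].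
  have uY : Y \in unitmx by rewrite unitmxE unitfE.
  exists (Y, (\det Y)^-1 *: a); last first.
    by rewrite /f /= -scalemxAl aY scalerN opprK scalerA mulVf// scale1r.
  rewrite !inE /= uY unitmxE unitfE dYE /=.
  rewrite -scalemxAl scaler_eq0; apply/orP; right.
  have : \det (Y + E) *: (a *m (Y + E)) = \det (Y + E) *: (a *m Y).
    rewrite scalemxAl -ab -scalemxAl bY aY !scalerN !scalerA.
    by rewrite mulrC.
  by move/(scalerI dYE)/eqP; rewrite mulmxDr -subr_eq0 addrAC subrr add0r.
case=> -[Y' u]; rewrite !inE /= => /andP[/andP[uY uYE] /eqP uE].
rewrite /f /= => /eq_col_mx[eY eY2]; subst Y' Y2.
rewrite !scale_row_mx !scale_scalar_mx.
rewrite unitmxE unitfE in uY; rewrite unitmxE unitfE in uYE.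
rewrite uY uYE /=; apply/eqP; congr row_mx; last by rewrite mulrC.
have -> : a = \det Y *: u.
  apply: (@row_free_inj _ _ _ _ Y); first by rewrite row_free_unit unitmxE unitfE.
  by rewrite aY scalerN opprK scalemxAl.
have -> : b = \det (Y + E) *: u.
  apply: (@row_free_inj _ _ _ _ (Y + E)).
    by rewrite row_free_unit unitmxE unitfE.
  by rewrite bY scalerN opprK -scalemxAl mulmxDr uE addr0.
by rewrite !scalerA mulrC.
Qed.

Lemma nshift_block : nshift (block_mx E 0 0 0 : 'M[k]_(n + 1)) =
  (nshift (block_mx E 0 0 1%:M : 'M[k]_(n + 1)) +
   #|k| ^ n * #|k| ^ (n - \rank E) * nshift E)%N.
Proof.
have -> : (0 : 'M[k]_1) = 0%:M by rewrite raddf0.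
have <- : (\sum_Y #|k| ^ n * kappa Y)%N =
    (#|k| ^ n * #|k| ^ (n - \rank E) * nshift E)%N.
  rewrite -big_distrr -mulnA -card_kappa -sum1dep_card [in RHS]big_mkcond /=.
  by congr (_ * _)%N; apply: eq_bigr => Y _; case: (kappa Y).
rewrite !nshift_block_sum -big_split; apply: eq_bigr => Y _ /=.
rewrite scale1r scale0r; under eq_finset do rewrite addr0.
have n1 : (n + 1).-1 = n by rewrite addn1.
by rewrite (card_two_forms _ _ elast) n1.
Qed.
End ShiftedUnitsBlock.

(** * The proportion of invertible translates and its limit *)

Section ShiftedUnitsLimit.
Variables (R : realType) (k : finFieldType).
Local Notation q := (#|k|%:R : R).

Definition nunits n : nat := #|[set Z : 'M[k]_n | Z \in unitmx]|.

Lemma card_field_gt1 : (1 < #|k|)%N.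
Proof. exact: card_finNzRing_gt1. Qed.

Lemma nunitsE n :
  nunits n = (#|k| ^ 'C(n, 2) * \prod_(1 <= i < n.+1) (#|k| ^ i - 1))%N.
Proof.
case: n => [|n].
  rewrite big_geq// muln1 bin_small// expn0 /nunits -[RHS](card_mx k 0 0).
  by apply: eq_card => Z; rewrite !inE unitmxE det_mx00 unitr1.
rewrite -card_GL// cardsT /nunits.
rewrite -(card_imset _ (val_inj : injective (val : {'GL_n.+1[k]} -> _))).
apply: eq_card => Z; rewrite !inE; apply/idP/imsetP => [uZ|[z _ ->]].
  by exists (insubd (1%g : {'GL_n.+1[k]}) Z) => //; rewrite insubdK.
exact: valP z.
Qed.

Lemma nunits_gt0 n : (0 < nunits n)%N.
Proof. by apply/card_gt0P; exists 1%:M; rewrite inE unitmx1. Qed.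

Lemma nunitsS n :
  nunits (n + 1) = ((#|k| ^ (n + 1) - 1) * #|k| ^ n * nunits n)%N.
Proof.
rewrite !nunitsE addn1 big_nat_recr//= binS bin1 expnD.
move: (_ - _)%N (\prod_(_ <= _ < _) _)%N => a b.
by rewrite mulnCA -!mulnA mulnC mulnAC; ring.
Qed.

Definition shift_ratio n m : R :=
  (nshift (pid_mx m : 'M[k]_n))%:R / (nunits n)%:R.

Lemma shift_ratioE n (E : 'M[k]_n) :
  (nshift E)%:R = shift_ratio n (\rank E) * (nunits n)%:R.
Proof.
rewrite /shift_ratio divfK ?pnatr_eq0 -?lt0n ?nunits_gt0//.
by rewrite (nshift_rank (E' := E))// rank_pid_mx// rank_leq_row.
Qed.

Lemma shift_ratio_ge0 n m : 0 <= shift_ratio n m.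
Proof. by rewrite divr_ge0. Qed.

Lemma shift_ratio_le1 n m : shift_ratio n m <= 1.
Proof.
rewrite ler_pdivrMr ?ltr0n ?nunits_gt0// mul1r ler_nat.
by apply: subset_leq_card; apply/fintype.subsetP => Z; rewrite !inE => /andP[].
Qed.

Lemma shift_ratio0 n : shift_ratio n 0 = 1.
Proof.
rewrite /shift_ratio pid_mx_0 /nshift.
under eq_finset do rewrite addr0 andbb.
by rewrite divff// pnatr_eq0 -lt0n nunits_gt0.
Qed.

(** This is [nshift_block] for E of rank m, divided by the order of GL_(n+1); the factor q^n cancels
    against the one in [nunitsS]. *)
Lemma shift_ratioS n m : (m <= n)%N -> shift_ratio (n + 1) m.+1 =
  shift_ratio (n + 1) m - q ^+ (n - m) / (q ^+ (n + 1) - 1) * shift_ratio n m.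
Proof.
move=> mn; pose E : 'M[k]_n := pid_mx m.
have rE : \rank E = m by rewrite rank_pid_mx.
have F0 : nshift (pid_mx m : 'M[k]_(n + 1)) =
    nshift (block_mx E 0 0 0 : 'M[k]_(n + 1)).
  apply: nshift_rank; rewrite rank_pid_mx; [|lia|lia].
  by rewrite rank_diag_block_mx rE mxrank0 addn0.
have F1 : nshift (pid_mx m.+1 : 'M[k]_(n + 1)) =
    nshift (block_mx E 0 0 1%:M : 'M[k]_(n + 1)).
  apply: nshift_rank; rewrite rank_pid_mx; [|lia|lia].
  by rewrite rank_diag_block_mx rE mxrank1 addn1.
have q1 : 1 < q by rewrite ltr1n card_field_gt1.
have q0 : q != 0 by rewrite gt_eqF// (lt_trans _ q1).
have qn1 : q ^+ (n + 1) - 1 != 0.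
  by rewrite gt_eqF// subr_gt0 exprn_egt1// addn1.
have un : (nunits n)%:R != 0 :> R by rewrite pnatr_eq0 -lt0n nunits_gt0.
rewrite /shift_ratio F0 F1 nshift_block rE nunitsS !natrD !natrM.
rewrite natrB ?expn_gt0 ?(ltnW card_field_gt1)// !natrX -/E.
field; rewrite un qn1 ?expf_neq0//.
Qed.

Lemma mul2n_le_exp2 m : (m.*2 <= 2 ^ m)%N.
Proof. elim: m => // m IH; rewrite expnS mul2n; case: m IH => // m; lia. Qed.

Definition qpoch m : R := \prod_(1 <= i < m.+1) (1 - q ^- i).

Lemma qpochS m : qpoch m.+1 = qpoch m * (1 - q ^- m.+1).
Proof. by rewrite /qpoch big_nat_recr. Qed.

(** The coefficient in the recursion is q^-(m+1) (1 + 1/(q^(n+1) - 1)), so up to the last term a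
    step multiplies by 1 - q^-(m+1). Each step adds two errors of at most q^-(n+1), whence the
    constant 2. *)
Lemma shift_ratio_bound n m : (m <= n)%N ->
  `|shift_ratio n m - qpoch m| <= 2 * m%:R / q ^+ n.
Proof.
elim: m n => [|m IH] n mn.
  by rewrite shift_ratio0 /qpoch big_geq// subrr normr0 mulr0 mul0r.
case: n mn => // n mn; rewrite ltnS in mn; rewrite -[n.+1]addn1.
have q2 : 2 <= q by rewrite ler_nat card_field_gt1.
have q1 : 1 <= q by lra.
have q0 : 0 < q by lra.
have := IH n mn; have := IH (n + 1)%N (leq_trans mn (leq_addr _ _)).
rewrite shift_ratioS// qpochS.
have f0 := shift_ratio_ge0 n m; have f1 := shift_ratio_le1 n m.
move: (shift_ratio _ _) (shift_ratio _ _) f0 f1 (qpoch m) => f g f0 f1 p.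
have -> : q ^+ (n - m) / (q ^+ (n + 1) - 1) =
    q ^- m.+1 * (1 + (q ^+ (n + 1) - 1)^-1).
  have e : q ^+ (n + 1) = q ^+ (n - m) * q ^+ m.+1.
    by rewrite -exprD; congr (_ ^+ _); lia.
  have h : q ^+ (n + 1) - 1 != 0.
    by rewrite gt_eqF// subr_gt0 exprn_egt1 ?addn1//; lra.
  apply: (mulIf h); rewrite divfK// -mulrA mulrDl mul1r mulVf// subrK e.
  by rewrite mulrCA mulVf ?mulr1// expf_neq0// gt_eqF.
have -> : q ^+ n = q ^+ (n + 1) / q by rewrite addn1 exprSr mulfK// gt_eqF.
set Q := q ^+ (n + 1); set w := q ^- m.+1.
have Q2 : 2 <= Q.
  rewrite /Q addn1 exprS; apply: (le_trans q2).
  by rewrite ler_peMr ?ler0n// exprn_ege1.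
have w0 : 0 < w by rewrite invr_gt0 exprn_gt0.
(* The left side is 2 m / q^m, and 2 m <= 2^m. This damps the error of g, whose size n is one less,
   so that its bound is larger by a factor q. *)
have w1 : w * q * (2 * m%:R) <= 1.
  rewrite /w exprSr invfM divfK ?gt_eqF//. 
  rewrite mulrC ler_pdivrMr ?exprn_gt0// mul1r -natrM mul2n.
  apply: le_trans (_ : 2 ^+ m <= _); last by rewrite lerXn2r ?nnegrE; lra.
  by rewrite -natrX ler_nat mul2n_le_exp2.
have w2 : w <= 2^-1.
  rewrite lef_pV2 ?posrE ?exprn_gt0// exprS; apply: (le_trans q2).
  by rewrite ler_peMr ?ler0n// exprn_ege1.
have e0 : 0 < (Q - 1)^-1 by rewrite invr_gt0; lra.
have e2 : (Q - 1)^-1 <= 2 / Q.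
  rewrite -[X in X <= _]mul1r ler_pdivrMr; last by lra.
  by rewrite mulrAC ler_pdivlMr; lra.
rewrite invf_div => h1 h2.
have -> : f - w * (1 + (Q - 1)^-1) * g - p * (1 - w) =
    (f - p) - (w * (g - p) + w * (Q - 1)^-1 * g) by ring.
have Q0 : 0 <= Q^-1 by rewrite invr_ge0; lra.
have b1 : `|w * (g - p)| <= Q^-1.
  rewrite normrM (gtr0_norm w0); apply: le_trans (ler_wpM2l (ltW w0) h2) _.
  rewrite [leLHS](_ : _ = w * q * (2 * m%:R) * Q^-1); last by ring.
  by rewrite ler_piMl.
have b2 : `|w * (Q - 1)^-1 * g| <= Q^-1.
  rewrite !normrM (gtr0_norm w0) (gtr0_norm e0) (ger0_norm f0).
  apply: (@le_trans _ _ (2^-1 * (2 / Q) * 1)); last by lra.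
  by rewrite !ler_pM// ?mulr_ge0// ltW.
apply: le_trans (ler_normB _ _) _; apply: le_trans (lerD h1 (ler_normD _ _)) _.
have -> : 2 * m.+1%:R / Q = 2 * m%:R / Q + (Q^-1 + Q^-1).
  by rewrite -[m.+1%:R]natr1; ring.
lra.
Qed.
End ShiftedUnitsLimit.

Section ShiftedUnitsCvg.
Local Open Scope classical_set_scope.
Variables (R : realType) (k : finFieldType).
Local Notation q := (#|k|%:R : R).

Lemma card_field_ge2 : 2 <= q.
Proof. by rewrite ler_nat card_field_gt1. Qed.

Lemma qpoch_factor_gt0 i : (0 < i)%N -> 0 < 1 - q ^- i.
Proof.
move=> i0; rewrite subr_gt0 invf_lt1 ?exprn_egt1 ?exprn_gt0// -?lt0n//;
  have := card_field_ge2; lra.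
Qed.

Lemma qpoch_gt0 m : 0 < qpoch R k m.
Proof.
rewrite /qpoch big_seq_cond; apply: prodr_gt0 => i; rewrite mem_index_iota andbT.
by case/andP => i0 _; apply: qpoch_factor_gt0.
Qed.

Lemma qpoch_cvg : qpoch R k @ \oo --> limn (qpoch R k).
Proof.
apply: nonincreasing_is_cvgn; last first.
  by exists 0 => _ [n _ <-]; apply/ltW/qpoch_gt0.
by apply/nonincreasing_seqP => n; rewrite qpochS ler_piMr ?(ltW (qpoch_gt0 _))// gerBl.
Qed.

(** By Bernoulli's inequality 1 + n/2 <= (3/2)^n, so n <= 2 (3/4)^n 2^n, and 2 <= q. *)
Lemma cvg_natr_div_expr : (n%:R / q ^+ n : R) @[n --> \oo] --> (0 : R).
Proof.
have h : (2 * (3 / 4) ^+ n : R) @[n --> \oo] --> (0 : R).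
  by apply: (@cvg_geometric R 2 (3 / 4)); rewrite gtr0_norm; lra.
apply: (squeeze_cvgr _ (cvg_cst 0) h).
near=> n; have q2 := card_field_ge2.
rewrite divr_ge0 ?exprn_ge0 ?ler0n//= ler_pdivrMr ?exprn_gt0//; last by lra.
apply: (@le_trans _ _ (2 * (3 / 4) ^+ n * 2 ^+ n)); last first.
  rewrite ler_wpM2l ?lerXn2r ?nnegrE ?mulr_ge0 ?exprn_ge0//; lra.
rewrite -mulrA -exprMn (_ : 3 / 4 * 2 = 1 + 2^-1); last by lra.
have : 1 + n%:R / 2 <= (1 + 2^-1) ^+ n :> R.
  elim: (n) => [|j IH]; first by rewrite mul0r addr0 expr0.
  rewrite exprS -natr1.
  have := ler_wpM2l (_ : 0 <= 1 + 2^-1) IH; have := ler0n R j; lra.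
lra.
Unshelve. all: by end_near.
Qed.

(** The rank n - r follows n; the uniform bound 2 (n - r) / q^n still tends to 0. The number r will
    be the dimension of G[p]. *)
Lemma shift_ratio_cvg r :
  shift_ratio R k n (n - r) @[n --> \oo] --> limn (qpoch R k).
Proof.
have h1 : qpoch R k (n - r) @[n --> \oo] --> limn (qpoch R k).
  by rewrite -(cvg_shiftn r); under eq_fun do rewrite addnK; exact: qpoch_cvg.
have h2 : (shift_ratio R k n (n - r) - qpoch R k (n - r)) @[n --> \oo] --> (0 : R).
  apply/norm_cvg0P.
  have h : (2 * (n%:R / q ^+ n) : R) @[n --> \oo] --> (0 : R).
    by rewrite -[X in _ --> X](mulr0 (2 : R)); apply: cvgMr; exact: cvg_natr_div_expr.
  apply: (squeeze_cvgr _ (cvg_cst 0) h).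
  near=> n; rewrite normr_ge0 /=.
  apply: le_trans (shift_ratio_bound _ _ (leq_subr _ _)) _.
  rewrite mulrA ler_pM2r ?invr_gt0 ?exprn_gt0//; last by have := card_field_ge2; lra.
  by rewrite ler_pM2l// ler_nat leq_subr.
rewrite [X in X @ _](_ : _ = fun n => shift_ratio R k n (n - r) -
  qpoch R k (n - r) + qpoch R k (n - r)); last by apply/funext => n; rewrite subrK.
by rewrite -[X in _ --> X]add0r; exact: cvgD h2 h1.
Unshelve. all: by end_near.
Qed.
End ShiftedUnitsCvg.

(** * Modules over finite chain rings *)

(* rho is the residue map, w a uniformizer and F + 1 the length of B. *)
Record chain_ring (B : finComUnitRingType) (k : finFieldType)
    (rho : {rmorphism B -> k}) (w : B) (F : nat) : Prop := ChainRing {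
  chain_surj : forall y, exists x, rho x = y;
  chain_ker : forall x, rho x = 0 <-> exists y, x = w * y;
  chain_unit : forall x, (x \is a GRing.unit) = (rho x != 0);
  chain_nil : w ^+ F.+1 = 0;
  chain_neq0 : w ^+ F != 0 }.

Definition is_diagonal (B : nmodType) m n (D : 'M[B]_(m, n)) :=
  forall (i : 'I_m) (j : 'I_n), i != j :> nat -> D i j = 0.

(** Since divisibility is total, some entry divides all the others. Moved to the corner, it clears
    its row and column without division with remainder, and zero divisors do no harm because only
    the existence of quotients is used. *)
Lemma chain_smith (B : comUnitRingType)
    (dvd_total : forall a b : B, (exists c, b = a * c) \/ (exists c, a = b * c))
    m n (X : 'M[B]_(m, n)) :
  exists P D Q, [/\ P \in unitmx, Q \in unitmx, is_diagonal D & X = P *m D *m Q].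
Proof.
have dvd_min (s : seq B) : s != [::] ->
    exists2 a, a \in s & forall b, b \in s -> exists c, b = a * c.
  elim: s => // x [|y s] IH _.
    exists x; rewrite ?mem_head// => b; rewrite inE => /eqP->.
    by exists 1; rewrite mulr1.
  have [//|a ain aP] := IH; case: (dvd_total a x) => [[c ax]|[c xa]].
    exists a; first by rewrite inE ain orbT.
    by move=> b; rewrite inE => /predU1P[->|/aP//]; exists c.
  exists x; rewrite ?mem_head// => b; rewrite inE => /predU1P[->|/aP[d ->]].
    by exists 1; rewrite mulr1.
  by exists (c * d); rewrite mulrA -xa.
elim: m n X => [|m IH] n X.
  exists 1%:M, X, 1%:M; rewrite !unitmx1 mul1mx mulmx1; split=> //.
  by case.
case: n X => [|n] X.
  exists 1%:M, X, 1%:M; rewrite !unitmx1 mul1mx mulmx1; split=> //.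
  by move=> i [].
have [|a ain aP] := dvd_min [seq X p.1 p.2 | p : 'I_m.+1 * 'I_n.+1].
  by rewrite -size_eq0 size_image card_prod !card_ord.
case/fintype.imageP: ain => -[i0 j0] _ /= aE.
pose Y : 'M[B]_(1 + m, 1 + n) := xrow 0 i0 (xcol 0 j0 X).
have Y00 : Y 0 0 = a by rewrite !mxE !tpermL.
have YP i j : exists c, Y i j == a * c.
  have [|c ec] := aP (Y i j); last by exists c; apply/eqP.
  apply/fintype.imageP; exists (tperm 0 i0 i, tperm 0 j0 j) => //=.
  by rewrite !mxE.
have XE : X = xrow 0 i0 (xcol 0 j0 Y).
  by apply/matrixP => i j; rewrite !mxE !tpermK.
clearbody Y.
pose c i j := xchoose (YP i j).
have cE i j : Y i j = a * c i j by apply/eqP/(xchooseP (YP i j)).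
pose l : 'cV[B]_m := \col_i c (rshift 1 i) 0.
pose r : 'rV[B]_n := \row_j c 0 (rshift 1 j).
pose Z : 'M[B]_(m, n) := drsubmx Y - l *m (a *: r).
have YE : Y = block_mx 1%:M 0 l 1%:M *m block_mx a%:M 0 0 Z
              *m block_mx 1%:M r 0 1%:M.
  rewrite !mulmx_block !(mul1mx, mulmx1, mul0mx, mulmx0, addr0, add0r).
  rewrite mul_scalar_mx -mulmxA mul_scalar_mx addrC subrK -{1}(submxK Y).
  congr block_mx.
  - by apply/matrixP => i j; rewrite !ord1 !mxE eqxx mulr1n -Y00; congr (Y _ _); apply/val_inj.
  - apply/matrixP => i j; rewrite !mxE !ord1 -cE; congr (Y _ _); exact/val_inj.
  - by apply/matrixP => i j; rewrite mul_mx_scalar !mxE !ord1 -cE; congr (Y _ _); exact/val_inj.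
have [P [D [Q [uP uQ dD ZE]]]] := IH n Z.
have ul (A : 'cV[B]_m) : block_mx 1%:M 0 A 1%:M \in unitmx.
  by rewrite unitmxE det_lblock !det1 mulr1 unitr1.
have ur (A : 'rV[B]_n) : block_mx 1%:M A 0 1%:M \in unitmx.
  by rewrite unitmxE det_ublock !det1 mulr1 unitr1.
have ud j (A : 'M[B]_j) : A \in unitmx -> block_mx (1%:M : 'M[B]_1) 0 0 A \in unitmx.
  by rewrite !unitmxE det_lblock det1 mul1r.
exists (tperm_mx 0 i0 *m (block_mx 1%:M 0 l 1%:M : 'M[B]_(1 + m)) *m (block_mx 1%:M 0 0 P : 'M[B]_(1 + m))).
exists (block_mx (a%:M : 'M[B]_1) 0 0 D : 'M[B]_(1 + m, 1 + n)).
exists ((block_mx 1%:M 0 0 Q : 'M[B]_(1 + n)) *m (block_mx 1%:M r 0 1%:M : 'M[B]_(1 + n)) *m tperm_mx 0 j0).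
split.
- by rewrite !unitmx_mul unitmx_perm ul /= ud.
- by rewrite !unitmx_mul unitmx_perm ur andbT /= ud.
- move=> i j; rewrite !mxE; case: splitP => i' ->; rewrite mxE; case: splitP => j' ->.
  + by rewrite !ord1 eqxx.
  + by rewrite mxE.
  + by rewrite mxE.
  + by rewrite eqn_add2l => /dD.
have mid : block_mx 1%:M 0 0 P *m block_mx a%:M 0 0 D *m block_mx 1%:M 0 0 Q
    = block_mx a%:M 0 0 Z :> 'M[B]_(1 + m, 1 + n).
  by rewrite !mulmx_block !(mul1mx, mulmx1, mul0mx, mulmx0, addr0, add0r) -ZE.
rewrite XE xrowE xcolE -!mulmxA; congr (_ *m _).
rewrite YE -!mulmxA; congr (_ *m _).
by rewrite !mulmxA; congr (_ *m _ *m _); rewrite -mid.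
Qed.

Section ChainRingTheory.
Variables (B : finComUnitRingType) (k : finFieldType).
Variables (rho : {rmorphism B -> k}) (w : B) (F : nat).
Hypothesis BC : chain_ring rho w F.

(** Factors w are extracted until a unit is left. After F + 1 of them the element is 0, which is
    written [1 * w ^+ F.+1]. *)
Lemma chain_decomp x : exists u e,
  [/\ u \is a GRing.unit, (e <= F.+1)%N & x = u * w ^+ e].
Proof.
suff H n : (n <= F.+1)%N -> (exists u e,
    [/\ u \is a GRing.unit, (e <= F.+1)%N & x = u * w ^+ e])
    \/ exists y, x = w ^+ n * y.
  have [//|[y ->]] := H _ (leqnn _).
  by exists 1, F.+1; rewrite unitr1 (chain_nil BC) mulr0 mul0r.
elim: n => [|n IH] nF; first by right; exists x; rewrite expr0 mul1r.
have [|[y xE]] := IH (ltnW nF); first by left.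
have [uy|] := boolP (y \is a GRing.unit).
  by left; exists y, n; rewrite mulrC ltnW.
rewrite (chain_unit BC) negbK => /eqP/(chain_ker BC)[z yE].
by right; exists z; rewrite xE yE mulrA exprSr.
Qed.

Lemma chain_dvd_total (a b : B) : (exists c, b = a * c) \/ (exists c, a = b * c).
Proof.
have [u [e [uu _ ->]]] := chain_decomp a.
have [v [f [uv _ ->]]] := chain_decomp b.
wlog ef : u e uu v f uv / (e <= f)%N => [H|].
  have [/H h|/ltnW/H h] := leqP e f; first exact: h.
  by case: (h v uv u uu); [right|left].
left; exists (v / u * w ^+ (f - e)).
by rewrite mulrACA -exprD subnKC// [u * _]mulrC divrK.
Qed.

Lemma chain_pow_eq0 e : (w ^+ e == 0) = (F < e)%N.
Proof.
apply/idP/idP => [|Fe]; last by rewrite -(subnKC Fe) exprD (chain_nil BC) mul0r.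
apply: contraTT; rewrite -leqNgt => eF; apply: contra (chain_neq0 BC) => /eqP e0.
by rewrite -(subnKC eF) exprD e0 mul0r.
Qed.

Lemma chain_annP e x : (e <= F.+1)%N ->
  w ^+ e * x = 0 <-> exists y, x = w ^+ (F.+1 - e) * y.
Proof.
move=> eF; split=> [|[y ->]]; last first.
  by rewrite mulrA -exprD subnKC// (chain_nil BC) mul0r.
have [u [j [uu _ ->]]] := chain_decomp x.
rewrite mulrCA -exprD => /(canRL (mulKr uu)); rewrite mulr0 => /eqP.
rewrite chain_pow_eq0 => Fej; exists (u * w ^+ (j - (F.+1 - e))).
by rewrite mulrCA -exprD subnKC// leq_subLR.
Qed.

Lemma chain_ann_dual (d : B) : exists d',
  (forall x, d * x = 0 <-> exists y, x = d' * y) /\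
  (forall x, d' * x = 0 <-> exists y, x = d * y).
Proof.
have [u [e [uu eF ->]]] := chain_decomp d; exists (w ^+ (F.+1 - e)); split=> x.
  rewrite -chain_annP// -mulrA; split; last by move=> ->; rewrite mulr0.
  by move/(canRL (mulKr uu)); rewrite mulr0.
rewrite chain_annP ?leq_subr// subKn//; split=> -[y ->].
  by exists (u^-1 * y); rewrite mulrACA mulrV// mul1r.
by exists (u * y); rewrite mulrCA mulrA.
Qed.

(** Every principal ideal of B is the annihilator of its annihilator, which is principal too; this
    is applied to each diagonal entry of a Smith form. The result serves as self-injectivity of B:
    it exchanges kernels and images, for columns and for rows. *)
Lemma chain_matrix_dual n (T : 'M[B]_n) : exists T' : 'M[B]_n,
  [/\ forall v : 'cV_n, T *m v = 0 <-> exists z, v = T' *m z,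
      forall v : 'cV_n, T' *m v = 0 <-> exists z, v = T *m z,
      forall v : 'rV_n, v *m T = 0 <-> exists z, v = z *m T' &
      forall v : 'rV_n, v *m T' = 0 <-> exists z, v = z *m T].
Proof.
have [P [D [Q [uP uQ dD ->]]]] := chain_smith chain_dvd_total T.
have dualP i := cid (chain_ann_dual (D i i)).
pose D' : 'M[B]_n := diag_mx (\row_i projT1 (dualP i)).
have DE : D = diag_mx (\row_i D i i).
  apply/matrixP => i j; rewrite !mxE; case: eqP => [->|/eqP ij]; first by rewrite mulr1n.
  by rewrite dD.
have diagP (a b : 'rV[B]_n) :
    (forall i x, a 0 i * x = 0 <-> exists y, x = b 0 i * y) ->
    (forall v : 'cV_n, diag_mx a *m v = 0 <-> exists z, v = diag_mx b *m z) /\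
    (forall v : 'rV_n, v *m diag_mx a = 0 <-> exists z, v = z *m diag_mx b).
  move=> ab; split=> v; split=> [v0|[z ->]].
  - have H i : exists y, v i 0 = b 0 i * y.
      apply/ab; have := congr1 (fun M : 'cV_n => M i 0) v0.
      by rewrite mul_diag_mx !mxE.
    exists (\col_i projT1 (cid (H i))); apply/colP => i.
    by rewrite mul_diag_mx !mxE; case: cid.
  - apply/colP => i; rewrite !mul_diag_mx !mxE; apply/ab; by exists (z i 0).
  - have H i : exists y, v 0 i = b 0 i * y.
      apply/ab; have := congr1 (fun M : 'rV_n => M 0 i) v0.
      by rewrite mul_mx_diag !mxE mulrC.
    exists (\row_i projT1 (cid (H i))); apply/rowP => i.
    by rewrite mul_mx_diag !mxE mulrC; case: cid.
  - apply/rowP => i; rewrite !mul_mx_diag !mxE mulrC; apply/ab; exists (z 0 i).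
    by rewrite mulrC.
have [D1 D2] : (forall v : 'cV_n, D *m v = 0 <-> exists z, v = D' *m z) /\
    (forall v : 'rV_n, v *m D = 0 <-> exists z, v = z *m D').
  rewrite DE; apply: diagP => i x; rewrite !mxE.
  by case: (dualP i) => d /= [h _]; exact: h.
have [D3 D4] : (forall v : 'cV_n, D' *m v = 0 <-> exists z, v = D *m z) /\
    (forall v : 'rV_n, v *m D' = 0 <-> exists z, v = z *m D).
  rewrite [in X in X /\ _]DE [in X in _ /\ X]DE; apply: diagP => i x; rewrite !mxE.
  by case: (dualP i) => d /= [_ h]; exact: h.
exists (invmx Q *m D' *m invmx P); split=> v.
- split=> [|[z ->]].
    rewrite -!mulmxA => /(canRL (mulKmx uP)); rewrite mulmx0 => /D1[z zE].
    by exists (P *m z); rewrite -!mulmxA mulKmx// -zE mulKmx.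
  rewrite !mulmxA mulmxK// -!mulmxA; have [_ ->] := D1 (D' *m (invmx P *m z)).
    by rewrite mulmx0.
  by exists (invmx P *m z).
- split=> [|[z ->]].
    rewrite -!mulmxA => /(canRL (mulKVmx uQ)); rewrite mulmx0 => /D3[z zE].
    by exists (invmx Q *m z); rewrite -!mulmxA mulKVmx// -zE mulKVmx.
  rewrite !mulmxA mulmxKV// -!mulmxA; have [_ ->] := D3 (D *m (Q *m z)).
    by rewrite mulmx0.
  by exists (Q *m z).
- split=> [|[z ->]].
    rewrite !mulmxA => /(canRL (mulmxK uQ)); rewrite mul0mx => /D2[z zE].
    by exists (z *m Q); rewrite !mulmxA mulmxK// -zE mulmxK.
  rewrite !mulmxA mulmxKV//; have [_ ->] := D2 (z *m invmx Q *m D').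
    by rewrite mul0mx.
  by exists (z *m invmx Q).
- split=> [|[z ->]].
    rewrite !mulmxA => /(canRL (mulmxKV uP)); rewrite mul0mx => /D4[z zE].
    by exists (z *m invmx P); rewrite !mulmxA mulmxKV// -zE mulmxKV.
  rewrite !mulmxA mulmxK//; have [_ ->] := D4 (z *m P *m D).
    by rewrite mul0mx.
  by exists (z *m P).
Qed.
End ChainRingTheory.

(** * Presentations by square matrices, and duality *)

Lemma card_additive (V W : finZmodType) (f : {additive V -> W}) (A : {set V}) :
  (forall x y, x \in A -> y \in A -> x + y \in A) ->
  (forall x, x \in A -> - x \in A) ->
  #|A| = (#|[set x in A | (f x == 0)%R]| * #|f @: A|)%N.
Proof.
move=> AD AN; apply: (@card_fibers _ _ f) => [a aA|_ /imsetP[a aA ->]].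
  exact: imset_f.
have inj : injective (fun x : V => x + a) := addIr a.
rewrite -[RHS](card_imset _ inj); apply: eq_card => x; apply/idP/imsetP.
  rewrite inE => /andP[xA /eqP fx]; exists (x - a); last by rewrite subrK.
  by rewrite inE AD ?AN//= raddfB fx subrr.
by case=> y; rewrite !inE => /andP[yA /eqP fy] ->; rewrite AD//= raddfD fy add0r.
Qed.

Lemma card_additiveT (V W : finZmodType) (f : {additive V -> W}) :
  #|V| = (#|[set x | (f x == 0)%R]| * #|f @: [set: V]|)%N.
Proof.
rewrite -cardsT (@card_additive _ _ f)//; last by move=> *; rewrite in_setT.
by congr (_ * _)%N; apply: eq_card => x; rewrite !inE.
Qed.

Section MakeLinear.
Variables (A : nzRingType) (M N : lmodType A) (f : M -> N).
Hypothesis lf : linear f.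
Definition mklinear : {linear M -> N} :=
  HB.pack f (GRing.isLinear.Build A M N *:%R f lf).
Lemma mklinearE x : mklinear x = f x. Proof. by []. Qed.
Lemma linear_at0 : f 0 = 0. Proof. exact: linear0 mklinear. Qed.
Lemma linear_atZ a x : f (a *: x) = a *: f x. Proof. exact: linearZ_LR mklinear a x. Qed.
Lemma linear_atB x y : f (x - y) = f x - f y. Proof. exact: linearB mklinear x y. Qed.
End MakeLinear.

Section Combination.
Variables (A : nzRingType) (M : nat) (H : lmodType A) (h : 'I_M -> H).
Definition comb (v : 'cV[A]_M) : H := \sum_i v i 0 *: h i.
Lemma comb_linear : linear comb.
Proof.
move=> a u v; rewrite /comb scaler_sumr -big_split; apply: eq_bigr => i _ /=.
by rewrite !mxE scalerDl scalerA.
Qed.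
HB.instance Definition _ :=
  GRing.isLinear.Build A 'cV[A]_M H *:%R comb comb_linear.
Lemma comb_delta i : comb (delta_mx i 0) = h i.
Proof.
rewrite /comb (bigD1 i)//= big1 => [|j /negPf ji].
  by rewrite mxE !eqxx scale1r addr0.
by rewrite mxE ji scale0r.
Qed.
End Combination.

Lemma eq_comb (A : nzRingType) M (H : lmodType A) (h h' : 'I_M -> H) :
  h =1 h' -> comb h =1 comb h'.
Proof. by move=> hh v; apply: eq_bigr => i _; rewrite hh. Qed.

Lemma comb_comp (A : nzRingType) M (H H' : lmodType A) (h : 'I_M -> H)
    (s : {linear H -> H'}) v :
  comb (s \o h) v = s (comb h v).
Proof. by rewrite /comb linear_sum; apply: eq_bigr => i _ /=; rewrite linearZ. Qed.

(* H is the cokernel of T, with h i the class of the i-th basis vector. *)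
Definition presents (A : nzRingType) M (H : lmodType A) (h : 'I_M -> H)
    (T : 'M[A]_M) : Prop :=
  (forall x, exists v, x = comb h v) /\
  (forall v, comb h v = 0 <-> exists z, v = T *m z).

Lemma linear_factor (A : nzRingType) (V H H' : lmodType A)
    (f : {linear V -> H}) (g : {linear V -> H'}) :
  (forall x, exists v, x = f v) -> (forall v, f v = 0 -> g v = 0) ->
  exists s : {linear H -> H'}, forall v, s (f v) = g v.
Proof.
move=> fS fg; pose l x := projT1 (cid (fS x)).
have fl x : f (l x) = x by rewrite /l; case: cid.
have gE u v : f u = f v -> g u = g v.
  by move=> e; apply/eqP; rewrite -subr_eq0 -linearB fg// linearB e subrr.
have ls : linear (g \o l).
  move=> a x y /=; rewrite -linearP; apply: gE.
  by rewrite linearP !fl.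
exists (mklinear ls) => v; rewrite mklinearE /=; apply: gE.
by rewrite fl.
Qed.

Lemma presents_factor (A : nzRingType) M (H H' : lmodType A)
    (h : 'I_M -> H) (h' : 'I_M -> H') T :
  presents h T -> (forall z, comb h' (T *m z) = 0) ->
  exists s : {linear H -> H'}, forall v, s (comb h v) = comb h' v.
Proof.
move=> [hS hT] h'T; apply: linear_factor hS _ => v /hT[z ->]; exact: h'T.
Qed.

Lemma presents_iso (A : comNzRingType) M (H H' : lmodType A)
    (h : 'I_M -> H) (h' : 'I_M -> H') T :
  presents h T -> presents h' T -> exists2 s : {linear H -> H'}, bijective s &
    forall v, s (comb h v) = comb h' v.
Proof.
move=> hT h'T.
have [s sE] : exists s : {linear H -> H'}, forall v, s (comb h v) = comb h' v.
  by apply: presents_factor hT _ => z; apply/(proj2 h'T); exists z.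
have [t tE] : exists t : {linear H' -> H}, forall v, t (comb h' v) = comb h v.
  by apply: presents_factor h'T _ => z; apply/(proj2 hT); exists z.
exists s => //; exists t => x.
  by have [v ->] := proj1 hT x; rewrite sE tE.
by have [v ->] := proj1 h'T x; rewrite tE sE.
Qed.

Lemma presents_comp (A : comNzRingType) M (H H' : lmodType A)
    (h : 'I_M -> H) (s : {linear H -> H'}) T :
  presents h T -> bijective s -> presents (s \o h) T.
Proof.
move=> [hS hT] sB; split=> [x|v].
  case: sB => t sK tK; have [v tv] := hS (t x); exists v.
  by rewrite comb_comp -tv tK.
rewrite comb_comp -hT; split=> [|->]; last by rewrite linear0.
by move=> e; apply: (bij_inj sB); rewrite linear0.
Qed.

(** The automorphisms of H act simply transitively on the families presented by a given T. *)
Lemma card_presents (A : finComNzRingType) M (H : finLmodType A) (T : 'M[A]_M) :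
  #|[set h : {ffun 'I_M -> H} | `[< presents h T >]]| =
  (#|automorphisms H| * `[< exists h : {ffun 'I_M -> H}, presents h T >])%N.
Proof.
case: asboolP => [[h hT]|nh]; last first.
  rewrite muln0; apply: eq_card0 => h; rewrite inE.
  by apply/asboolP => hT; apply: nh; exists h.
rewrite muln1.
have inj : {in automorphisms H &, injective
    (fun s : {perm H} => [ffun i => s (h i)] : {ffun 'I_M -> H})}.
  move=> s t; rewrite !inE => /asboolP ls /asboolP lt /ffunP st.
  apply/permP => x; have [v ->] := proj1 hT x.
  rewrite -[s _](comb_comp h (mklinear ls)) -[t _](comb_comp h (mklinear lt)).
  by apply: eq_comb => i /=; have := st i; rewrite !ffunE.
rewrite -(card_in_imset inj); apply: eq_card => h'; rewrite inE.
apply/asboolP/imsetP => [h'T|[s]].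
  have [s sB sE] := presents_iso hT h'T.
  exists (perm (bij_inj sB)); last first.
    by apply/ffunP => i; rewrite ffunE permE -(comb_delta h i) sE comb_delta.
  by rewrite inE; apply/asboolP => a x y; rewrite !permE linearP.
rewrite inE => /asboolP ls ->.
have sB : bijective (mklinear ls) by exists (s^-1)%g; [exact: permK|exact: permKV].
have := presents_comp hT sB; rewrite /presents.
move=> [pS pT]; split=> [x|v].
  have [v ->] := pS x; exists v; apply: eq_comb => i; by rewrite ffunE.
rewrite (_ : comb _ v = comb (mklinear ls \o h) v); first exact: pT.
by apply: eq_comb => i; rewrite ffunE.
Qed.

(** T is square, so its kernel and its cokernel have the same order. *)
Lemma card_presented (A : finComNzRingType) M (H : finLmodType A)
    (h : 'I_M -> H) (T : 'M[A]_M) :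
  presents h T -> #|H| = #|[set v : 'cV[A]_M | T *m v == 0]|.
Proof.
move=> [hS hT].
have c1 := card_additiveT (comb h).
have c2 := card_additiveT (mulmx T : {additive 'cV[A]_M -> 'cV[A]_M}).
have imE : [set v | comb h v == 0] = mulmx T @: [set: 'cV[A]_M].
  apply/setP => v; rewrite inE; apply/eqP/imsetP => [/hT[z ->]|[z _ ->]].
    by exists z.
  by apply/hT; exists z.
have sE : comb h @: [set: 'cV[A]_M] = [set: H].
  apply/setP => x; rewrite in_setT; apply/imsetP.
  by have [v ->] := hS x; exists v.
rewrite sE imE cardsT in c1.
have p0 : (0 < #|mulmx T @: [set: 'cV[A]_M]|)%N.
  by apply/card_gt0P; exists 0; apply/imsetP; exists 0; rewrite ?mulmx0.
apply/eqP; rewrite -(eqn_pmul2l p0) -c1 c2 mulnC; apply/eqP; congr (_ * _)%N.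
Qed.

(** Used to replace a rectangular diagonal matrix by a square one with the same image, so that all
    presentations can be square. *)
Lemma diagonal_square (B : nzRingType) m n (D : 'M[B]_(m, n)) :
  is_diagonal D ->
  D *m (pid_mx (minn m n) : 'M[B]_(n, m)) *m (pid_mx (minn m n) : 'M[B]_(m, n)) = D.
Proof.
move=> dD; rewrite -mulmxA mul_pid_mx.
apply/matrixP => i j; rewrite mxE (bigD1 j)//= big1 => [|l /negPf lj].
  rewrite mxE eqxx /= addr0.
  case: (ltnP j m) => jm.
    by rewrite (_ : (_ < _)%N) ?mulr1//; have := ltn_ord j; lia.
  rewrite dD ?mul0r//; have := ltn_ord i; lia.
by rewrite mxE -val_eqE /= in lj *; rewrite lj mulr0.
Qed.

Lemma row_ext0 (B : nzRingType) m n (u : 'M[B]_(m, n)) :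
  (forall z : 'cV_n, u *m z = 0) -> u = 0.
Proof.
move=> u0; apply/matrixP => i j.
have := congr1 (fun c : 'cV_m => c i 0) (u0 (delta_mx j 0)).
by rewrite -colE !mxE.
Qed.

Section ChainModules.
Variables (B : finComUnitRingType) (k : finFieldType).
Variables (rho : {rmorphism B -> k}) (w : B) (F : nat).
Hypothesis BC : chain_ring rho w F.

Lemma chain_square_image m n (X : 'M[B]_(m, n)) : exists T : 'M[B]_m,
  forall v : 'cV_m, (exists z, v = X *m z) <-> (exists z, v = T *m z).
Proof.
have [P [D [Q [uP uQ dD ->]]]] := chain_smith (chain_dvd_total BC) X.
exists (P *m D *m (pid_mx (minn m n) : 'M[B]_(n, m))) => v; split=> -[z ->].
  exists ((pid_mx (minn m n) : 'M[B]_(m, n)) *m (Q *m z)).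
  by rewrite -{1}(diagonal_square dD) !mulmxA.
exists (invmx Q *m ((pid_mx (minn m n) : 'M[B]_(n, m)) *m z)).
by rewrite !mulmxA mulmxK.
Qed.

Lemma chain_submodule_image m (K : {pred 'cV[B]_m}) :
  0 \in K -> (forall a u v, u \in K -> v \in K -> a *: u + v \in K) ->
  exists T : 'M[B]_m, forall v, v \in K <-> exists z, v = T *m z.
Proof.
move=> K0 KL; pose s := enum K.
pose X : 'M[B]_(m, size s) := \matrix_(i, j) (nth 0 s j) i 0.
have XE z : X *m z = \sum_j z j 0 *: nth 0 s j.
  apply/colP => i; rewrite mxE summxE; apply: eq_bigr => j _.
  by rewrite !mxE mulrC.
have [T TP] := chain_square_image X; exists T => v; split.
  move=> vK; apply/TP; have vs : v \in s by rewrite mem_enum.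
  have ls : (index v s < size s)%N by rewrite index_mem.
  exists (delta_mx (Ordinal ls) 0); rewrite XE (bigD1 (Ordinal ls))//= big1.
    by rewrite addr0 mxE !eqxx scale1r nth_index.
  by move=> j /negPf ji; rewrite mxE ji scale0r.
move/TP => [z ->]; rewrite XE; apply: (big_ind (fun x => x \in K)) => //.
  by move=> x y xK yK; rewrite -[x]scale1r KL.
move=> j _; rewrite -[_ *: _]addr0 KL// -[_ \in K]mem_enum.
exact: mem_nth.
Qed.

Lemma presents_exists (H : finLmodType B) :
  exists (h : 'I_#|H| -> H) (T : 'M[B]_#|H|), presents h T.
Proof.
pose h (i : 'I_#|H|) : H := enum_val i; exists h.
have [||T TP] := @chain_submodule_image _ [pred v | comb h v == 0].
- by rewrite inE linear0.
- move=> a u v; rewrite !inE => /eqP u0 /eqP v0.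
  by rewrite linearP /= u0 v0 scaler0 addr0.
exists T; split=> [x|v].
  by exists (delta_mx (enum_rank x) 0); rewrite comb_delta /h enum_rankK.
by split=> [/eqP v0|/TP/eqP//]; apply/TP.
Qed.

(** A square diagonal matrix is symmetric, so transposition exchanges the two kernels of the Smith
    form. *)
Lemma chain_card_left_kernel n (T : 'M[B]_n) :
  #|[set u : 'rV[B]_n | u *m T == 0]| = #|[set v : 'cV[B]_n | T *m v == 0]|.
Proof.
have [P [D [Q [uP uQ dD ->]]]] := chain_smith (chain_dvd_total BC) T.
have DT : D^T = D.
  by apply/matrixP => i j; rewrite mxE; case: (eqVneq i j) => [->//|ij]; rewrite !dD// eq_sym.
have inj : injective (fun u : 'rV[B]_n => invmx Q *m (u *m P)^T).
  by move=> u v /(can_inj (mulKVmx uQ))/trmx_inj/(can_inj (mulmxK uP)).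
rewrite -[LHS](card_imset _ inj); apply: eq_card => v; apply/imsetP/idP.
  case=> u; rewrite !inE => /eqP u0 ->.
  rewrite -!mulmxA mulKVmx// -[D]DT -trmx_mul.
  suff -> : u *m P *m D = 0 by rewrite trmx0 mulmx0.
  by apply: (can_inj (mulmxK uQ)); rewrite mul0mx -u0 !mulmxA.
rewrite inE -!mulmxA => /eqP/(canRL (mulKmx uP)); rewrite mulmx0 => v0.
exists ((Q *m v)^T *m invmx P); last by rewrite mulmxKV// trmxK mulKmx.
rewrite inE !mulmxA mulmxKV// -[D]DT -trmx_mul v0.
by rewrite trmx0 mul0mx.
Qed.

Section Homs.
Variable G : finLmodType B.

Definition homs : {set {ffun G -> B}} := 
  [set f : {ffun G -> B} | `[< linear (f : G -> B^o) >]].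

Lemma homsP (f : {ffun G -> B}) : reflect (linear (f : G -> B^o)) (f \in homs).
Proof. by rewrite inE; apply: asboolP. Qed.

(** A homomorphism from the cokernel of T to B is a row u with u T = 0, and the left kernel of T is
    as large as its kernel, hence as G. *)
Lemma card_homs : #|homs| = #|G|.
Proof.
have [h [T hT]] := presents_exists G.
rewrite (card_presented hT) -chain_card_left_kernel.
pose r (f : {ffun G -> B}) : 'rV[B]_#|G| := \row_i f (h i).
have rE (f : {ffun G -> B}) (lf : linear (f : G -> B^o)) v :
    (r f *m v) 0 0 = f (comb h v).
  rewrite -[f _](comb_comp h (mklinear lf)) mxE; apply: eq_bigr => i _.
  by rewrite mxE mulrC.
have inj : {in homs &, injective r}.
  move=> f g /homsP lf /homsP lg fg; apply/ffunP => x.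
  by have [v ->] := proj1 hT x; rewrite -!rE// fg.
rewrite -(card_in_imset inj); apply: eq_card => u; apply/imsetP/idP.
  case=> f /homsP lf ->; rewrite inE; apply/eqP/row_ext0 => z.
  rewrite [r f *m T *m z]mx11_scalar -mulmxA rE//.
  have -> : comb h (T *m z) = 0 by apply/(proj2 hT); exists z.
  by rewrite -[f _]/(mklinear lf _) linear0 raddf0.
rewrite inE => /eqP uT.
pose g : 'cV[B]_#|G| -> B^o := fun v => (u *m v) 0 0.
have lg : linear g by move=> a x y; rewrite /g mulmxDr -scalemxAr !mxE.
have [s sE] : exists s : {linear G -> B^o}, forall v, s (comb h v) = mklinear lg v.
  apply: linear_factor (proj1 hT) _ => v /(proj2 hT)[z ->].
  by rewrite mklinearE /g mulmxA uT mul0mx mxE.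
exists [ffun x => s x].
  by apply/homsP => a x y; rewrite !ffunE linearP.
apply/rowP => i; rewrite mxE ffunE -comb_delta sE mklinearE /g.
by rewrite -colE mxE.
Qed.

(** For T' dual to T, the map v -> T' v vanishes exactly on im T; its coordinates are homomorphisms
    that separate the elements of the cokernel. *)
Lemma homs_separate (x : G) : x != 0 -> exists2 f, f \in homs & f x != 0.
Proof.
have [h [T hT]] := presents_exists G.
have [T' [_ T2 T3 _]] := chain_matrix_dual BC T.
have [v ->] := proj1 hT x => /eqP v0.
have [i Ti] : exists i, (T' *m v) i 0 != 0.
  apply/existsP; apply: contra_notT v0 => /existsPn T'v.
  apply/(proj2 hT)/T2/colP => i; rewrite [RHS]mxE.
  by apply/eqP; rewrite -[_ == _]negbK.
pose g : 'cV[B]_#|G| -> B^o := fun v => (T' *m v) i 0.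
have lg : linear g by move=> a y z; rewrite /g mulmxDr -scalemxAr !mxE.
have T'T : T' *m T = 0.
  apply/row_matrixP => j; rewrite row0 row_mul; apply/T3.
  by exists (delta_mx 0 j); rewrite rowE.
have [s sE] : exists s : {linear G -> B^o}, forall v, s (comb h v) = mklinear lg v.
  apply: linear_factor (proj1 hT) _ => y /(proj2 hT)[z ->].
  by rewrite mklinearE /g mulmxA T'T mul0mx mxE.
exists [ffun y => s y]; last by rewrite ffunE sE.
by apply/homsP => a y z; rewrite !ffunE linearP.
Qed.
End Homs.
End ChainModules.

(** * Counting matrices with a given kernel *)

Lemma card_rows_in (B : finType) m n (S : {set 'rV[B]_n}) :
  #|[set M : 'M[B]_(m, n) | [forall i, row i M \in S]]| = (#|S| ^ m)%N.
Proof.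
rewrite -[m in RHS]card_ord -card_ffun_on.
pose f (M : 'M[B]_(m, n)) : {ffun 'I_m -> 'rV[B]_n} := [ffun i => row i M].
have inj : injective f.
  by move=> M M' /ffunP MM; apply/row_matrixP => i; have := MM i; rewrite !ffunE.
rewrite -(card_imset _ inj); apply: eq_card => g; apply/imsetP/ffun_onP.
  by case=> M; rewrite inE => /forallP MS -> i; rewrite ffunE.
move=> gS; exists (\matrix_i g i); last by apply/ffunP => i; rewrite ffunE rowK.
by rewrite inE; apply/forallP => i; rewrite rowK.
Qed.

Section ChainCounting.
Variables (B : finComUnitRingType) (k : finFieldType).
Variables (rho : {rmorphism B -> k}) (w : B) (F : nat).
Hypothesis BC : chain_ring rho w F.

Definition units_mx N : {set 'M[B]_N} := [set P | P \in unitmx].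

Lemma chain_unitmx n (P : 'M[B]_n) : (P \in unitmx) = (map_mx rho P \in unitmx).
Proof. by rewrite !unitmxE (chain_unit BC) -det_map_mx unitfE. Qed.

Section Kernels.
Variables (N : nat) (X0 : 'M[B]_N).
Hypothesis X0F : forall v : 'cV_N, X0 *m v = 0 -> w ^+ F *: v = 0.

Let same_ker (X : 'M[B]_N) := [forall v : 'cV_N, (X *m v == 0) == (X0 *m v == 0)].

Lemma wF_rho0 (v : 'cV[B]_N) : map_mx rho v = 0 <-> w ^+ F *: v = 0.
Proof.
split=> [v0|v0].
  apply/colP => i; rewrite !mxE.
  have /(chain_ker BC)[y ->] : rho (v i 0) = 0.
    by have := congr1 (fun c : 'cV_N => c i 0) v0; rewrite !mxE.
  by rewrite mulrA -exprSr (chain_nil BC) mul0r.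
apply/colP => i; rewrite !mxE; apply/(chain_ker BC).
have := congr1 (fun c : 'cV_N => c i 0) v0; rewrite !mxE => /(chain_annP BC _ (leqnSn F))[y].
by rewrite subSnn expr1 => ->; exists y.
Qed.

(* A nonzero y in the kernel of Y modulo w lifts to v with Y (w^F v) = 0, and
   w^F v, which lies in the image of X0, would give a vector of ker (Y X0)
   outside ker X0. *)
Lemma same_ker_unit Y : same_ker (Y *m X0) -> Y \in unitmx.
Proof.
move=> /forallP YX; rewrite chain_unitmx.
rewrite -[_ \in _]negbK; apply/negP => nu.
have [y y0 yY] : exists2 y : 'cV[k]_N, y != 0 & map_mx rho Y *m y = 0.
  move: nu; rewrite -unitmx_tr -row_free_unit -kermx_eq0 => /rowV0Pn[u uk u0].
  exists u^T; first by rewrite trmx_eq0.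
  by rewrite -[map_mx _ _]trmxK -trmx_mul (sub_kermxP uk) trmx0.
have [v vy] : exists v : 'cV[B]_N, map_mx rho v = y.
  exists (\col_i projT1 (cid (chain_surj BC (y i 0)))).
  by apply/colP => i; rewrite !mxE; case: cid.
have [T [T1 T2 _ _]] := chain_matrix_dual BC X0.
have /T2[z zE] : T *m (w ^+ F *: v) = 0.
  rewrite -scalemxAr; apply: X0F; apply/T1; by exists v.
have := YX z; rewrite -mulmxA -zE.
have -> : Y *m (w ^+ F *: v) = 0.
  by rewrite -scalemxAr; apply/wF_rho0; rewrite map_mxM vy.
rewrite eqxx => /eqP/esym/eqP wv; move: y0; rewrite -vy.
by move/negP; apply; apply/eqP/wF_rho0.
Qed.

(** Y -> Y X0 maps GL_N(B) onto the matrices with the kernel of X0. The Y above a given X form a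
    coset of the matrices whose rows lie in the left kernel of X0, and by [same_ker_unit] the whole
    coset is invertible. *)
Lemma card_same_ker :
  (#|[set X | same_ker X]| * #|[set v : 'cV[B]_N | (X0 *m v == 0)%R]| ^ N)%N =
  #|units_mx N|.
Proof.
rewrite -(chain_card_left_kernel BC).
rewrite -card_rows_in mulnC; apply/esym.
apply: (@card_fibers _ _ (fun Y : 'M[B]_N => Y *m X0)) => [Y|X].
  rewrite !inE => uY; apply/forallP => v; rewrite -mulmxA.
  apply/eqP; apply/idP/idP => /eqP; last by move=> ->; rewrite mulmx0.
  by move/(canRL (mulKmx uY)); rewrite mulmx0 => ->.
rewrite inE => Xk.
(* X kills ker X0 = im T, so its rows lie in the left kernel of T, which is the row space of X0. *)
have [Y0 XE] : exists Y0, X = Y0 *m X0.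
  have [T [T1 _ _ T4]] := chain_matrix_dual BC X0.
  have XT : X *m T = 0.
    apply: row_ext0 => z; rewrite -mulmxA; apply/eqP.
    by rewrite (eqP (forallP Xk _)); apply/eqP/T1; exists z.
  have H i : exists z, row i X = z *m X0.
    by apply/T4; rewrite -row_mul XT row0.
  exists (\matrix_i projT1 (cid (H i))).
  by apply/row_matrixP => i; rewrite row_mul rowK; case: cid.
have inj : injective (fun D : 'M[B]_N => D + Y0) := addIr Y0.
rewrite -[RHS](card_imset _ inj); apply: eq_card => Y; apply/idP/imsetP.
  rewrite !inE => /andP[_ /eqP YX]; exists (Y - Y0); last by rewrite subrK.
  rewrite inE; apply/forallP => i.
  by rewrite inE -row_mul mulmxBl YX -XE subrr row0.
case=> D; rewrite inE => /forallP DX ->.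
have YX : (D + Y0) *m X0 = X.
  rewrite mulmxDl -XE; suff -> : D *m X0 = 0 by rewrite add0r.
  by apply/row_matrixP => i; rewrite row_mul row0; have := DX i; rewrite inE => /eqP.
by rewrite !inE YX eqxx andbT; apply: same_ker_unit; rewrite YX.
Qed.
End Kernels.

(** Invertibility is decided by residues, and reduction of matrices is onto with fibres of constant
    size c. *)
Lemma card_units_shift N (X : 'M[B]_N) :
  (#|[set P : 'M[B]_N | (P \in unitmx) && (P + X \in unitmx)%R]| * nunits k N)%N =
  (#|units_mx N| * nshift (map_mx rho X))%N.
Proof.
pose c := #|[set P : 'M[B]_N | map_mx rho P == 0]|.
have fib (A : 'M[k]_N) : #|[set P : 'M[B]_N | map_mx rho P == A]| = c.
  have [P0 P0E] : exists P0 : 'M[B]_N, map_mx rho P0 = A.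
    exists (\matrix_(i, j) projT1 (cid (chain_surj BC (A i j)))).
    by apply/matrixP => i j; rewrite !mxE; case: cid.
  have inj : injective (fun D : 'M[B]_N => D + P0) := addIr P0.
  rewrite /c -[RHS](card_imset _ inj); apply: eq_card => P; apply/idP/imsetP.
    rewrite inE => /eqP PA; exists (P - P0); last by rewrite subrK.
    by rewrite inE raddfB /= PA P0E subrr.
  by case=> D; rewrite !inE => /eqP D0 ->; rewrite raddfD /= D0 P0E add0r.
have H (Q : pred 'M[k]_N) :
    #|[set P : 'M[B]_N | Q (map_mx rho P)]| = (c * #|[set A | Q A]|)%N.
  apply: (@card_fibers _ _ (map_mx rho)) => [P|A]; rewrite !inE// => QA.
  rewrite -(fib A); apply: eq_card => P; rewrite !inE andbC.
  by case: eqP => // ->.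
have -> : #|[set P : 'M[B]_N | (P \in unitmx) && (P + X \in unitmx)]| =
    (c * nshift (map_mx rho X))%N.
  rewrite -H; apply: eq_card => P; rewrite !inE.
  by rewrite !chain_unitmx map_mxD.
have -> : #|units_mx N| = (c * nunits k N)%N.
  by rewrite -H; apply: eq_card => P; rewrite !inE chain_unitmx.
by rewrite mulnAC.
Qed.

(** As P + X = P (1 + P^-1 X) and Phi is stable under left multiplication, the number of X in Phi
    with P + X invertible is the same for all units P. *)
Lemma card_shift_average N (Phi : {set 'M[B]_N}) :
  (forall P X, P \in unitmx -> (P *m X \in Phi) = (X \in Phi)) ->
  (#|[set X in Phi | (1%:M + X \in unitmx)%R]| * #|units_mx N|)%N =
  (\sum_(X in Phi) #|[set P : 'M[B]_N | (P \in unitmx) && (P + X \in unitmx)%R]|)%N.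
Proof.
move=> PhiU.
transitivity (\sum_(P in units_mx N) #|[set X in Phi | (P + X \in unitmx)%R]|)%N.
  rewrite mulnC -sum_nat_const; apply: eq_bigr => P; rewrite inE => uP.
  have inj : injective (mulmx P : 'M[B]_N -> 'M[B]_N) := can_inj (mulKmx uP).
  rewrite -(card_imset _ inj); apply: eq_card => X; apply/imsetP/idP.
    case=> Y; rewrite !inE => /andP[YP uY] ->; rewrite PhiU// YP /=.
    by rewrite -[X in X + _]mulmx1 -mulmxDr unitmx_mul uP.
  rewrite inE => /andP[XP uX]; exists (invmx P *m X); last by rewrite mulKVmx.
  rewrite inE PhiU ?unitmx_inv// XP /= -(mulVmx uP) -mulmxDr.
  by rewrite unitmx_mul unitmx_inv uP.
under eq_bigr do rewrite -sum1dep_card.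
under [in RHS]eq_bigr do rewrite -sum1dep_card.
rewrite (exchange_big_dep (mem Phi))/=; last by move=> P X _ /andP[].
apply: eq_bigr => X XP; apply: eq_bigl => P.
by rewrite inE XP.
Qed.
End ChainCounting.

Section ChainInjections.
Variables (B : finComUnitRingType) (k : finFieldType).
Variables (rho : {rmorphism B -> k}) (w : B) (F : nat).
Hypothesis BC : chain_ring rho w F.
Variable G : finLmodType B.

Definition lin_inj N : {set {ffun G -> 'cV[B]_N}} :=
  [set i : {ffun G -> 'cV[B]_N} | `[< linear i >] && injectiveb i].

(** The kernel is described as the image of an embedding of G, so that pairs of an embedding and a
    matrix can be counted in two ways. *)
Definition kernel_set N : {set 'M[B]_N} :=
  [set X | [exists i in lin_inj N,
     [forall v : 'cV_N, (X *m v == 0) == (v \in codom i)]]].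

Lemma card_coord_in N (S : {set {ffun G -> B}}) : S \subset homs G ->
  #|[set i : {ffun G -> 'cV[B]_N} | `[< linear i >] &&
      [forall j, [ffun x => i x j 0] \in S]]| = (#|S| ^ N)%N.
Proof.
move=> /fintype.subsetP SH; rewrite -[N in RHS]card_ord -card_ffun_on.
pose f (i : {ffun G -> 'cV[B]_N}) : {ffun 'I_N -> {ffun G -> B}} :=
  [ffun j => [ffun x => i x j 0]].
have inj : injective f.
  move=> i i' /ffunP ii; apply/ffunP => x; apply/colP => j.
  by have := ii j; rewrite !ffunE => /ffunP/(_ x); rewrite !ffunE.
rewrite -(card_imset _ inj); apply: eq_card => g; apply/imsetP/ffun_onP.
  case=> i; rewrite inE => /andP[_ /forallP iS] -> j.
  by rewrite ffunE; exact: iS.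
move=> gS; exists [ffun x => \col_j g j x]; last first.
  by apply/ffunP => j; rewrite ffunE; apply/ffunP => x; rewrite !ffunE mxE.
rewrite inE; apply/andP; split.
  apply/asboolP => a x y; apply/colP => j; rewrite !ffunE !mxE.
  have /homsP lg := SH _ (gS j); exact: lg.
apply/forallP => j; rewrite (_ : finfun _ = g j)//.
by apply/ffunP => x; rewrite !ffunE mxE.
Qed.

Lemma linear_coord N (i : {ffun G -> 'cV[B]_N}) j :
  linear i -> [ffun x => i x j 0] \in homs G.
Proof.
by move=> li; apply/homsP => a x y; rewrite !ffunE li !mxE.
Qed.

Lemma lin_inj_le N : (#|lin_inj N| <= #|G| ^ N)%N.
Proof.
rewrite -(card_homs BC) -card_coord_in//; apply: subset_leq_card.
apply/fintype.subsetP => i; rewrite !inE => /andP[li _]; rewrite li /=.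
by apply/forallP => j; apply: linear_coord; apply/asboolP.
Qed.

(** The homomorphisms vanishing at x are disjoint from their translate by one that does not vanish
    there. *)
Lemma card_homs_vanish (x : G) : x != 0 ->
  (2 * #|[set f in homs G | f x == 0%R]| <= #|G|)%N.
Proof.
move=> x0; rewrite -(card_homs BC).
have [f fH fx] := homs_separate BC x0.
pose H0 := [set g in homs G | g x == 0].
have inj : injective (fun g : {ffun G -> B} => [ffun y => g y + f y] : {ffun G -> B}).
  move=> g h /ffunP gh; apply/ffunP => y; have := gh y; rewrite !ffunE.
  by move/addIr.
have d : [disjoint H0 & (fun g : {ffun G -> B} => [ffun y => g y + f y]) @: H0].
  rewrite disjoints_subset; apply/fintype.subsetP => g; rewrite !inE.
  case/andP=> _ /eqP gx; apply/imsetP => -[h]; rewrite !inE => /andP[_ /eqP hx] E.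
  by move: gx; rewrite E ffunE hx add0r => /eqP; rewrite (negPf fx).
rewrite mul2n -addnn -{2}(card_imset _ inj).
have /leqifP := leq_card_setU H0 ((fun g : {ffun G -> B} => [ffun y => g y + f y]) @: H0).
rewrite d => /eqP <-; apply: subset_leq_card; apply/fintype.subsetP => g.
rewrite inE => /orP[|/imsetP[h]].
  by rewrite inE => /andP[].
rewrite inE => /andP[/homsP lh _] ->; move/homsP: fH => lf.
apply/homsP => a y z; rewrite !ffunE [h _]lh [f _]lf.
by rewrite scalerDr addrACA.
Qed.

(** A union bound: a linear map from G to B^N that is not injective kills some x <> 0. Its N
    coordinates are independent, so at most (|G|/2)^N of the |G|^N maps kill a given x. All is
    multiplied by 2^N to stay among the integers. *)
Lemma lin_inj_ge N : (2 ^ N * #|G| ^ N <= 2 ^ N * #|lin_inj N| + #|G| ^ N.+1)%N.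
Proof.
pose V x := [set i : {ffun G -> 'cV[B]_N} | `[< linear i >] &&
  [forall j, [ffun y => i y j 0] \in [set f in homs G | f x == 0]]].
have cV x : x != 0 -> (2 ^ N * #|V x| <= #|G| ^ N)%N.
  move=> x0; rewrite card_coord_in; last first.
    by apply/fintype.subsetP => f; rewrite inE => /andP[].
  rewrite -expnMn; case: (N) => // n.
  by rewrite leq_exp2r// card_homs_vanish.
have le : (#|G| ^ N <= #|lin_inj N| + \sum_(x | x != 0%R) #|V x|)%N.
  rewrite -[X in (X ^ N <= _)%N](card_homs BC) -card_coord_in//.
  apply: (@leq_trans #|lin_inj N :|: \bigcup_(x | x != 0) V x|); last first.
    apply: leq_trans (leq_card_setU _ _) _; rewrite leq_add2l.
    apply: (big_ind2 (fun (A : {set _}) n => #|A| <= n)%N) => //.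
      by rewrite cards0.
    move=> A a C c Aa Cc; exact: leq_trans (leq_card_setU _ _) (leq_add Aa Cc).
  apply: subset_leq_card; apply/fintype.subsetP => i; rewrite !inE => /andP[li _].
  rewrite li /=; case: (boolP (injectiveb i)) => //= /injectivePn[x [y xy ixy]].
  move/asboolP: (li) => li'.
  apply/bigcupP; exists (x - y); first by rewrite subr_eq0.
  rewrite inE li /=; apply/forallP => j; rewrite inE linear_coord//= ffunE.
  by rewrite (linear_atB li') ixy subrr mxE.
apply: leq_trans (leq_mul (leqnn _) le) _.
rewrite mulnDr leq_add2l big_distrr /= expnS.
apply: (@leq_trans (\sum_(x : G | x != 0%R) #|G| ^ N)); first exact: leq_sum.
rewrite sum_nat_const leq_mul2r.
by rewrite max_card orbT.
Qed.

Lemma card_lin_inj_image N (i0 : {ffun G -> 'cV[B]_N}) : i0 \in lin_inj N ->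
  #|[set i in lin_inj N | [forall v, (v \in codom i) == (v \in codom i0)]]|
  = #|automorphisms G|.
Proof.
rewrite inE => /andP[/asboolP l0 /injectiveP inj0].
have inj : {in automorphisms G &, injective
    (fun s : {perm G} => [ffun x => i0 (s x)] : {ffun G -> 'cV[B]_N})}.
  move=> s t _ _ /ffunP st; apply/permP => x; apply: inj0.
  by have := st x; rewrite !ffunE.
rewrite -[RHS](card_in_imset inj); apply: eq_card => i; rewrite inE.
apply/andP/imsetP => [[]|[s]]; rewrite inE.
  case/andP=> /asboolP li /injectiveP injI /forallP ii.
  have H x : exists y, i0 y = i x.
    have : i x \in codom i0 by rewrite -(eqP (ii _)) codom_f.
    by case/codomP => y ->; exists y.
  pose s x := projT1 (cid (H x)).
  have sE x : i0 (s x) = i x by rewrite /s; case: cid.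
  have injs : injective s by move=> x y /(congr1 i0); rewrite !sE => /injI.
  exists (perm injs); last by apply/ffunP => x; rewrite ffunE permE sE.
  rewrite inE; apply/asboolP => a x y; rewrite !permE; apply: inj0.
  by rewrite l0 !sE li.
move=> /asboolP ls ->; split.
  rewrite inE; apply/andP; split; last first.
    by apply/injectiveP => x y; rewrite !ffunE => /inj0/perm_inj.
  by apply/asboolP => a x y; rewrite !ffunE ls l0.
apply/forallP => v; apply/eqP; apply/codomP/codomP => -[x ->].
  by exists (s x); rewrite ffunE.
by exists (s^-1 x)%g; rewrite ffunE permKV.
Qed.

Hypothesis GF : forall x : G, w ^+ F *: x = 0.

Lemma card_kernel_image N (i : {ffun G -> 'cV[B]_N}) : i \in lin_inj N ->
  (#|[set X : 'M[B]_N | [forall v : 'cV_N, (X *m v == 0%R) == (v \in codom i)]]|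
   * #|G| ^ N)%N = #|units_mx B N|.
Proof.
rewrite inE => /andP[/asboolP li /injectiveP inji].
have [||T TP] := @chain_submodule_image _ _ _ _ _ BC N [pred v | v \in codom i].
- by rewrite inE; apply/codomP; exists 0; rewrite (linear_at0 li).
- move=> a u v; rewrite !inE => /codomP[x ->] /codomP[y ->].
  by apply/codomP; exists (a *: x + y); rewrite li.
have [X0 [_ T2 _ _]] := chain_matrix_dual BC T.
have X0P (v : 'cV_N) : (X0 *m v == 0) = (v \in codom i).
  apply/eqP/idP; first by move/T2/TP.
  by move=> vi; apply/T2/TP.
rewrite -(@card_same_ker _ _ _ _ _ BC N X0); last first.
  move=> v /eqP; rewrite X0P => /codomP[x ->].
  by rewrite -(linear_atZ li) GF (linear_at0 li).
congr (_ * _ ^ _)%N.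
  by apply: eq_card => X; rewrite !inE; under [in RHS]eq_forallb do rewrite X0P.
rewrite -(card_imset _ inji); apply: eq_card => v; rewrite inE X0P.
by apply/imsetP/codomP => -[x]; [move=> _ ->|move=> ->]; exists x.
Qed.

(** Pairs (i, X) with ker X = im i: each X has |Aut G| embeddings i, and each i has |GL_N(B)| /
    |G|^N matrices X. *)
Lemma card_kernel_set N :
  (#|kernel_set N| * #|automorphisms G| * #|G| ^ N)%N =
  (#|lin_inj N| * #|units_mx B N|)%N.
Proof.
transitivity (\sum_(i in lin_inj N)
  #|[set X : 'M[B]_N | [forall v : 'cV_N, (X *m v == 0%R) == (v \in codom i)]]|
   * #|G| ^ N)%N; last first.
  rewrite -sum_nat_const; apply: eq_bigr => i iI; exact: card_kernel_image.
rewrite -big_distrl /=; congr (_ * _)%N.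
under eq_bigr do rewrite -sum1dep_card.
rewrite (exchange_big_dep (mem (kernel_set N)))/=; last first.
  move=> i X iI iX; rewrite inE; apply/existsP; exists i; exact/andP.
rewrite -sum_nat_const; apply: eq_bigr => X; rewrite inE.
case/existsP=> i0 /andP[i0I /forallP i0X].
rewrite sum1dep_card -(card_lin_inj_image i0I); apply: eq_card => i.
rewrite !inE; congr (_ && _); apply: eq_forallb => v.
by rewrite (eqP (i0X v)) eq_sym.
Qed.

Lemma kernel_set_mul N P X : P \in unitmx -> (P *m X \in kernel_set N) = (X \in kernel_set N).
Proof.
move=> uP; rewrite !inE; apply: eq_existsb => i; congr (_ && _).
apply: eq_forallb => v; congr (_ == _); rewrite -mulmxA.
apply/eqP/eqP => [|->]; last by rewrite mulmx0.
by move/(canRL (mulKmx uP)); rewrite mulmx0.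
Qed.

(** The vectors of B^N killed by w are the multiples of w^F. Hence y -> w^F (lift of y) identifies
    the kernel of the residue matrix with the w-torsion of ker X, that is of G. *)
Lemma kernel_set_rank N X : X \in kernel_set N ->
  (#|k| ^ (N - \rank (map_mx rho X)))%N = #|[set x : G | w *: x == 0]|.
Proof.
rewrite inE => /existsP[i /andP[]]; rewrite inE => /andP[/asboolP li /injectiveP inji].
move=> /forallP iX; set Y := map_mx rho X.
have -> : (#|k| ^ (N - \rank Y))%N = #|[set y : 'cV[k]_N | Y *m y == 0]|.
  rewrite -(mxrank_tr Y) -card_left_kernel -(card_imset _ (@trmx_inj _ _ _)).
  apply: eq_card => y; apply/imsetP/idP.
    case=> u; rewrite !inE => /eqP uY ->.
    by rewrite -[Y]trmxK -trmx_mul uY trmx0.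
  rewrite inE => /eqP Yy; exists y^T; last by rewrite trmxK.
  by rewrite inE -trmx_mul Yy trmx0.
have lk y : exists x, rho x = y := chain_surj BC y.
pose l (y : 'cV[k]_N) : 'cV[B]_N := \col_j projT1 (cid (lk (y j 0))).
have lE y : map_mx rho (l y) = y by apply/colP => j; rewrite !mxE; case: cid.
have injl : injective (fun y => w ^+ F *: l y).
  move=> y z /eqP; rewrite -subr_eq0 -scalerBr => /eqP/(wF_rho0 BC).
  by rewrite map_mxB !lE => /eqP; rewrite subr_eq0 => /eqP.
rewrite -(card_imset _ injl) -[RHS](card_imset _ inji).
apply: eq_card => v; apply/imsetP/imsetP => -[].
  move=> y; rewrite inE => /eqP Yy ->.
  have : w ^+ F *: l y \in codom i.
    rewrite -(eqP (iX _)) -scalemxAr; apply/eqP/(wF_rho0 BC).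
    by rewrite map_mxM lE.
  case/codomP => x xE; exists x => //; rewrite inE; apply/eqP/inji.
  rewrite (linear_atZ li) (linear_at0 li) -xE.
  by rewrite scalerA -exprS (chain_nil BC) scale0r.
move=> x; rewrite inE => /eqP wx ->.
have wix : w *: i x = 0.
  by rewrite -(linear_atZ li) wx (linear_at0 li).
have H j : exists z, i x j 0 = w ^+ F * z.
  have /(chain_annP BC _ (ltn0Sn F))[z zE] : w ^+ 1 * i x j 0 = 0.
    by have := congr1 (fun c : 'cV_N => c j 0) wix; rewrite !mxE.
  by exists z; rewrite zE subn1.
pose z : 'cV[B]_N := \col_j projT1 (cid (H j)).
have xE : i x = w ^+ F *: z by apply/colP => j; rewrite !mxE; case: cid.
exists (map_mx rho z).
  rewrite inE; apply/eqP; rewrite -map_mxM; apply/(wF_rho0 BC).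
  by rewrite scalemxAr -xE; apply/eqP; rewrite (eqP (iX _)) codom_f.
apply/eqP; rewrite xE -subr_eq0 -scalerBr; apply/eqP/(wF_rho0 BC).
by rewrite map_mxB lE subrr.
Qed.
End ChainInjections.

(** * Extensions of a presented module by a cyclic one *)

HB.instance Definition _ (B : finComNzRingType) m n (T : 'M[B]_(m, n)) :=
  [Countable of ker_mod T by <:].
HB.instance Definition _ (B : finComNzRingType) m n (T : 'M[B]_(m, n)) :=
  [Finite of ker_mod T by <:].

Section Joint.
Variables (A : comNzRingType) (N : nat) (H : lmodType A).

Definition joint (h : 'I_N -> H) (y : H) (i : 'I_(N + 1)) : H :=
  match fintype.split i with inl a => h a | inr _ => y end.

Lemma joint_lshift h y i : joint h y (lshift 1 i) = h i.
Proof.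
by rewrite /joint; case: (fintype.splitP (lshift 1 i)) => [a|a /=];
  [move=> /= /ord_inj->|have := ltn_ord i; lia].
Qed.

Lemma joint_rshift h y i : joint h y (rshift N i) = y.
Proof.
by rewrite /joint; case: (fintype.splitP (rshift N i)) => [a /=|//];
  have := ltn_ord a; lia.
Qed.

Lemma comb_joint h y (a : 'cV[A]_N) (b : 'cV[A]_1) :
  comb (joint h y) (col_mx a b) = comb h a + b 0 0 *: y.
Proof.
rewrite /comb big_split_ord big_ord1 /=; congr (_ + _).
  by apply: eq_bigr => i _; rewrite col_mxEu joint_lshift.
by rewrite col_mxEd joint_rshift.
Qed.
End Joint.

Lemma linear_cV (A : comNzRingType) N (H : lmodType A)
    (f : {linear 'cV[A]_N -> H}) a :
  f a = comb (fun i => f (delta_mx i 0)) a.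
Proof.
transitivity (f (comb (fun i : 'I_N => delta_mx i 0 : 'cV[A]_N) a)); last first.
  exact/esym/comb_comp.
congr (f _).
apply/colP => i; rewrite summxE (bigD1 i)//= big1 => [|j /negPf ji].
  by rewrite !mxE !eqxx mulr1 addr0.
by rewrite !mxE eq_sym ji mulr0.
Qed.

Lemma card_entries_in (B : finType) n (S : {set B}) :
  #|[set u : 'rV[B]_n | [forall i, u 0 i \in S]]| = (#|S| ^ n)%N.
Proof.
rewrite -[n in RHS]card_ord -card_ffun_on.
pose f (u : 'rV[B]_n) : {ffun 'I_n -> B} := [ffun i => u 0 i].
have inj : injective f.
  by move=> u v /ffunP uv; apply/rowP => i; have := uv i; rewrite !ffunE.
rewrite -(card_imset _ inj); apply: eq_card => g; apply/imsetP/ffun_onP.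
  by case=> u; rewrite inE => /forallP uS -> i; rewrite ffunE.
move=> gS; exists (\row_i g i); last by apply/ffunP => i; rewrite ffunE mxE.
by rewrite inE; apply/forallP => i; rewrite mxE.
Qed.

(** The quotient of H by y is isomorphic to G, phrased through a surjection so that it transports
    easily along changes of the base ring. *)
Definition quo_by (A : nzRingType) (H G : lmodType A) (y : H) : Prop :=
  exists f : {linear H -> G}, (forall x, exists h, x = f h) /\
    (forall h, f h = 0 <-> exists b, h = b *: y).

Section ChainExtensions.
Variables (B : finComUnitRingType) (k : finFieldType).
Variables (rho : {rmorphism B -> k}) (w : B) (F : nat).
Hypothesis BC : chain_ring rho w F.

(** The cokernel of T is realized inside B^N as ker T: for the dual matrix T', the map v -> T' v has
    kernel im T and image ker T. *)
Lemma chain_presented_exists N (T : 'M[B]_N) :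
  exists (H : finLmodType B) (h : 'I_N -> H), presents h T.
Proof.
have [T' [T1 T2 _ _]] := chain_matrix_dual BC T.
have TT i : T *m (T' *m delta_mx i (0 : 'I_1)) == 0.
  by apply/eqP/T1; exists (delta_mx i 0).
exists (ker_mod T), (fun i => KerMod (TT i)).
have cE v : val (comb (fun i => KerMod (TT i)) v) = T' *m v.
  rewrite [RHS]linear_cV /comb linear_sum; apply: eq_bigr => i _.
  by rewrite linearZ.
split=> [[x Tx]|v].
  have /T1[z zE] := eqP (Tx : T *m x == 0); exists z; apply/val_inj.
  by rewrite cE.
rewrite -T2 -cE; split=> [->|v0]; first by rewrite linear0.
by apply/val_inj; rewrite v0 linear0.
Qed.

(** Multiplication by w^e maps the annihilator of w^(e+1) onto that of w, which is w^F B and has q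
    elements. *)
Lemma chain_card_ann e : (e <= F.+1)%N -> #|[set x | w ^+ e * x == 0]| = (#|k| ^ e)%N.
Proof.
elim: e => [|e IH] eF.
  apply/eqP/cards1P; exists 0; apply/setP => x.
  by rewrite !inE expr0 mul1r.
have c1 : #|[set x | w * x == 0]| = #|k|.
  pose l y := projT1 (cid (chain_surj BC y)).
  have lE y : rho (l y) = y by rewrite /l; case: cid.
  have rho0 x : w ^+ F * x = 0 <-> rho x = 0.
    rewrite (chain_ker BC) (chain_annP BC _ (leqnSn F)) subSnn expr1.
    by [].
  have inj : injective (fun y => w ^+ F * l y).
    move=> y z /eqP; rewrite -subr_eq0 -mulrBr => /eqP/rho0.
    by rewrite rmorphB !lE => /eqP; rewrite subr_eq0 => /eqP.
  rewrite -cardsT -(card_imset _ inj); apply: eq_card => x; rewrite inE.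
  apply/eqP/imsetP => [|[y _ ->]]; last by rewrite mulrA -exprS (chain_nil BC) mul0r.
  rewrite -{1}[w]expr1 (chain_annP BC _ (ltn0Sn F)) subn1 => -[z ->].
  exists (rho z); rewrite ?in_setT//=; apply/eqP.
  by rewrite -subr_eq0 -mulrBr; apply/eqP/rho0; rewrite rmorphB lE subrr.
rewrite (@card_additive _ _ (GRing.mull_fun (w ^+ e) idfun : {additive B -> B}) [set x | w ^+ e.+1 * x == 0]); first last.
- by move=> x; rewrite !inE mulrN oppr_eq0.
- by move=> x y; rewrite !inE mulrDr => /eqP-> /eqP->; rewrite addr0.
rewrite expnSr -(IH (ltnW eF)) -c1; congr (_ * _)%N; apply: eq_card => x; rewrite !inE.
  rewrite /=; case: (w ^+ e * x =P 0) => [e0|]; rewrite ?andbF ?andbT//.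
  by rewrite exprS -mulrA e0 mulr0 eqxx.
apply/imsetP/eqP => [[y]|wx].
  by rewrite inE exprS -mulrA => /eqP ? ->.
have := wx; rewrite -{1}[w]expr1 (chain_annP BC _ (ltn0Sn F)) subn1 /= => -[z zE].
exists (w ^+ (F - e) * z).
  rewrite inE mulrA -exprD (_ : e.+1 + (F - e) = F.+1)%N; last lia.
  by rewrite (chain_nil BC) mul0r.
by rewrite mulrA -exprD subnKC.
Qed.

Lemma chain_card : #|B| = (#|k| ^ F.+1)%N.
Proof.
rewrite -chain_card_ann//; rewrite -cardsT; apply: eq_card => x.
by rewrite !inE (chain_nil BC) mul0r eqxx.
Qed.

Section Cyclic.
Variables (H : finLmodType B) (y : H).
Definition cyclic_set : {set H} := [set b *: y | b : B].
Definition ann_set : {set B} := [set b | b *: y == 0].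

Lemma scale_additive : additive (fun b : B => b *: y).
Proof. by move=> a b; rewrite scalerBl. Qed.

Lemma card_cyclic_ann : (#|cyclic_set| * #|ann_set|)%N = #|B|.
Proof.
pose f : {additive B -> H} := HB.pack (fun b : B => b *: y)
  (GRing.isZmodMorphism.Build B H (fun b : B => b *: y) scale_additive).
rewrite (card_additiveT f) mulnC; congr (_ * _)%N.
by apply: eq_card => h; apply/imsetP/imsetP => -[b _ ->]; exists b.
Qed.

(** If w^e is the first power that kills y, the annihilator of y is the ideal w^e B, of order
    q^(F+1-e). *)
Lemma card_cyclic_set : exists e, [/\ (e <= F.+1)%N, w ^+ e *: y = 0,
  #|cyclic_set| = (#|k| ^ e)%N & forall d, (d < e)%N -> w ^+ d *: y <> 0].
Proof.
have ex : exists e, w ^+ e *: y == 0.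
  by exists F.+1; rewrite (chain_nil BC) scale0r.
case: (ex_minnP ex) => e /eqP ey emin.
have eF : (e <= F.+1)%N by apply: emin; rewrite (chain_nil BC) scale0r.
exists e; split=> //; last by move=> d de /eqP/emin; rewrite leqNgt de.
have annE : ann_set = [set b | w ^+ (F.+1 - e) * b == 0].
  apply/setP => b; rewrite !inE; apply/eqP/eqP => [|/(chain_annP BC _ (leq_subr _ _))].
    have [u [i [uu _ ->]]] := chain_decomp BC b; rewrite -scalerA => uy.
    have /emin ei : w ^+ i *: y == 0.
      by rewrite -[_ *: y]scale1r -(mulVr uu) -scalerA uy scaler0.
    by rewrite mulrCA -exprD (_ : _ + i = F.+1 + (i - e))%N ?exprD ?(chain_nil BC) ?mul0r ?mulr0//; lia.
  by rewrite subKn// => -[z ->]; rewrite mulrC -scalerA ey scaler0.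
have k0 : (0 < #|k| ^ (F.+1 - e))%N by rewrite expn_gt0 (ltnW (card_field_gt1 k)).
apply/eqP; rewrite -(eqn_pmul2r k0) -expnD subnKC// -chain_card -card_cyclic_ann.
by rewrite annE chain_card_ann// leq_subr.
Qed.
End Cyclic.
End ChainExtensions.
Section ChainExtensionCount.
Variables (B : finComUnitRingType) (k : finFieldType).
Variables (rho : {rmorphism B -> k}) (w : B) (F : nat).
Hypothesis BC : chain_ring rho w F.
Variables (N j : nat) (G H : finLmodType B) (g : 'I_N -> G) (S : 'M[B]_N).
Hypothesis jF : (j <= F.+1)%N.
Hypothesis gS : presents g S.
Hypothesis GF : forall x : G, w ^+ (F.+1 - j) *: x = 0.

(* The cokernels of these matrices are the extensions of G, the cokernel of S,
   by a cyclic module of length j. *)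
Definition ext_mx (l : 'rV[B]_N) : 'M[B]_(N + 1) := block_mx S 0 l (w ^+ j)%:M.

Lemma ext_mxE l (a : 'cV[B]_N) (b : 'cV[B]_1) :
  ext_mx l *m col_mx a b = col_mx (S *m a) (l *m a + w ^+ j *: b).
Proof. by rewrite mul_block_col mul0mx addr0 mul_scalar_mx. Qed.

(** Since w^(F+1-j) kills the cokernel of S, it kills the image of the dual matrix S', which is ker
    S; over B this means divisibility by w^j. *)
Lemma ker_divisible (a : 'cV[B]_N) : S *m a = 0 -> exists c, a = w ^+ j *: c.
Proof.
have [S' [S1 S2 _ _]] := chain_matrix_dual BC S.
move=> /S1[z ->].
have Sz i : exists c, (S' *m z) i 0 = w ^+ j * c.
  have -> : (j = F.+1 - (F.+1 - j))%N by rewrite subKn.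
  apply/(chain_annP BC _ (leq_subr _ _)).
  have /S2 : exists y, w ^+ (F.+1 - j) *: z = S *m y.
    by apply/(proj2 gS); rewrite linearZ /= GF.
  by rewrite -scalemxAr => /(congr1 (fun c : 'cV_N => c i 0)); rewrite !mxE.
exists (\col_i projT1 (cid (Sz i))); apply/colP => i.
by rewrite [RHS]mxE mxE; case: cid.
Qed.

(** Over each a in ker S the equation l a + w^j b = 0 is solvable in b by [ker_divisible], with q^j
    solutions. So all rows l give cokernels of the same order. *)
Lemma card_ker_ext_mx l :
  #|[set v : 'cV[B]_(N + 1) | ext_mx l *m v == 0]| = (#|k| ^ j * #|G|)%N.
Proof.
rewrite (card_presented gS); apply: (@card_fibers _ _ usubmx) => [v|a].
  rewrite !inE -(vsubmxK v) ext_mxE -(col_mx0 _ N 1 1).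
  by move=> /eqP/eq_col_mx[Sv _]; rewrite col_mxKu Sv.
rewrite inE => /eqP Sa; have [c ac] := ker_divisible Sa.
rewrite -(chain_card_ann BC jF).
pose f (x : B) : 'cV[B]_(N + 1) := col_mx a (x%:M - l *m c).
have inj : injective f.
  move=> x y /eq_col_mx[_ /addIr/(congr1 (fun M : 'M[B]_1 => M 0 0))].
  by rewrite !mxE eqxx !mulr1n.
rewrite -[RHS](card_imset _ inj); apply: eq_card => v; apply/idP/imsetP.
  rewrite !inE -(vsubmxK v) ext_mxE col_mxKu => /andP[/eqP v0 /eqP va].
  exists (dsubmx v 0 0 + (l *m c) 0 0); last first.
    rewrite /f va; congr col_mx; apply/rowP => i; rewrite !ord1 !mxE eqxx mulr1n.
    by rewrite addrK.
  move: v0; rewrite -[0 in X in X -> _](col_mx0 _ N 1 1) => /eq_col_mx[_].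
  rewrite va ac -scalemxAr -scalerDr => /(congr1 (fun M : 'M[B]_1 => M 0 0)).
  by rewrite inE mxE [in X in _ * X]mxE [RHS]mxE addrC => ->.
case=> x; rewrite inE => /eqP wx ->.
rewrite !inE col_mxKu eqxx andbT ext_mxE Sa {1}ac -scalemxAr -scalerDr addrC subrK.
by rewrite scale_scalar_mx wx raddf0 col_mx0.
Qed.

Hypothesis HG : #|H| = (#|k| ^ j * #|G|)%N.

Lemma presents_quo_by psi y l : presents (@joint B N H psi y) (ext_mx l) ->
  exists f : {linear H -> G}, [/\ forall x, exists h, x = f h,
    forall h, f h = 0 <-> exists b, h = b *: y & forall i, f (psi i) = g i].
Proof.
move=> hT; have [hS hK] := hT.
have [f fE] : exists f : {linear H -> G},
    forall v, f (comb (joint psi y) v) = comb (joint g 0) v.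
  apply: presents_factor hT _ => z; rewrite -(vsubmxK z) ext_mxE comb_joint.
  by rewrite scaler0 addr0; apply/(proj2 gS); exists (usubmx z).
have fpsi a : f (comb psi a) = comb g a.
  by have := fE (col_mx a 0); rewrite !comb_joint mxE !scale0r !addr0.
have fy : f y = 0.
  have := fE (col_mx 0 1%:M); rewrite !comb_joint !linear0 !add0r mxE eqxx.
  by rewrite scale1r.
exists f; split=> [x|h|i].
- by have [v ->] := proj1 gS x; exists (comb psi v); rewrite fpsi.
- split=> [|[b ->]]; last by rewrite linearZ /= fy scaler0.
  have [v ->] := hS h; rewrite -(vsubmxK v); move: (usubmx v) (dsubmx v) => a b.
  rewrite comb_joint linearD linearZ /= fy scaler0 addr0 fpsi => /(proj2 gS)[z ->].
  have : comb (joint psi y) (ext_mx l *m col_mx z 0) = 0 by apply/hK; exists (col_mx z 0).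
  rewrite ext_mxE comb_joint scaler0 addr0 => /eqP; rewrite addr_eq0 => /eqP->.
  by exists (b 0 0 - (l *m z) 0 0); rewrite scalerBl addrC.
- by rewrite -comb_delta fpsi comb_delta.
Qed.

Section FixQuotient.
Variables (y : H) (f : {linear H -> G}).
Hypothesis fS : forall x, exists h, x = f h.
Hypothesis fK : forall h, f h = 0 <-> exists b, h = b *: y.

(** The f (psi i) form again a family presented by S: these families are the images of g under the
    automorphisms of G. *)
Definition compat (psi : {ffun 'I_N -> H}) :=
  [exists s in automorphisms G, [forall i, f (psi i) == s (g i)]].

Definition relator (psi : {ffun 'I_N -> H}) (l : 'rV[B]_N) :=
  [forall i, comb psi (S *m delta_mx i 0) + l 0 i *: y == 0].

Lemma cyclic_ker : cyclic_set y = [set h | f h == 0].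
Proof.
apply/setP => h; rewrite inE; apply/imsetP/eqP => [[b _ ->]|/fK[b ->]].
  by apply/fK; exists b.
by exists b.
Qed.

Lemma card_cyclic_quo : #|cyclic_set y| = (#|k| ^ j)%N.
Proof.
have G0 : (0 < #|G|)%N by apply/card_gt0P; exists 0.
apply/eqP; rewrite -(eqn_pmul2r G0) -HG cyclic_ker; apply/eqP.
rewrite (card_additiveT f); congr (_ * _)%N.
rewrite -cardsT; apply: eq_card => x; rewrite in_setT; apply/esym/imsetP.
by have [h ->] := fS x; exists h.
Qed.

Lemma wj_y : w ^+ j *: y = 0.
Proof.
have [e [_ ey ce _]] := card_cyclic_set BC y.
move: ce; rewrite card_cyclic_quo => /eqP; rewrite eqn_exp2l ?card_field_gt1//.
by move=> /eqP->.
Qed.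

Lemma relatorP (psi : {ffun 'I_N -> H}) l :
  reflect (forall a, comb psi (S *m a) + (l *m a) 0 0 *: y = 0) (relator psi l).
Proof.
apply: (iffP forallP) => [r a|r i]; last first.
  by have := r (delta_mx i 0); rewrite -(colE _ l) mxE => ->.
pose t a := comb psi (S *m a) + (l *m a) 0 0 *: y.
have lt : linear t.
  move=> c u v; rewrite /t !mulmxDr -!scalemxAr linearP mxE scalerDl scalerDr.
  by rewrite [in X in X *: y + _]mxE scalerA addrACA.
rewrite -[LHS]/(mklinear lt a) linear_cV /comb big1// => i _.
have := r i; rewrite mklinearE /t -(colE _ l) mxE => /eqP->.
by rewrite scaler0.
Qed.

(** From right to left: by the relations, the cokernel of [ext_mx l] maps onto H, and both have
    order q^j |G|, so no relation is missing. *)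
Lemma presents_extP (psi : {ffun 'I_N -> H}) l :
  `[< presents (joint psi y) (ext_mx l) >] = compat psi && relator psi l.
Proof.
apply/asboolP/andP => [hT|[/existsP[s /andP[sA /forallP fs]] /relatorP r]].
  have [f' [f'S f'K f'psi]] := presents_quo_by hT; split; last first.
    apply/relatorP => a; have : comb (joint psi y) (ext_mx l *m col_mx a 0) = 0.
      by apply/(proj2 hT); exists (col_mx a 0).
    by rewrite ext_mxE comb_joint scaler0 addr0.
  have [s sE] : exists s : {linear G -> G}, forall h, s (f' h) = f h.
    by apply: linear_factor f'S _ => h /f'K/fK.
  have sinj : injective s.
    move=> x z /eqP; rewrite -subr_eq0 -linearB => /eqP sxz; apply/eqP.
    rewrite -subr_eq0; apply/eqP; move: sxz; have [h ->] := f'S (x - z).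
    by rewrite sE => /fK/f'K.
  apply/existsP; exists (perm sinj); rewrite inE; apply/andP; split.
    by apply/asboolP => a x z; rewrite !permE linearP.
  by apply/forallP => i; rewrite permE -f'psi sE.
move: sA; rewrite inE => /asboolP ls.
have fpsi a : f (comb psi a) = s (comb g a).
  rewrite -(comb_comp psi f) -[s _](comb_comp g (mklinear ls)).
  by apply: eq_comb => i /=; apply/eqP.
have surj x : exists v, x = comb (joint psi y) v.
  have [a aE] := proj1 gS (s^-1 (f x))%g.
  have /fK[b bE] : f (x - comb psi a) = 0.
    by rewrite linearB fpsi -aE permKV subrr.
  exists (col_mx a b%:M); rewrite comb_joint mxE eqxx mulr1n -bE.
  by rewrite addrC subrK.
have kill v : comb (joint psi y) (ext_mx l *m v) = 0.
  rewrite -(vsubmxK v) ext_mxE comb_joint mxE [in X in (_ + X) *: y]mxE.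
  by rewrite scalerDl addrA r add0r mulrC -scalerA wj_y scaler0.
split=> // v; split=> [v0|[z ->]]; last exact: kill.
have sub : mulmx (ext_mx l) @: [set: 'cV[B]_(N + 1)] \subset
    [set v | comb (joint psi y) v == 0].
  by apply/fintype.subsetP => _ /imsetP[z _ ->]; rewrite inE kill.
have c1 := card_additiveT (comb (joint psi y)).
have c2 := card_additiveT (mulmx (ext_mx l) : {additive 'cV[B]_(N + 1) -> _}).
have sE : comb (joint psi y) @: [set: 'cV[B]_(N + 1)] = [set: H].
  apply/setP => x; rewrite in_setT; apply/imsetP.
  by have [u ->] := surj x; exists u.
have H0 : (0 < #|H|)%N by apply/card_gt0P; exists 0.
have cE : #|[set v | comb (joint psi y) v == 0]| =
    #|mulmx (ext_mx l) @: [set: 'cV[B]_(N + 1)]|.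
  apply/eqP; rewrite -(eqn_pmul2r H0) -[#|H| in X in X == _]cardsT -sE -c1 c2 HG.
  by rewrite -(card_ker_ext_mx l) mulnC.
have : v \in mulmx (ext_mx l) @: [set: 'cV[B]_(N + 1)].
  by rewrite (subset_cardP (esym cE) sub) inE v0.
by case/imsetP => z _ ->; exists z.
Qed.

(** The combination of psi along S e_i is killed by f, hence a multiple of y, which fixes the i-th
    entry of l modulo the annihilator of y. *)
Lemma card_relator psi : compat psi ->
  #|[set l | relator psi l]| = (#|ann_set y| ^ N)%N.
Proof.
case/existsP=> s /andP[]; rewrite inE => /asboolP ls /forallP fs.
have ex i : exists b, comb psi (S *m delta_mx i 0) = b *: y.
  apply/fK; rewrite -(comb_comp psi f).
  rewrite (@eq_comb _ _ _ _ (mklinear ls \o g)); last by move=> a; exact: (eqP (fs a)).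
  rewrite comb_comp.
  have -> : comb g (S *m delta_mx i 0) = 0 by apply/(proj2 gS); exists (delta_mx i 0).
  exact: linear0.
pose l0 : 'rV[B]_N := \row_i projT1 (cid (ex i)).
have inj : injective (fun l : 'rV[B]_N => l - l0) := addIr (- l0).
rewrite -card_entries_in -[RHS](card_imset _ inj); apply: eq_card => l.
rewrite inE; apply/forallP/imsetP.
  move=> r; exists (l + l0); last by rewrite addrK.
  rewrite inE; apply/forallP => i; have := r i; rewrite inE !mxE.
  by case: cid => b /= ->; rewrite -scalerDl addrC.
case=> u; rewrite inE => /forallP uS -> i.
have := uS i; rewrite inE !mxE; case: cid => b /= ->.
by rewrite -scalerDl addrCA subrr addr0.
Qed.

(** The automorphism s is determined by its values on the generators g i; given s, each psi i ranges
    over one coset of ker f, the submodule generated by y. *)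
Lemma card_compat :
  #|[set psi | compat psi]| = (#|cyclic_set y| ^ N * #|automorphisms G|)%N.
Proof.
have inj : {in automorphisms G &, injective
    (fun s : {perm G} => [ffun i => s (g i)] : {ffun 'I_N -> G})}.
  move=> s t; rewrite !inE => /asboolP ls /asboolP lt /ffunP st.
  apply/permP => x; have [v ->] := proj1 gS x.
  rewrite -[s _](comb_comp g (mklinear ls)) -[t _](comb_comp g (mklinear lt)).
  by apply: eq_comb => i /=; have := st i; rewrite !ffunE.
rewrite -(card_in_imset inj).
apply: (@card_fibers _ _ (fun psi : {ffun 'I_N -> H} => [ffun i => f (psi i)])).
  move=> psi; rewrite inE => /existsP[s /andP[sA /forallP fs]].
  apply/imsetP; exists s => //; apply/ffunP => i; rewrite !ffunE.
  exact/eqP.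
move=> _ /imsetP[s sA ->].
pose x0 i := projT1 (cid (fS (s (g i)))).
have x0E i : f (x0 i) = s (g i) by rewrite /x0; case: cid.
have injx : injective (fun p : {ffun 'I_N -> H} => [ffun i => p i + x0 i] : {ffun 'I_N -> H}).
  move=> p p' /ffunP pp; apply/ffunP => i; have := pp i; rewrite !ffunE.
  by move/addIr.
rewrite -[N in RHS]card_ord -card_ffun_on -[RHS](card_imset _ injx).
apply: eq_card => psi; rewrite inE; apply/andP/imsetP => [[_ /eqP/ffunP fpsi]|[p pK ->]].
  exists [ffun i => psi i - x0 i]; last by apply/ffunP => i; rewrite !ffunE subrK.
  apply/ffun_onP => i; rewrite ffunE cyclic_ker inE linearB.
  by have := fpsi i; rewrite !ffunE => ->; rewrite x0E subrr.
have fp i : f ([ffun i => p i + x0 i] i) = s (g i).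
  move/ffun_onP: pK => /(_ i); rewrite cyclic_ker inE => /eqP fp.
  by rewrite ffunE linearD fp add0r x0E.
split; last by apply/eqP/ffunP => i; rewrite [LHS]ffunE fp ffunE.
rewrite inE; apply/existsP; exists s; rewrite sA /=.
by apply/forallP => i; rewrite fp.
Qed.

(** The orders of the submodule generated by y and of its annihilator multiply to |B|, so the total
    is the same for all admissible y. *)
Lemma sum_presents_ext :
  (\sum_(psi : {ffun 'I_N -> H})
     #|[set l | `[< presents (joint psi y) (ext_mx l) >]]| =
   #|automorphisms G| * #|B| ^ N)%N.
Proof.
rewrite -(card_cyclic_ann y) expnMn mulnA [X in (X * _)%N]mulnC -card_compat.
rewrite -sum1dep_card big_distrl [RHS]big_mkcond; apply: eq_bigr => psi _ /=.
case: ifP => cp.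
  rewrite mul1n -(card_relator cp); apply: eq_card => l.
  by rewrite !inE presents_extP cp.
by apply: eq_card0 => l; rewrite !inE presents_extP cp.
Qed.
End FixQuotient.

(** Triples (y, psi, l) such that (psi, y) is presented by [ext_mx l], counted by y on the left and
    by l on the right. *)
Lemma card_quo_by :
  (#|[set y : H | `[< quo_by G y >]]| * (#|automorphisms G| * #|B| ^ N))%N =
  (#|automorphisms H| * #|[set l : 'rV[B]_N |
     `[< exists h : {ffun 'I_(N + 1) -> H}, presents h (ext_mx l) >]]|)%N.
Proof.
transitivity (\sum_(y : H) \sum_(psi : {ffun 'I_N -> H})
    #|[set l | `[< presents (joint psi y) (ext_mx l) >]]|)%N.
  rewrite -sum_nat_const big_mkcond; apply: eq_bigr => y _; rewrite inE.
  case: asboolP => [[f [fS fK]]|nq]; first by rewrite (sum_presents_ext fS fK).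
  apply/esym; rewrite big1// => psi _; apply: eq_card0 => l; rewrite inE.
  apply/asboolP => hT; apply: nq; have [f [fS fK _]] := presents_quo_by hT.
  by exists f.
transitivity (\sum_(l : 'rV[B]_N)
    #|[set h : {ffun 'I_(N + 1) -> H} | `[< presents h (ext_mx l) >]]|)%N; last first.
  under eq_bigr do rewrite card_presents.
  rewrite -big_distrr; congr (_ * _)%N; rewrite -sum1dep_card [RHS]big_mkcond.
  by apply: eq_bigr => l _; case: asboolP.
have bf : bijective (fun p : H * {ffun 'I_N -> H} =>
    [ffun i => joint p.2 p.1 i] : {ffun 'I_(N + 1) -> H}).
  exists (fun h : {ffun 'I_(N + 1) -> H} => (h (rshift N 0), [ffun i => h (lshift 1 i)] : {ffun 'I_N -> H})).
    move=> [y psi]; congr (_, _) => /=; first by rewrite ffunE joint_rshift.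
    by apply/ffunP => i; rewrite !ffunE joint_lshift.
  move=> h; apply/ffunP => i; rewrite ffunE /=.
  by rewrite -[i]fintype.splitK; case: (fintype.split i) => a /=;
    rewrite ?joint_lshift ?joint_rshift ?ffunE// (ord1 a).
under [in RHS]eq_bigr do rewrite (card_sum_pair _ bf).
rewrite [RHS]exchange_big; apply: eq_bigr => y _ /=.
under eq_bigr do rewrite -sum1dep_card.
under [in RHS]eq_bigr do rewrite -sum1dep_card.
rewrite (exchange_big_dep xpredT)//=; apply: eq_bigr => l _.
apply: eq_bigl => psi; rewrite (_ : fun_of_fin _ = joint psi y)//.
by apply/funext => i; rewrite ffunE.
Qed.
End ChainExtensionCount.

(** * A uniformizer at a prime of the ring of integers *)

Section RingOfIntegersArithmetic.
Variables (L : fieldExtType rat) (p : prime_idealr (ringOfIntegers L)).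
Local Notation O := (ringOfIntegers L).

Lemma roi_integral_domain (x y : O) : x * y = 0 -> x = 0 \/ y = 0.
Proof.
move/(congr1 val); rewrite rmorphM rmorph0 => /eqP.
rewrite mulf_eq0 => /orP[] /eqP e; [left|right]; apply/val_inj; exact: e.
Qed.

Lemma roi_mulI (x : O) : x != 0 -> injective ( *%R x).
Proof.
move=> x0 y z /eqP; rewrite -subr_eq0 -mulrBr => /eqP/roi_integral_domain[/eqP|/eqP].
  by rewrite (negPf x0).
by rewrite subr_eq0 => /eqP.
Qed.

Lemma roi_natr_neq0 n : (0 < n)%N -> n%:R != 0 :> O.
Proof.
move=> n0; apply/eqP => /(congr1 val); rewrite rmorph_nat rmorph0 => /eqP.
have -> : n%:R = (n%:R : rat)%:A :> L by rewrite scaler_nat.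
by rewrite scaler_eq0 oner_eq0 orbF pnatr_eq0 (gtn_eqF n0).
Qed.

Lemma prime_ideal_exp (x : O) n : x \notin p -> x ^+ n \notin p.
Proof.
move=> xp; elim: n => [|n IH]; first by rewrite expr0 idealr1.
by rewrite exprS prime_idealrM negb_or xp.
Qed.

(** After cancelling powers of x in an integral equation, the constant term is a non-zero integer
    divisible by x. The least positive integer in p is then prime because p is. *)
Lemma ideal_nat_exists : (exists2 x, x \in (p : {pred O}) & x != 0) ->
  exists l, prime l /\ (l%:R : O) \in p.
Proof.
case=> x xp x0.
have [c c0 cp] : exists2 c : int, c != 0 & (c%:~R : O) \in p.
  have [f fm fx] : integralOver (intr : int -> L) (val x).
    by apply/asboolP; exact: valP x.
  have {fx} : (map_poly intr f).[x] = 0 :> O.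
    apply/val_inj; rewrite rmorph0 -horner_map.
    rewrite (_ : map_poly val _ = map_poly intr f); first exact/eqP.
    by apply/polyP => i; rewrite !coef_map [LHS]rmorph_int.
  have := monic_neq0 fm; elim/poly_ind: f {fm} => [|f c IH]; first by rewrite eqxx.
  rewrite rmorphD rmorphM /= map_polyX map_polyC /= !hornerE => fc0.
  have [c_eq0|c0] := eqVneq c 0.
    rewrite c_eq0 in fc0 *; rewrite addr0 => /roi_integral_domain[|/eqP]; last first.
      by rewrite (negPf x0).
    apply: IH; apply: contraNneq fc0 => ->.
    by rewrite mul0r add0r polyC0.
  move/eqP; rewrite addrC addr_eq0 => /eqP cE; exists c => //.
  by rewrite cE rpredN idealMr.
have ex : exists n, (0 < n)%N && ((n%:R : O) \in p).
  exists `|c|%N; rewrite absz_gt0 c0 /=.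
  by case: c {c0} cp => n //=; rewrite NegzE rmorphN /= rpredN.
case: (ex_minnP ex) => l /andP[l0 lp] lmin; exists l; split=> //.
have l1 : (1 < l)%N.
  by case: l l0 lp {lmin} => [|[|l]]//; rewrite idealr1.
have rP := pdiv_prime l1; have /dvdnP[m mE] := pdiv_dvd l.
suff rl : (pdiv l)%:R \in p.
  suff -> : l = pdiv l by [].
  apply/eqP; rewrite eqn_leq pdiv_leq// andbT lmin// rl andbT.
  exact: prime_gt0.
move: lp; rewrite {1}mE natrM prime_idealrM => /orP[mp|//].
have m0 : (0 < m)%N by move: l0; rewrite {1}mE; case: (m).
have /lmin : (0 < m)%N && ((m%:R : O) \in p) by rewrite m0.
by rewrite {1}mE leqNgt ltn_Pmulr ?prime_gt1.
Qed.

(** * The ring of integers modulo a prime number *)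

Section ModuloPrime.
Variable l : nat.
Hypotheses (lP : prime l) (lp : (l%:R : O) \in p).

Definition eqm (x y : O) := exists z, x = y + l%:R * z.

Lemma eqm_refl x : eqm x x. Proof. by exists 0; rewrite mulr0 addr0. Qed.
Lemma eqm_sym x y : eqm x y -> eqm y x.
Proof. by case=> z ->; exists (- z); rewrite mulrN addrK. Qed.
Lemma eqm_trans x y z : eqm x y -> eqm y z -> eqm x z.
Proof. by case=> a -> [b ->]; exists (b + a); rewrite mulrDr addrA. Qed.
Lemma eqmD x y z t : eqm x y -> eqm z t -> eqm (x + z) (y + t).
Proof. by case=> a -> [b ->]; exists (a + b); rewrite mulrDr addrACA. Qed.
Lemma eqmM x y z t : eqm x y -> eqm z t -> eqm (x * z) (y * t).
Proof.
case=> a -> [b ->]; exists (a * t + y * b + l%:R * (a * b)).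
ring.
Qed.
Lemma eqm_ideal x y : eqm x y -> (x \in p) = (y \in p).
Proof. by case=> z ->; rewrite rpredDr// mulrC idealMr. Qed.

Definition indep_mod (s : seq O) := forall c : nat -> int,
  eqm (\sum_(i < size s) (c i)%:~R * s`_i) 0 ->
  forall i, (i < size s)%N -> (l %| c i)%Z.

(* A nontrivial integral relation could be divided by l forever, so elements
   independent modulo l are independent over the rationals. *)
Lemma indep_mod_size s : indep_mod s -> (size s <= \dim {: L})%N.
Proof.
move=> si; have l0 := roi_natr_neq0 (prime_gt0 lP).
have relation_div (c : nat -> int) m :
    \sum_(i < size s) (c i)%:~R * s`_i = 0 :> O ->
    forall i, (i < size s)%N -> (l%:Z ^+ m %| c i)%Z.
  elim: m c => [|m IH] c c0 i ir; first by rewrite expr0 dvd1z.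
  have lc j : (j < size s)%N -> (l %| c j)%Z.
    by apply: si; rewrite c0; exact: eqm_refl.
  have cE j : (j < size s)%N -> c j = (l%:Z * (c j %/ l)%Z)%R.
    by move=> js; rewrite mulrC divzK// lc.
  rewrite cE// exprS dvdz_mul2l ?eqz_nat -?lt0n ?prime_gt0//.
  apply: (IH (fun j => (c j %/ l)%Z)) => //.
  apply: (roi_mulI l0); rewrite mulr0 -[RHS]c0 mulr_sumr.
  apply: eq_bigr => j _; rewrite [in RHS]cE// rmorphM /= mulrA.
  by rewrite -pmulrn.
have sfree : free (map_tuple val (in_tuple s)).
  apply/freeP => q q0 i.
  pose d : int := \prod_(j < size s) denq (q j).
  have d0 : d != 0 by apply/prodf_neq0 => j _; rewrite denq_eq0.
  (* Numerators over the common denominator d, indexed by all naturals as [relation_div] requires;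
     out of range there is no constraint. *)
  have ex (j : nat) : exists c : int,
      if insub j is Some j' then q j' * d%:~R = c%:~R else true.
    case: insubP => [j' _ _|_]; last by exists 0.
    exists (numq (q j') * \prod_(a < size s | a != j') denq (q a)).
    rewrite /d (bigD1 j')//= rmorphM rmorphM /= mulrA; congr (_ * _).
    by rewrite -{1}(divq_num_den (q j')) divfK// intr_eq0 denq_eq0.
  pose c j := projT1 (cid (ex j)).
  have cE (j : 'I_(size s)) : q j * d%:~R = (c j)%:~R.
    by rewrite /c; case: cid => x /=; rewrite valK.
  have c0 : \sum_(j < size s) (c j)%:~R * s`_j = 0 :> O.
    apply/val_inj; rewrite rmorph0 rmorph_sum.
    transitivity (d%:~R *: \sum_(j < size s) q j *: (val s`_j) : L).
      rewrite scaler_sumr; apply: eq_bigr => j _.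
      rewrite scalerA [d%:~R * _]mulrC cE rmorphM rmorph_int.
      by rewrite scaler_int mulrzl.
    suff -> : \sum_(j < size s) q j *: (val s`_j) = 0 :> L by rewrite scaler0.
    by rewrite -[RHS]q0; apply: eq_bigr => j _; rewrite (nth_map 0).
  have /eqP : (c i)%:~R = 0 :> rat.
    have ci m : (l%:Z ^+ m %| c i)%Z by apply: relation_div.
    suff -> : c i = 0 by [].
    apply/eqP; rewrite -absz_eq0 -leqn0 leqNgt; apply/negP => ci0.
    have := ci `|c i|%N; rewrite dvdzE abszX /= => /(dvdn_leq ci0).
    by rewrite leqNgt ltn_expl// prime_gt1.
  by rewrite -cE mulf_eq0 intr_eq0 (negPf d0) orbF => /eqP.
apply: (@leq_trans (\dim <<map_tuple val (in_tuple s)>>)).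
  by rewrite (eqP (sfree : \dim _ == _)) size_tuple.
exact/dimvS/subvf.
Qed.

(** A largest family independent modulo l, of size at most the degree of L, spans O modulo l; the
    representatives are its combinations with coefficients from 0 to l - 1. *)
Lemma finite_mod : exists s : seq O, forall x, exists2 y, y \in s & eqm x y.
Proof.
have lu (a : int) : ~~ (l %| a)%Z -> exists b c : int, b * a = 1 + l%:Z * c.
  rewrite dvdzE /= => la.
  have /eqP cop : coprimez a l.
    by rewrite coprimezE coprime_sym prime_coprime.
  have [b [c bc]] := Bezoutz a l; exists b, (- c).
  rewrite cop in bc; rewrite mulrN -bc; ring.
pose P n := `[< exists s : seq O, size s = n /\ indep_mod s >].
have P0 : exists n, P n.
  by exists 0%N; apply/asboolP; exists [::]; split=> // c _ i.
have Pb n : P n -> (n <= \dim {: L})%N.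
  by move=> /asboolP[s [<- /indep_mod_size]].
case: (ex_maxnP P0 Pb) => n /asboolP[s [sn si]] nmax.
exists [seq \sum_(i < n) (f i)%:R * s`_i | f : {ffun 'I_n -> 'I_l}] => y.
have [c [ci [c0 cl]]] : exists c : nat -> int, exists i : nat,
    eqm (\sum_(i < n.+1) (c i)%:~R * (y :: s)`_i) 0 /\
    ((i < n.+1)%N && ~~ (l %| c i)%Z).
  apply: contrapT => H; have /nmax : P n.+1; last by rewrite ltnn.
  apply/asboolP; exists (y :: s); rewrite /= sn; split=> // c c0 i i_lt.
  apply: contrapT => lci; apply: H; exists c, i; split; first by move: c0; rewrite /= sn.
  by move: i_lt; rewrite /= sn => ->; apply/negP.
move: c0; rewrite big_ord_recl /=.
(* If l divides the coefficient of y, the relation is one among s alone; otherwise this coefficient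
   is invertible modulo l, and y can be solved for. *)
have [lc0|nlc0] := boolP (l %| c 0%N)%Z.
  move=> c0; case/andP: cl => cin /negP[]; case: ci cin => [//|ci cin].
  apply: (si (fun i => c i.+1)); last by rewrite sn.
  rewrite sn; have [z cz] : exists z, c 0%N = l%:Z * z.
    by exists (c 0%N %/ l)%Z; rewrite mulrC divzK.
  case: c0 => u cu; exists (u - z%:~R * y); rewrite add0r mulrBr.
  rewrite add0r in cu; rewrite -cu cz rmorphM /= -pmulrn mulrA.
  by rewrite addrAC subrr add0r.
have [b [d bd]] := lu _ nlc0; case=> u; rewrite add0r => cu.
pose f : {ffun 'I_n -> 'I_l} := [ffun i =>
  Ordinal (ltn_pmod `|((- b * c (lift ord0 i)) %% l)%Z|%N (prime_gt0 lP))].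
exists (\sum_(i < n) (f i)%:R * s`_i); first by apply/fintype.imageP; exists f.
have yE : eqm y (\sum_(i < n) (- b * c (lift ord0 i))%:~R * s`_i).
  exists (b%:~R * u - d%:~R * y).
  have -> : \sum_(i < n) (- b * c (lift ord0 i))%:~R * s`_i =
      - b%:~R * \sum_(i < n) (c (lift ord0 i))%:~R * s`_i.
    rewrite mulr_sumr; apply: eq_bigr => i _.
    by rewrite rmorphM rmorphN /= mulrA.
  have cu' := congr1 ( *%R b%:~R) cu; rewrite mulrDr mulrA -rmorphM /= bd in cu'.
  rewrite rmorphD rmorphM /= -pmulrn in cu'.
  move: cu'; set S := \sum_(_ < _) _ => cu'.
  rewrite mulrBr mulrCA -cu' mulrA; ring.
apply: (eqm_trans yE); apply: big_ind2 => [|x x' z z'|i _].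
- exact: eqm_refl.
- exact: eqmD.
have l0 : 0 < l%:Z by rewrite ltz_nat prime_gt0.
have lneq0 : l%:Z != 0 by rewrite gt_eqF.
apply: eqmM (eqm_refl _); rewrite ffunE /= modn_small; last first.
  by rewrite -ltz_nat gez0_abs ?modz_ge0 ?ltz_pmod.
set a := - b * _; pose e : int := (a %/ l)%Z; exists e%:~R; rewrite /e.
rewrite {1}(divz_eq a l) rmorphD rmorphM /= addrC; congr (_ + _).
  by rewrite pmulrn gez0_abs// modz_ge0.
by rewrite mulrC -pmulrn.
Qed.
Lemma eqm_mul0 x y z : eqm x y -> eqm (y * z) 0 -> eqm (x * z) 0.
Proof. by move=> xy; apply: eqm_trans; apply: eqmM xy (eqm_refl _). Qed.

Lemma eqm_pigeonhole (a : nat -> O) : exists i j, (i < j)%N /\ eqm (a i) (a j).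
Proof.
have [s sP] := finite_mod.
have ex n : exists i : 'I_(size s), eqm (a n) s`_i.
  have [y ys ay] := sP (a n).
  have ls : (index y s < size s)%N by rewrite index_mem.
  by exists (Ordinal ls); rewrite /= nth_index.
pose f (n : 'I_(size s).+1) := projT1 (cid (ex n)).
have fE (n : 'I_(size s).+1) : eqm (a n) s`_(f n) by rewrite /f; case: cid.
clearbody f.
have [i [j [ij fij]]] : exists i j : 'I_(size s).+1, (i < j)%N /\ f i = f j.
  apply: contrapT => H; have injf : injective f.
    move=> i j fij; case: (ltngtP (i : nat) (j : nat)) => [ij|ji|/ord_inj//].
      by case: H; exists i, j; exact: (conj ij fij).
    by case: H; exists j, i; exact: (conj ji (esym fij)).
  by have := leq_card f injf; rewrite !card_ord ltnn.
exists i, j; split=> //; apply: (eqm_trans (fE i)).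
by rewrite fij; apply/eqm_sym/fE.
Qed.

(** Multiplication by t stands in for localization at p: as the product of the representatives
    outside p, t is modulo l a multiple of every element outside p. Two powers of x agree modulo l,
    so l divides x^i (1 - x^(j-i)), whose second factor is outside p. *)
Lemma local_annihilator : exists t : O, t \notin p /\
  forall x, x \in p -> exists i, eqm (t * x ^+ i) 0.
Proof.
have [s sP] := finite_mod.
pose t := \prod_(e <- s | e \notin p) e; exists t; split.
  rewrite /t; elim: s {sP t} => [|e s IH]; first by rewrite big_nil idealr1.
  by rewrite big_cons; case: ifP => // ep; rewrite prime_idealrM negb_or ep.
move=> x xp; have [i [j [ij xij]]] := eqm_pigeonhole (fun n => x ^+ n).
exists i; pose e := 1 - x ^+ (j - i).
have ep : e \notin p.
  apply/negP => ep; have : (1 : O) \in p.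
    rewrite -[1](subrK (x ^+ (j - i))) rpredD//.
    by rewrite -(subnSK ij) exprSr idealMr.
  by rewrite idealr1.
have [e' e's ee'] := sP e.
have [t' tE] : exists t', t = e' * t'.
  have : e' \notin p by rewrite -(eqm_ideal ee').
  rewrite /t; elim: (s) e's => // a r IH; rewrite inE => /predU1P[<-|e'r] e'p.
    by rewrite big_cons e'p; exists (\prod_(e <- r | e \notin p) e).
  have [t' t'E] := IH e'r e'p; rewrite big_cons; case: ifP => _.
    by exists (a * t'); rewrite t'E mulrCA.
  by exists t'.
rewrite tE; have ex0 : eqm (e * x ^+ i) 0.
  case: xij => z xz; rewrite /e mulrBl mul1r -exprD subnK 1?ltnW//.
  by exists z; rewrite add0r xz addrAC subrr add0r.
rewrite mulrAC -[0](mul0r t'); apply: eqmM (eqm_refl _).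
exact: eqm_mul0 (eqm_sym ee') ex0.
Qed.

(* Among the multiples t c outside l O, one generating a minimal ideal modulo l
   works: otherwise t c = t c (x d) mod l with x in p, and x d acts nilpotently
   on t. *)
Lemma socle_element : exists b : O, ~ eqm b 0 /\ forall x, x \in p -> eqm (b * x) 0.
Proof.
have [t [tp tnil]] := local_annihilator; have [s sP] := finite_mod.
pose mu (b : O) := count (fun y : O => `[< exists c : O, eqm y (b * c) >]) s.
pose P n := `[< exists c : O, ~ eqm (t * c) 0 /\ mu (t * c) = n >].
have exP : exists n, P n.
  exists (mu (t * 1)); apply/asboolP; exists 1; split=> //.
  by rewrite mulr1 => /eqm_ideal; rewrite idealr0 (negPf tp).
case: (ex_minnP exP) => n /asboolP[c [tc cn]] nmin.
exists (t * c); split=> // x xp; apply: contrapT => tcx.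
have mule : (mu (t * c)%R <= mu (t * c * x)%R)%N.
  by rewrite cn; apply: nmin; apply/asboolP; exists (c * x); rewrite mulrA.
have sub (y : O) : `[< exists d : O, eqm y (t * c * x * d) >] ->
    `[< exists d : O, eqm y (t * c * d) >].
  by move=> /asboolP[d yd]; apply/asboolP; exists (x * d); rewrite mulrA.
have [b bs tcb] := sP (t * c).
have : `[< exists d : O, eqm b (t * c * x * d) >].
  have eqc : mu (t * c) = mu (t * c * x).
    by apply/eqP; rewrite eqn_leq mule; apply: sub_count => y; apply: sub.
  apply: contrapT => nb; move: eqc; apply/eqP; rewrite gtn_eqF//.
  rewrite /mu; elim: (s) bs => // a r IH; rewrite inE => /predU1P[<-|br] /=.
    have -> : `[< exists d : O, eqm b (t * c * d) >].
      by apply/asboolP; exists 1; rewrite mulr1; exact: eqm_sym.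
    rewrite (negPf (introN idP nb)) add0n add1n ltnS.
    by apply: sub_count => y; apply: sub.
  rewrite -addnS leq_add ?IH//.
  by case H : `[< exists d : O, eqm a (t * c * x * d) >]; rewrite ?(sub _ H).
move/asboolP => [d bd]; have tcxd : eqm (t * c) (t * c * (x * d)).
  by apply: eqm_trans tcb _; rewrite mulrA.
have [|i ti] := tnil (x * d); first by rewrite mulrC idealMr.
apply: tc.
have H j : eqm (t * c) (t * c * (x * d) ^+ j).
  elim: j => [|j IH]; first by rewrite expr0 mulr1; exact: eqm_refl.
  apply: (eqm_trans IH); rewrite exprS mulrA; apply: eqmM (eqm_refl _).
  exact: tcxd.
apply: eqm_trans (H i) _; rewrite mulrAC.
by apply: eqm_mul0 ti _; rewrite mul0r; exact: eqm_refl.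
Qed.

(* Otherwise b/l stabilizes p, so its powers lie in l^-1 O; two of them agree
   modulo O, and b/l is integral. *)
Lemma socle_not_stable (b : O) : ~ eqm b 0 ->
  ~ (forall a, a \in p -> exists2 a', a' \in p & b * a = l%:R * a').
Proof.
move=> b0 bp; have l0 := roi_natr_neq0 (prime_gt0 lP).
pose nxt (a : {x : O | x \in p}) : {x : O | x \in p} :=
  let a' := cid2 (bp (val a) (valP a)) in exist _ (s2val a') (s2valP a').
have nxtE a : b * val a = l%:R * val (nxt a) by rewrite /nxt /=; case: cid2.
pose a n := val (iter n nxt (exist _ l%:R lp)).
have aS n : b * a n = l%:R * a n.+1 by rewrite /a iterS nxtE.
have l0L : (l%:R : L) != 0.
  by apply: contraNneq l0 => e; apply/eqP/val_inj; rewrite rmorph_nat e rmorph0.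
pose v : {rmorphism O -> L} := val.
have valn : v l%:R = l%:R by rewrite rmorph_nat.
pose z : L := v b / l%:R; have vb : v b = z * l%:R by rewrite divfK.
clearbody z.
have aE n : v (a n) = z ^+ n * l%:R.
  elim: n => [|n IH]; first by rewrite expr0 mul1r; exact: valn.
  apply: (mulfI l0L); have := congr1 v (aS n); rewrite !rmorphM valn IH => <-.
  by rewrite vb exprS; ring.
have [i [j [ij [c aij]]]] := eqm_pigeonhole a.
have zij : z ^+ j - z ^+ i + v c = 0.
  apply: (mulIf l0L); rewrite mul0r mulrDl mulrBl -!aE aij rmorphD rmorphM valn.
  ring.
have : integralOver (intr : int -> L) z.
  pose f : {poly L} := 'X^j - 'X^i + (v c)%:P.
  have fI : f \is a polyOver (@integral_pred L).
    by rewrite rpredD ?rpredB ?rpredX ?polyOverX// polyOverC; exact: valP.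
  apply: (@integral_root_monic _ _ (intr : {rmorphism int -> L}) z f).
  - rewrite monicE /f -addrA lead_coefDl ?lead_coefXn// size_polyXn.
    apply: leq_ltn_trans (size_polyD _ _) _; rewrite gtn_max size_polyN size_polyXn.
    by rewrite ltnS ij (leq_ltn_trans (size_polyC_leq1 _))// ltnS (leq_ltn_trans _ ij).
  - by rewrite /root !hornerE zij.
  - by move=> d df; have /allP/(_ _ df)/asboolP := fI.
move=> zI; apply: b0; have zO : z \in @integral_pred L by apply/asboolP.
exists (RingOfIntegers zO); rewrite add0r; apply: (@val_inj _ _ O).
by rewrite -[RHS]/(v _) rmorphM valn -[LHS]/(v b) vb mulrC.
Qed.
End ModuloPrime.

Hypothesis p_neq0 : exists2 x, x \in (p : {pred O}) & x != 0.

Lemma residue_reps : exists s : seq O, forall x, exists2 y, y \in s & x - y \in p.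
Proof.
have [l [lP lp]] := ideal_nat_exists p_neq0.
have [s sP] := finite_mod lP; exists s => x; have [y ys [z ->]] := sP x.
by exists y => //; rewrite addrC addKr mulrC idealMr.
Qed.

Lemma uniformizer_exists : exists w u : O, [/\ w \in p, u \notin p,
  forall a, a \in p -> exists a', u * a = w * a' &
  forall j, w ^+ j \notin ideal_exp p j.+1].
Proof.
have [l [lP lp]] := ideal_nat_exists p_neq0.
have l0 := roi_natr_neq0 (prime_gt0 lP).
have [b [b0 bp]] := socle_element lP lp.
have bdiv a : a \in p -> exists a', b * a = l%:R * a'.
  by move=> /bp[c ->]; exists c; rewrite add0r.
have [w wp [u bw up]] : exists2 w, w \in p &
    exists2 u, b * w = l%:R * u & u \notin p.
  apply: contrapT => H; apply: (socle_not_stable lP lp b0) => a ap.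
  have [a' aE] := bdiv a ap; exists a' => //; apply: contrapT => a'p.
  by apply: H; exists a => //; exists a' => //; apply/negP.
exists w, u; split=> // [a ap|j].
  have [a' aE] := bdiv a ap; exists a'; apply: (roi_mulI l0).
  by rewrite mulrA -bw mulrAC aE mulrAC mulrA.
have scale i a : a \in ideal_exp p i -> exists a', b ^+ i * a = l%:R ^+ i * a'.
  elim: i a => [|i IH] a; first by move=> _; exists a; rewrite !expr0.
  case/asboolP => s sI ->; elim: s sI => [|[x y] s IHs] /=.
    by exists 0; rewrite big_nil !mulr0.
  case/andP=> /andP[/= /bdiv[x' xE] /IH[y' yE]] /IHs[c cE].
  exists (x' * y' + c); rewrite big_cons /= !mulrDr cE; congr (_ + _).
  have -> : b ^+ i.+1 * (x * y) = b * x * (b ^+ i * y) by rewrite exprS; ring.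
  by rewrite xE yE exprS; ring.
apply: contra (prime_ideal_exp j up) => /asboolP[s sI wE].
(* In a product of j + 1 factors from p, the power b^j absorbs j of them, and the remaining one
   keeps c in p. On the other hand b w = l u gives c = u^j, which is outside p. *)
have [c cp cE] : exists2 c, c \in p & b ^+ j * w ^+ j = l%:R ^+ j * c.
  rewrite wE; elim: s sI {wE} => [|[x y] s IHs] /=.
    by exists 0; rewrite ?rpred0// big_nil !mulr0.
  case/andP=> /andP[/= xp /scale[y' yE]] /IHs[c cp cE].
  exists (x * y' + c); first by rewrite rpredD// mulrC idealMr.
  by rewrite big_cons /= !mulrDr cE mulrCA yE; ring.
suff -> : u ^+ j = c by [].
have lj i : injective ( *%R (l%:R ^+ i : O)).
  elim: i => [|i IH] x y; first by rewrite expr0 !mul1r.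
  by rewrite exprS -!mulrA => /(roi_mulI l0)/IH.
by apply: (lj j); rewrite -cE -!exprMn bw.
Qed.
End RingOfIntegersArithmetic.

(** * The quotients by the powers of a prime *)

Section FiniteRing.
Variables (T : comNzRingType) (s : seq T).
Hypothesis sP : forall x, x \in s.

Let pickleK : pcancel (fun x : T => index x s) (fun n => Some (nth 0 s n)).
Proof. by move=> x; rewrite nth_index. Qed.

Let countT := PCanIsCountable pickleK.

Let enumP : Finite.axiom (undup s).
Proof. by move=> x; rewrite count_uniq_mem ?undup_uniq// mem_undup sP. Qed.

Definition classical_unit : {pred T} := fun x => `[< exists y, y * x = 1 >].
Definition classical_inv (x : T) : T :=
  if pselect (exists y, y * x = 1) is left e then projT1 (cid e) else x.

Let mulVx : {in classical_unit, left_inverse 1 classical_inv *%R}.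
Proof.
move=> x /asboolP ux; rewrite /classical_inv; case: pselect => // e.
by case: cid.
Qed.
Let unitP x y : y * x = 1 -> classical_unit x.
Proof. by move=> xy; apply/asboolP; exists y. Qed.
Let inv_out : {in [predC classical_unit], classical_inv =1 id}.
Proof.
move=> x /negP nu; rewrite /classical_inv; case: pselect => // e; case: nu.
exact/asboolP.
Qed.

(** The carrier and operations of T are kept, so that matrices over this ring are literally those in
    the definition of [Sp_set]. *)
Definition fin_ring : finComUnitRingType := HB.pack (GRing.ComNzRing.sort T)
  (GRing.ComNzRing_hasMulInverse.Build T mulVx unitP inv_out)
  countT (fintype.isFinite.Build T enumP).

Lemma fin_ring_unit (x : fin_ring) :
  x \is a GRing.unit <-> exists y : T, y * (x : T) = 1.
Proof. by split=> [/asboolP//|h]; apply/asboolP. Qed.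

End FiniteRing.
Section FiniteField.
Variables (T : comNzRingType) (s : seq T).
Hypothesis sP : forall x, x \in s.
Hypothesis invP : forall x : T, x != 0 -> exists y, y * x = 1.

Let fieldP : GRing.field_axiom (fin_ring sP).
Proof. by move=> x x0; apply/fin_ring_unit/invP. Qed.

Definition fin_field : finFieldType :=
  HB.pack (FinRing.ComUnitRing.sort (fin_ring sP))
    (GRing.ComUnitRing_isField.Build (fin_ring sP) fieldP).
End FiniteField.

Section PrimeQuotient.
Variables (A : comNzRingType) (p : prime_idealr A).
Variables (s : seq A) (w u : A).
Hypothesis sP : forall x, exists2 y, y \in s & x - y \in p.
Hypothesis wp : w \in p.
Hypothesis up : u \notin p.
Hypothesis uw : forall a, a \in p -> exists a', u * a = w * a'.
Hypothesis w_exp : forall j, w ^+ j \notin ideal_exp p j.+1.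

Lemma ideal_expX x n : x \in p -> x ^+ n \in ideal_exp p n.
Proof.
move=> xp; elim: n => [|n IH]; first by rewrite expr0.
rewrite exprS /=; apply/asboolP; exists [:: (x, x ^+ n)]; first by rewrite /= xp IH.
by rewrite big_cons big_nil addr0.
Qed.

Lemma ideal_exp_le i j x : (i <= j)%N -> x \in ideal_exp p j -> x \in ideal_exp p i.
Proof.
move=> ij; rewrite -(subnK ij) => xj; elim: (j - i)%N x xj => [//|n IH] x.
rewrite addSn; case/asboolP => r rI ->; elim: r rI => [|[a b] r IHr] /=.
  by rewrite big_nil ideal_exp0.
case/andP=> /andP[/= ap bi] rI; rewrite big_cons.
by apply: ideal_exp_linear; [exact: IH|exact: IHr].
Qed.

(** Two powers of x agree modulo p by the pigeonhole principle, and the smaller one can be cancelled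
    as p is prime. *)
Lemma mod_inverse x : x \notin p -> exists y, 1 - x * y \in p.
Proof.
move=> xp; have ex n : exists i : 'I_(size s), x ^+ n - s`_i \in p.
  have [y ys xy] := sP (x ^+ n).
  have ls : (index y s < size s)%N by rewrite index_mem.
  by exists (Ordinal ls); rewrite /= nth_index.
pose f (n : 'I_(size s).+1) := projT1 (cid (ex n)).
have fE (n : 'I_(size s).+1) : x ^+ n - s`_(f n) \in p by rewrite /f; case: cid.
clearbody f.
have [i [j [ij fij]]] : exists i j : 'I_(size s).+1, (i < j)%N /\ f i = f j.
  apply: contrapT => H; have injf : injective f.
    move=> i j fij; case: (ltngtP (i : nat) (j : nat)) => [ij|ji|/ord_inj//].
      by case: H; exists i, j; exact: (conj ij fij).
    by case: H; exists j, i; exact: (conj ji (esym fij)).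
  by have := leq_card f injf; rewrite !card_ord ltnn.
exists (x ^+ (j - i).-1).
rewrite -exprS prednK ?subn_gt0//.
have : x ^+ i * (1 - x ^+ (j - i)) \in p.
  rewrite mulrBr mulr1 -exprD subnKC 1?ltnW//.
  have -> : x ^+ i - x ^+ j = (x ^+ i - s`_(f i)) - (x ^+ j - s`_(f j)).
    by rewrite fij opprB addrA subrK.
  by rewrite rpredB.
rewrite prime_idealrM => /orP[xi|//]; exfalso; move: xi.
by elim: (i : nat) => [|n IH]; rewrite ?expr0 ?idealr1// exprS prime_idealrM (negPf xp).
Qed.

Let K0 : comNzRingType := {ideal_quot p}.
Let piK : A -> K0 := \pi_({ideal_quot p})%qT.

Lemma residue_mem (x : K0) : x \in [seq piK y | y <- s].
Proof.
have [y ys xy] := sP (repr x); apply/mapP; exists y => //.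
by rewrite -[x]reprK; apply/eqP; rewrite -Quotient.idealrBE.
Qed.

Lemma residue_inv (x : K0) : x != 0 -> exists y, y * x = 1.
Proof.
rewrite -[x]reprK -(rmorph0 piK) => xp.
have [|y xy] := @mod_inverse (repr x).
  apply: contra xp; rewrite -{1}[repr x]subr0 Quotient.idealrBE.
  by move/eqP => ->.
exists (piK y); rewrite -rmorphM -(rmorph1 piK); apply/eqP.
rewrite -[_ == _]Quotient.idealrBE -opprB rpredN mulrC.
exact: xy.
Qed.

Definition residue_field : finFieldType := fin_field residue_mem residue_inv.

Section Power.
Variable F : nat.
Let B0 : comNzRingType := quot_exp p F.
Let piB : {rmorphism A -> B0} := quot_pi p F.

Lemma piB_eq0 a : (piB a == 0) = (a \in ideal_exp p F.+1).
Proof.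
by rewrite -(rmorph0 piB) -[_ == _]Quotient.idealrBE subr0.
Qed.

Lemma piB_surj x : exists a, piB a = x.
Proof. by exists (repr x); rewrite [LHS]reprK. Qed.

(** With b inverse to a modulo p, 1 - a b is nilpotent in the quotient, and a geometric series
    inverts a b. *)
Lemma piB_unit a : a \notin p -> exists y, y * piB a = 1.
Proof.
move=> ap; have [b ab] := mod_inverse ap.
have nil : (1 - piB (a * b)) ^+ F.+1 = 0.
  by rewrite -(rmorph1 piB) -rmorphB -rmorphXn; apply/eqP; rewrite piB_eq0 ideal_expX.
exists (piB b * \sum_(i < F.+1) (1 - piB (a * b)) ^+ i).
have := subrXX (1 : B0) (1 - piB (a * b)) F.+1.
rewrite expr1n nil subr0 opprB addrC subrK => e.
rewrite mulrAC -rmorphM [b * a]mulrC [RHS]e; congr (_ * _).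
by apply: eq_bigr => i _; rewrite expr1n mul1r.
Qed.

(** The element u becomes invertible in the quotient, so w generates the image of p even if it does
    not generate p. *)
Lemma piB_ideal a : a \in p -> exists x, piB a = piB w * x.
Proof.
move=> ap; have [a' aE] := uw ap; have [v vu] := piB_unit up.
exists (v * piB a'); rewrite mulrCA -rmorphM -aE rmorphM mulrA vu.
by rewrite mul1r.
Qed.

Lemma piB_nil : piB w ^+ F.+1 = 0.
Proof. by rewrite -rmorphXn; apply/eqP; rewrite piB_eq0 ideal_expX. Qed.

(** Expansions in powers of w with digits in s; F + 1 digits suffice. *)
Lemma quot_exp_finite : exists r : seq B0, forall x, x \in r.
Proof.
suff H n : exists r : seq B0, forall x, exists2 y, y \in r &
    exists z, x = y + piB w ^+ n * z.
  have [r rP] := H F.+1; exists r => x; have [y yr [z ->]] := rP x.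
  by rewrite piB_nil mul0r addr0.
elim: n => [|n [r rP]].
  exists [:: 0] => x; exists 0; rewrite ?mem_head//.
  by exists x; rewrite expr0 mul1r add0r.
exists [seq y + piB w ^+ n * piB z | y <- r, z <- s] => x.
have [y yr [z ->]] := rP x; have [a <-] := piB_surj z.
have [b bs /piB_ideal[c cE]] := sP a.
exists (y + piB w ^+ n * piB b); first by apply/allpairsP; exists (y, b).
by exists c; rewrite exprSr -mulrA -cE -addrA -mulrDr -rmorphD [b + _]addrC subrK.
Qed.

Definition quot_ring : finComUnitRingType :=
  fin_ring (projT2 (cid quot_exp_finite)).

Definition to_quot (a : A) : quot_ring := piB a.
Lemma to_quot_additive : additive to_quot.
Proof. by move=> x y; exact: (rmorphB piB). Qed.
Lemma to_quot_multiplicative : monoid_morphism to_quot.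
Proof. by split; [exact: (rmorph1 piB)|move=> x y; exact: (rmorphM piB)]. Qed.
HB.instance Definition _ :=
  GRing.isZmodMorphism.Build A quot_ring to_quot to_quot_additive.
HB.instance Definition _ :=
  GRing.isMonoidMorphism.Build A quot_ring to_quot to_quot_multiplicative.

Definition to_residue (x : quot_ring) : residue_field := piK (repr (x : B0)).

Lemma to_residueE a : to_residue (to_quot a) = piK a.
Proof.
apply/eqP; rewrite -[_ == _]Quotient.idealrBE.
apply: (@ideal_exp_sub _ p F); rewrite Quotient.idealrBE.
by apply/eqP; exact: reprK.
Qed.

Lemma to_quot_surj x : exists a, to_quot a = x.
Proof. exact: piB_surj. Qed.

Lemma to_residue_additive : additive to_residue.
Proof.
move=> x y; have [a <-] := to_quot_surj x; have [b <-] := to_quot_surj y.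
by rewrite -rmorphB !to_residueE; exact: (rmorphB piK).
Qed.
Lemma to_residue_multiplicative : monoid_morphism to_residue.
Proof.
split; first by rewrite -(rmorph1 to_quot) to_residueE; exact: (rmorph1 piK).
move=> x y; have [a <-] := to_quot_surj x; have [b <-] := to_quot_surj y.
by rewrite -rmorphM !to_residueE; exact: (rmorphM piK).
Qed.
HB.instance Definition _ :=
  GRing.isZmodMorphism.Build quot_ring residue_field to_residue to_residue_additive.
HB.instance Definition _ :=
  GRing.isMonoidMorphism.Build quot_ring residue_field to_residue
    to_residue_multiplicative.

Lemma piK_eq0 a : (piK a == 0) = (a \in p).
Proof. by rewrite -(rmorph0 piK) -[_ == _]Quotient.idealrBE subr0. Qed.

Lemma quot_chain_ring :
  chain_ring (to_residue : {rmorphism quot_ring -> residue_field}) (to_quot w) F.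
Proof.
have rE a : (to_residue : {rmorphism quot_ring -> residue_field}) (to_quot a) = piK a.
  exact: to_residueE.
split.
- by move=> y; exists (to_quot (repr (y : K0))); rewrite rE [LHS]reprK.
- move=> x; have [a <-] := to_quot_surj x; rewrite rE; split.
    move/eqP; rewrite [_ == _]piK_eq0 => /piB_ideal[y yE]; exists y; exact: yE.
  case=> y; have [b <-] := to_quot_surj y; rewrite -rmorphM => e.
  rewrite -rE e rE; apply/eqP; rewrite [_ == _]piK_eq0.
  by rewrite mulrC idealMr.
- move=> x; have [a <-] := to_quot_surj x; rewrite rE.
  rewrite [X in ~~ X]piK_eq0; apply/idP/idP => [/fin_ring_unit[y]|/piB_unit yE].
    have [b <-] := piB_surj y; apply: contra_eqN => ap.
    rewrite -rmorphM -(rmorph1 piB) -subr_eq0 -rmorphB piB_eq0.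
    apply/negP => /ideal_exp_sub; apply/negP.
    rewrite rpredDl ?rpredN ?idealr1//; exact: idealMr.
  exact/fin_ring_unit.
- by rewrite -rmorphXn; apply/eqP; rewrite [_ == _]piB_eq0 ideal_expX.
- by rewrite -rmorphXn [_ == _]piB_eq0 w_exp.
Qed.
End Power.
End PrimeQuotient.

(** * Transport of modules along a surjection of rings *)

Section Transport.
Variables (A : comNzRingType) (B : finComUnitRingType) (r : {rmorphism A -> B}).
Hypothesis r_surj : forall b, exists a, r a = b.

Definition semilinear (G : lmodType A) (M : lmodType B) (f : G -> M) :=
  forall a x y, f (a *: x + y) = r a *: f x + f y.

Lemma semilinear0 (G : lmodType A) (M : lmodType B) (f : G -> M) :
  semilinear f -> f 0 = 0.
Proof.
move=> fl; have := fl 1 0 0; rewrite scale1r addr0 rmorph1 scale1r => /eqP.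
by rewrite addrC -subr_eq subrr => /eqP.
Qed.

Lemma semilinearZ (G : lmodType A) (M : lmodType B) (f : G -> M) a x :
  semilinear f -> f (a *: x) = r a *: f x.
Proof. by move=> fl; rewrite -[a *: x]addr0 fl (semilinear0 fl) addr0. Qed.

Lemma extend_scalars (G : finLmodType A) :
  (forall a, r a = 0 -> forall x : G, a *: x = 0) ->
  exists (M : finLmodType B) (f : G -> M), bijective f /\ semilinear f.
Proof.
move=> kill; pose l b := projT1 (cid (r_surj b)).
have lK b : r (l b) = b by rewrite /l; case: cid.
have scE a b (x : G) : r a = r b -> a *: x = b *: x.
  by move=> e; apply/eqP; rewrite -subr_eq0 -scalerBl kill// rmorphB e subrr.
pose sc b (x : G) := l b *: x.
have scA b c x : sc b (sc c x) = sc (b * c) x.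
  by rewrite /sc scalerA; apply: scE; rewrite rmorphM !lK.
have sc1 : left_id 1 sc.
  by move=> x; rewrite /sc -[RHS]scale1r; apply: scE; rewrite lK rmorph1.
have scDr : right_distributive sc +%R by move=> b x y; rewrite /sc scalerDr.
have scDl x b c : sc (b + c) x = sc b x + sc c x.
  by rewrite /sc -scalerDl; apply: scE; rewrite rmorphD !lK.
exists (fin_lmodule (@addrA G) (@addrC G) (@add0r G) (@addNr G) scA sc1 scDr scDl).
exists (fun x => x); split; first by exists (fun x => x).
move=> a x y; congr (_ + _); apply: scE; by rewrite lK.
Qed.

Lemma restrict_scalars (M : finLmodType B) :
  exists (G : finLmodType A) (f : G -> M), bijective f /\ semilinear f.
Proof.
pose sc a (x : M) := r a *: x.
have scA b c x : sc b (sc c x) = sc (b * c) x by rewrite /sc scalerA rmorphM.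
have sc1 : left_id 1 sc by move=> x; rewrite /sc rmorph1 scale1r.
have scDr : right_distributive sc +%R by move=> b x y; rewrite /sc scalerDr.
have scDl x b c : sc (b + c) x = sc b x + sc c x by rewrite /sc rmorphD scalerDl.
exists (fin_lmodule (@addrA M) (@addrC M) (@add0r M) (@addNr M) scA sc1 scDr scDl).
by exists (fun x => x); split; first by exists (fun x => x).
Qed.

Section Maps.
Variables (G G' : lmodType A) (M M' : lmodType B) (f : G -> M) (f' : G' -> M').
Hypotheses (fB : bijective f) (fl : semilinear f).
Hypotheses (f'B : bijective f') (f'l : semilinear f').

Lemma linear_transport (g : {linear G -> G'}) :
  exists g' : {linear M -> M'}, forall x, g' (f x) = f' (g x).
Proof.
case: fB => h fK hK.
have lg : linear (fun y : M => f' (g (h y))).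
  move=> b x y; have [a <-] := r_surj b.
  rewrite -[x in LHS]hK -[y in LHS]hK -fl fK linearP f'l.
  by [].
by exists (mklinear lg) => x; rewrite mklinearE fK.
Qed.

Lemma linear_transport_inv (g' : {linear M -> M'}) :
  exists g : {linear G -> G'}, forall x, f' (g x) = g' (f x).
Proof.
case: f'B => h fK hK.
have lg : linear (fun x : G => h (g' (f x))).
  by move=> a x y; rewrite fl linearP -{1}[g' (f x)]hK -{1}[g' (f y)]hK -f'l fK.
by exists (mklinear lg) => x; rewrite mklinearE hK.
Qed.

Lemma quo_by_transport (y : G) : quo_by G' y <-> quo_by M' (f y).
Proof.
have f0 x : f' x = 0 <-> x = 0.
  split=> [|->]; last exact: semilinear0.
  by rewrite -(semilinear0 f'l) => /(bij_inj f'B).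
have fS : forall x, exists z, x = f z by case: fB => h _ hK x; exists (h x).
have f'S : forall x, exists z, x = f' z by case: f'B => h _ hK x; exists (h x).
have cyc x : (exists a, x = a *: y) <-> (exists b, f x = b *: f y).
  split=> [[a ->]|[b]]; first by exists (r a); rewrite semilinearZ.
  have [a <-] := r_surj b; rewrite -semilinearZ// => /(bij_inj fB) ->.
  by exists a.
split=> -[g [gS gK]].
  have [g' g'E] := linear_transport g; exists g'; split=> [x|x].
    by have [z ->] := f'S x; have [h ->] := gS z; exists (f h).
  by have [z ->] := fS x; rewrite g'E f0 gK cyc.
have [h hE] := linear_transport_inv g; exists h; split=> [x|x].
  have [m mE] := gS (f' x); have [z zE] := fS m; exists z.
  by apply: (bij_inj f'B); rewrite hE -zE.
by rewrite -f0 hE gK cyc.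
Qed.
End Maps.

Lemma card_automorphisms_transport (G : finLmodType A) (M : finLmodType B)
    (f : G -> M) : bijective f -> semilinear f ->
  #|automorphisms G| = #|automorphisms M|.
Proof.
move=> fB fl; case: (fB) => h fK hK.
have injh (s : {perm G}) : injective (fun y => f (s (h y))).
  by move=> x y /(bij_inj fB)/perm_inj/(can_inj hK).
pose t (s : {perm G}) : {perm M} := perm (@injh s).
have injt : injective t.
  move=> s s' /permP e; apply/permP => x; apply: (bij_inj fB).
  by have := e (f x); rewrite !permE fK.
rewrite -(card_imset _ injt); apply: eq_card => s'; apply/imsetP/idP.
  case=> s; rewrite !inE => /asboolP ls ->; apply/asboolP.
  have [g' g'E] := linear_transport fB fl fl (mklinear ls).
  move=> b x y; rewrite !permE -[x]hK -[y]hK.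
  have tE z : f (s (h (f z))) = g' (f z) by rewrite fK g'E.
  rewrite !tE -linearP -[b *: _ + _]hK tE hK.
  by [].
rewrite inE => /asboolP ls.
have [g gE] := linear_transport_inv fl fB fl (mklinear ls).
have injg : injective g.
  by move=> x y /(congr1 f); rewrite !gE => /perm_inj/(bij_inj fB).
exists (perm injg).
  by rewrite inE; apply/asboolP => a x y; rewrite !permE linearP.
by apply/permP => y; rewrite !permE gE /= hK.
Qed.
End Transport.

Section QuotientModule.
Variables (A : comNzRingType) (H : finLmodType A) (y : H).
Local Notation quo := (Quotient.quot (cyclic_submod y)).

Lemma quo_pi_linear : linear (\pi_quo%qT : H -> quo).
Proof. by move=> a u v; rewrite raddfD /= -quo_scale_pi. Qed.

Lemma mod_iso_quo_by (G : lmodType A) : mod_iso quo G <-> quo_by G y.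
Proof.
pose piq := mklinear quo_pi_linear.
have piK x : piq x = 0 <-> exists a, x = a *: y.
  split=> [/eqP|cx].
    by rewrite -(linear0 piq) -[_ == _]Quotient.idealrBE subr0 => /asboolP.
  apply/eqP; rewrite -(linear0 piq) -[_ == _]Quotient.idealrBE subr0.
  exact/asboolP.
have piS x : exists z, x = piq z by exists (repr x); rewrite mklinearE reprK.
split=> [[f fB]|[f [fS fK]]].
  exists (f \o piq); split=> [x|h].
    case: (fB) => g _ gK; have [z zE] := piS (g x).
    by exists z; rewrite -[LHS]gK zE.
  split=> [fh|/piK ph]; last by rewrite -[LHS]/(f (piq h)) ph linear0.
  by apply/piK/(bij_inj fB); rewrite linear0; exact: fh.
have [s sE] : exists s : {linear quo -> G}, forall v, s (piq v) = f v.
  by apply: linear_factor piS _ => v /piK/fK.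
have [t tE] : exists t : {linear G -> quo}, forall v, t (f v) = piq v.
  by apply: linear_factor fS _ => v /fK/piK.
exists s; exists t => x.
  by have [z ->] := piS x; rewrite sE tE.
by have [z ->] := fS x; rewrite tE sE.
Qed.
End QuotientModule.

Lemma card_fset_set_fin (T : finType) (S : set T) :
  #|` fset_set S|%fset = #|[set x | `[< S x >]]|.
Proof.
rewrite cardE; apply/perm_size/uniq_perm; rewrite ?fset_uniq ?enum_uniq// => x.
rewrite mem_enum inE in_fset_set; last exact: finite_finset.
by apply/idP/asboolP => [/set_mem|/mem_set].
Qed.

(** * The limiting distribution of the kernel *)

Section KernelRatio.
Local Open Scope classical_set_scope.
Variables (R : realType) (B : finComUnitRingType) (k : finFieldType).
Variables (rho : {rmorphism B -> k}) (w : B) (F : nat).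
Hypothesis BC : chain_ring rho w F.
Variable M : finLmodType B.
Hypothesis MF : forall x : M, w ^+ F *: x = 0.

Definition kernel_ratio N : R :=
  #|[set X in kernel_set M N | 1%:M + X \in unitmx]%SET|%:R / #|units_mx B N|%:R.

(** The dimension of the w-torsion of M. The logarithm is exact as soon as some matrix has a kernel
    isomorphic to M, by [kernel_set_rank]. *)
Let r := trunc_log #|k| #|[set x : M | w *: x == 0]%SET|.

Lemma card_units_gt0 N : (0 < #|units_mx B N|)%N.
Proof. by apply/card_gt0P; exists 1%:M; rewrite inE unitmx1. Qed.

Lemma card_kernel_shift N :
  #|[set X in kernel_set M N | 1%:M + X \in unitmx]%SET|%:R =
  #|kernel_set M N|%:R * shift_ratio R k N (N - r).
Proof.
have U0 : #|units_mx B N|%:R != 0 :> R by rewrite pnatr_eq0 -lt0n card_units_gt0.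
have n0 : (nunits k N)%:R != 0 :> R by rewrite pnatr_eq0 -lt0n nunits_gt0.
apply: (mulIf U0); rewrite -natrM card_shift_average; last first.
  by move=> P X uP; apply: kernel_set_mul.
rewrite natr_sum mulrAC -mulrA mulr_natl -sumr_const; apply: eq_bigr => X XK.
apply: (mulIf n0); rewrite -natrM (card_units_shift BC) natrM -mulrA; congr (_ * _).
rewrite (shift_ratioE R); congr (shift_ratio _ _ _ _ * _).
have := kernel_set_rank BC XK; rewrite /r => <-.
rewrite trunc_expnK ?card_field_gt1// subKn//; exact: rank_leq_row.
Qed.

Lemma lin_inj_cvg :
  (#|lin_inj M N|%:R / #|M|%:R ^+ N : R) @[N --> \oo] --> (1 : R).
Proof.
have M0 : 0 < #|M|%:R :> R by rewrite ltr0n; apply/card_gt0P; exists 0.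
have h : (1 - #|M|%:R * 2^-1 ^+ N : R) @[N --> \oo] --> (1 : R).
  rewrite -[X in _ --> X]subr0; apply: cvgB; first exact: cvg_cst.
  by apply: (@cvg_geometric R #|M|%:R 2^-1); rewrite gtr0_norm; lra.
have h' : (1 : R) @[_ --> \oo] --> (1 : R) by exact: cvg_cst.
apply: (squeeze_cvgr _ h h'); near=> N.
rewrite ler_pdivrMr ?exprn_gt0// mul1r -natrX ler_nat (lin_inj_le BC) andbT.
rewrite ler_pdivlMr ?ltr0n ?expn_gt0 -?(ltr0n R) ?M0//.
have := lin_inj_ge BC M N; rewrite -(ler_nat R) !natrD !natrM !natrX => H.
have p2 : 0 < 2 ^+ N :> R by rewrite exprn_gt0.
rewrite -(ler_pM2l p2); apply: (@le_trans _ _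
    (2 ^+ N * #|M|%:R ^+ N - #|M|%:R ^+ N.+1)); last by rewrite lerBlDr.
rewrite mulrBl mul1r mulrBr exprVn exprS le_eqVlt; apply/orP; left; apply/eqP.
by congr (_ - _); field; rewrite gt_eqF.
Unshelve. all: by end_near.
Qed.

Lemma kernel_ratio_cvg :
  kernel_ratio N @[N --> \oo] --> limn (qpoch R k) / #|automorphisms M|%:R.
Proof.
have -> : kernel_ratio = (fun N => #|automorphisms M|%:R^-1 *
    ((#|lin_inj M N|%:R / #|M|%:R ^+ N) * shift_ratio R k N (N - r))).
  apply/funext => N; rewrite /kernel_ratio card_kernel_shift.
  have U0 : #|units_mx B N|%:R != 0 :> R by rewrite pnatr_eq0 -lt0n card_units_gt0.
  have M0 : #|M|%:R != 0 :> R.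
    by rewrite pnatr_eq0 -lt0n; apply/card_gt0P; exists 0.
  have A0 : #|automorphisms M|%:R != 0 :> R.
    rewrite pnatr_eq0 -lt0n; apply/card_gt0P; exists 1%g.
    by rewrite inE; apply/asboolP => a x y; rewrite !perm1.
  have := congr1 (fun n => n%:R : R) (card_kernel_set BC MF N).
  rewrite /= !natrM natrX => e.
  apply: (mulIf U0); rewrite divfK//.
  apply: (mulIf A0); apply: (mulIf (expf_neq0 N M0)).
  transitivity (#|kernel_set M N|%:R * #|automorphisms M|%:R * #|M|%:R ^+ N
    * shift_ratio R k N (N - r)); first by ring.
  by rewrite e; field; rewrite A0 expf_neq0.
rewrite mulrC; apply: cvgM; first exact: cvg_cst.
by rewrite -[X in _ --> X]mul1r; apply: cvgM; [exact: lin_inj_cvg|exact: shift_ratio_cvg].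
Qed.
End KernelRatio.

(** * The u-probability distributions *)

Section PrimeModules.
Variables (R : realType) (A : comNzRingType) (p : prime_idealr A).
Variables (s : seq A) (w u : A).
Hypothesis sP : forall x, exists2 y, y \in s & x - y \in p.
Hypothesis wp : w \in p.
Hypothesis up : u \notin p.
Hypothesis uw : forall a, a \in p -> exists a', u * a = w * a'.
Hypothesis w_exp : forall j, w ^+ j \notin ideal_exp p j.+1.

Local Notation k := (residue_field sP).
Local Notation Bq F := (quot_ring sP wp up uw F).
Local Notation rB F := (to_quot sP wp up uw F : {rmorphism A -> Bq F}).
Local Notation chain F := (quot_chain_ring sP wp up uw w_exp F).

Lemma residue_cardE : residue_card p = #|k|.
Proof.
rewrite /residue_card (@card_fset_set_fin k) -cardsT.
by apply: eq_card => x; rewrite !inE; apply/asboolP.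
Qed.

Lemma to_quot_eq0 F a : rB F a = 0 <-> a \in ideal_exp p F.+1.
Proof.
by rewrite -[a \in _](piB_eq0 p F); split=> [/eqP|/eqP].
Qed.

Lemma to_quot_surjective F b : exists a, rB F a = b.
Proof. exact: to_quot_surj. Qed.

Lemma module_over_quot F (G : finLmodType A) : killed_by_exp p F.+1 G ->
  exists (M : finLmodType (Bq F)) (f : G -> M),
    bijective f /\ semilinear (rB F) f.
Proof.
move=> GF; apply: extend_scalars; first exact: to_quot_surjective.
by move=> a /to_quot_eq0; apply: GF.
Qed.

Lemma killed_by_exp_le i j (G : lmodType A) : (i <= j)%N ->
  killed_by_exp p i G -> killed_by_exp p j G.
Proof. by move=> ij Gi a aj; apply: Gi; apply: ideal_exp_le aj. Qed.

Section KernelIso.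
Variables (F N : nat) (G : finLmodType A) (M : finLmodType (Bq F)) (f : G -> M).
Hypotheses (fB : bijective f) (fl : semilinear (rB F) f).

Lemma ker_iso_kernel_set (X : 'M[Bq F]_N) :
  ker_iso (X : 'M[quot_exp p F]_N) G <-> X \in kernel_set M N.
Proof.
case: (fB) => h fK hK; rewrite inE; split.
  case=> g gB; apply/existsP.
  pose i : {ffun M -> 'cV[Bq F]_N} := [ffun m => val (g (h m))].
  have li : linear i.
    move=> b x y; rewrite !ffunE; have [a <-] := to_quot_surjective b.
    rewrite -[x in LHS]hK -[y in LHS]hK -fl fK linearP.
    exact: (linearP val).
  have ii : injective i.
    move=> x y; rewrite !ffunE => /val_inj/(bij_inj gB).
    exact: (can_inj hK).
  exists i; apply/andP; split.
    by rewrite inE; apply/andP; split; [apply/asboolP|apply/injectiveP].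
  apply/forallP => v; apply/eqP; apply/idP/codomP => [Xv|[x ->]]; last first.
    by rewrite ffunE; exact: (valP (g (h x))).
  case: gB => g' _ g'K; exists (f (g' (KerMod Xv))).
  by rewrite ffunE fK g'K.
case/existsP=> i /andP[]; rewrite inE => /andP[/asboolP li /injectiveP ii].
move=> /forallP iX.
have ik x : (X : 'M[quot_exp p F]_N) *m (i (f x)) == 0.
  by have := iX (i (f x)); rewrite codom_f => /eqP.
pose g x : ker_mod (X : 'M[quot_exp p F]_N) := KerMod (ik x).
have lg : linear_for (quot_pi p F \; *:%R) g.
  by move=> a x y; apply/val_inj; rewrite /= fl li.
pose gM := GRing.isLinear.Build A G (ker_mod (X : 'M[quot_exp p F]_N))
  (quot_pi p F \; *:%R) g lg.
pose gL : {linear G -> ker_mod (X : 'M[quot_exp p F]_N) | quot_pi p F \; *:%R} :=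
  HB.pack g gM.
exists gL.
have S v : exists x, g x = v.
  case: v => v vX; have : v \in codom i by rewrite -(eqP (iX v)).
  case/codomP => m mE; exists (h m); apply/val_inj => /=.
  by rewrite hK -mE.
exists (fun v => projT1 (cid (S v))) => [x|v].
  case: cid => y /= /(congr1 val) /= /ii/(bij_inj fB).
  by [].
by case: cid.
Qed.
End KernelIso.

Lemma Sp_ratioE F (G : finLmodType A) (M : finLmodType (Bq F)) (f : G -> M) n :
  bijective f -> semilinear (rB F) f ->
  Sp_ratio R p 0 F G n = kernel_ratio R M (n + n).
Proof.
move=> fB fl; rewrite /Sp_ratio /kernel_ratio.
have SpE (g : 'M[Bq F]_(n + n)) : Sp_set p 0 F n g <-> g \in unitmx.
  split=> [[[h [gh _]] _]|ug].
    by have [] := @mulmx1_unit (Bq F) _ _ _ gh.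
  (* For m = 0 the congruence is modulo [ideal_exp p 0], the whole ring, so any lift of the entry
     will do. *)
  split; last by move=> i j; have [a <-] := piB_surj (F := F) (p := p) ((g^T *m sympl_J _ n *m g - sympl_J _ n) i j); exists a.
  exists (invmx g); split; [exact: (@mulmxV (Bq F) _ g ug)|exact: (@mulVmx (Bq F) _ g ug)].
rewrite !(@card_fset_set_fin 'M[Bq F]_(n + n)); congr (_%:R / _%:R).
  have inj : injective (fun X : 'M[Bq F]_(n + n) => 1%:M + X) := addrI 1%:M.
  rewrite -[RHS](card_imset _ inj); apply: eq_card => g; rewrite inE.
  apply/asboolP/imsetP => [[/SpE ug /(ker_iso_kernel_set fB fl) gK]|].
    exists (g - 1%:M); last by rewrite addrC subrK.
    by rewrite inE gK /= addrC subrK.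
  case=> X; rewrite inE => /andP[XK uX] ->; split; first exact/SpE.
  apply/(ker_iso_kernel_set fB fl); rewrite addrC addKr//.
by apply: eq_card => g; rewrite !inE; apply/asboolP/idP => /SpE.
Qed.
Lemma semilinear_pow F (G : finLmodType A) (M : finLmodType (Bq F)) (f : G -> M) i x :
  semilinear (rB F) f -> (rB F w) ^+ i *: f x = f (w ^+ i *: x).
Proof. by move=> fl; rewrite (semilinearZ _ _ fl) rmorphXn. Qed.

Section KernelLimit.
Local Open Scope classical_set_scope.

Lemma cvg_double : (n + n)%N @[n --> \oo] --> \oo.
Proof.
apply/cvgnyPge => N; near=> n; apply: leq_trans (leq_addr n n).
by near: n; exact: nbhs_infty_ge.
Unshelve. all: by end_near.
Qed.

(** [Pm] picks some limit common to all admissible exponents. The expected value is one, and the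
    exponent [F0] provided by torsion makes it unique. *)
Lemma Pm0E (G : finLmodType A) : ptorsion p G ->
  Pm R p 0 G = limn (qpoch R k) / #|automorphisms G|%:R.
Proof.
move=> [F0 GF0].
have lim F : killed_by_exp p F G ->
    Sp_ratio R p 0 F G n @[n --> \oo] --> limn (qpoch R k) / #|automorphisms G|%:R.
  move=> GF; have [M [f [fB fl]]] := module_over_quot (killed_by_exp_le (leqnSn F) GF).
  rewrite (_ : Sp_ratio R p 0 F G = fun n => kernel_ratio R M (n + n)%N); last first.
    by apply/funext => n; rewrite (Sp_ratioE n fB fl).
  rewrite (card_automorphisms_transport (to_quot_surjective (F := F)) fB fl).
  have MF (x : M) : (rB F w) ^+ F *: x = 0.
    case: (fB) => h _ hK; rewrite -[x]hK semilinear_pow// GF ?ideal_expX//.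
    exact: semilinear0.
  exact: (cvg_comp _ _ cvg_double (kernel_ratio_cvg (R := R) (chain F) MF)).
rewrite /Pm; set S := [set l | _].
have Sl : S (limn (qpoch R k) / #|automorphisms G|%:R) by move=> F _; apply: lim.
have /(_ F0 isT GF0) c1 := @getPex _ S (ex_intro _ _ Sl).
exact: (cvg_unique _ c1 (lim _ GF0)).
Qed.

End KernelLimit.

Lemma piB_exp F n a : a \in ideal_exp p n -> exists b, rB F a = (rB F w) ^+ n * b.
Proof.
elim: n a => [|n IH] a; first by exists (rB F a); rewrite expr0 mul1r.
case/asboolP => t tI ->; elim: t tI => [|[x y] t IHt] /=.
  by exists 0; rewrite big_nil rmorph0 mulr0.
case/andP=> /andP[/= /(piB_ideal sP up uw F)[x' xE] /IH[y' yE]] /IHt[b bE].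
exists ((x' : Bq F) * y' + b); rewrite big_cons rmorphD rmorphM bE yE mulrDr.
congr (_ + _); rewrite [rB F x]xE exprS -!mulrA; congr (_ * _).
exact: mulrCA.
Qed.

Lemma quo_by_card K (G H : finLmodType A) (M : finLmodType (Bq K)) (f : H -> M)
    (y : H) : bijective f -> semilinear (rB K) f -> quo_by G y ->
  #|H| = (#|cyclic_set (f y)| * #|G|)%N.
Proof.
move=> fB fl [phi [phiS phiK]]; rewrite (card_additiveT phi).
have -> : phi @: [set: H]%SET = [set: G]%SET.
  apply/setP => x; rewrite in_setT; apply/imsetP.
  by have [z ->] := phiS x; exists z.
rewrite cardsT -(card_imset _ (bij_inj fB)); congr (_ * _)%N; apply: eq_card => x.
apply/imsetP/imsetP => [[z]|[b _ ->]].
  rewrite inE => /eqP/phiK[a ->] ->; exists (rB K a) => //.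
  by rewrite (semilinearZ _ _ fl).
have [a <-] := to_quot_surjective b.
exists (a *: y); last by rewrite (semilinearZ _ _ fl).
by rewrite inE; apply/eqP/phiK; exists a.
Qed.

(** p^m maps H into the submodule generated by y. The order of H forces this submodule to have
    length j, so p^j kills it. *)
Lemma extension_killed (G H : finLmodType A) (y : H) m j :
  ptorsion p H -> killed_by_exp p m G -> quo_by G y ->
  #|H| = (#|k| ^ j * #|G|)%N -> killed_by_exp p (m + j) H.
Proof.
move=> [K HK] Gm yG HG.
have [M [f [fB fl]]] := module_over_quot (killed_by_exp_le (leqnSn K) HK).
have [e [_ ey ce _]] := card_cyclic_set (chain K) (f y).
have ej : e = j.
  have G0 : (0 < #|G|)%N by apply/card_gt0P; exists 0.
  apply/eqP; rewrite -(eqn_exp2l _ _ (card_field_gt1 k)) -ce -(eqn_pmul2r G0).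
  by rewrite -HG (quo_by_card fB fl yG).
have [phi [_ phiK]] := yG.
move=> a /(piB_exp K)[b aE] x; apply: (bij_inj fB).
rewrite (semilinearZ _ _ fl) aE (semilinear0 fl) mulrC -scalerA addnC exprD -scalerA.
rewrite semilinear_pow//.
have [c ->] : exists c, w ^+ m *: x = c *: y.
  by apply/phiK; rewrite linearZ /= Gm ?ideal_expX.
rewrite (semilinearZ _ _ fl) [_ *: (rB K c *: _)]scalerA mulrC -scalerA -ej ey.
by rewrite !scaler0.
Qed.

(** * Summation over the extensions of a fixed module *)

Section ExtensionSum.
Variables (G : finLmodType A) (m j : nat).
Hypothesis Gm : killed_by_exp p m G.
(** O / p^(F+1) acts on every extension H of order q^j |G|, by [extension_killed], and w^(F+1-j) =
    w^(m+1) kills G, as the count of extensions requires. *)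
Let F := (m + j)%N.
Variables (M : finLmodType (Bq F)) (f : G -> M).
Hypotheses (fB : bijective f) (fl : semilinear (rB F) f).
Variables (N : nat) (g : 'I_N -> M) (S : 'M[Bq F]_N).
Hypothesis gS : presents g S.

Let W : Bq F := rB F w.

Let MF (x : M) : W ^+ (F.+1 - j) *: x = 0.
Proof.
case: fB => h _ hK; rewrite -[x]hK semilinear_pow// Gm ?(semilinear0 fl)//.
by apply: (@ideal_exp_le _ p m (F.+1 - j)); rewrite ?ideal_expX// /F; lia.
Qed.

Definition class_presented (c : isoclass p) (l : 'rV[Bq F]_N) :=
  `[< exists (H : finLmodType (Bq F)) (h : class_repr c -> H) (b : 'I_(N + 1) -> H),
    [/\ bijective h, semilinear (rB F) h & presents b (ext_mx W j S l)] >].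

Definition quotient_count (H : finLmodType A) :=
  #|[set y : H | `[< mod_iso (Quotient.quot (cyclic_submod y)) G >]]%SET|.

Lemma class_presentedP (c : isoclass p) l (H : finLmodType (Bq F)) (h : class_repr c -> H) :
  bijective h -> semilinear (rB F) h ->
  class_presented c l <->
  exists b : {ffun 'I_(N + 1) -> H}, presents b (ext_mx W j S l).
Proof.
move=> hB hl; split=> [/asboolP[H' [h' [b [h'B h'l bP]]]]|[b bP]]; last first.
  by apply/asboolP; exists H, h, b.
have [t tE] := linear_transport (to_quot_surjective (F := F)) h'B h'l hl
  (idfun : {linear class_repr c -> class_repr c}).
have tB : bijective t.
  case: hB h'B => i hK iK [i' h'K i'K]; exists (h' \o i) => x /=.
    by rewrite -[x in LHS]i'K tE hK i'K.
  by rewrite tE iK.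
exists [ffun i => t (b i)].
rewrite (_ : fun_of_fin _ = t \o b); last by apply/funext => i; rewrite ffunE.
exact: presents_comp.
Qed.

Lemma class_presented_unique l : exists c, class_presented c l /\
  forall c', class_presented c' l -> c' = c.
Proof.
have [H [b bP]] := chain_presented_exists (chain F) (ext_mx W j S l).
have [G' [f' [f'B f'l]]] := restrict_scalars (rB F) H.
have G'tors : ptorsion p G'.
  exists F.+1 => a aF x; apply: (bij_inj f'B).
  rewrite (semilinearZ _ _ f'l) (semilinear0 f'l).
  have -> : rB F a = 0 by apply/to_quot_eq0.
  by rewrite scale0r.
have [c [[t tB] cU]] := class_reprP G'tors; exists c; split.
  apply/asboolP; exists H, (f' \o t), b; split=> //.
    exact: bij_comp.
  by move=> a x y /=; rewrite linearP f'l.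
move=> c' /asboolP[H' [h' [b' [h'B h'l b'P]]]]; apply/esym/cU.
have [s1 s1B _] := presents_iso b'P bP.
have [t' t'E] := linear_transport_inv h'l f'B f'l s1; exists t'.
case: f'B => i' f'K i'K; case: h'B => i hK iK; case: s1B => r1 s1K r1K.
exists (fun x => i (r1 (f' x))) => x; first by rewrite t'E s1K hK.
by apply: (can_inj f'K); rewrite t'E iK r1K.
Qed.

Lemma card_class_presented (c : isoclass p) l : class_presented c l ->
  #|class_repr c| = (#|k| ^ j * #|G|)%N.
Proof.
move=> /asboolP[H [h [b [hB hl bP]]]].
rewrite (bij_eq_card hB) (bij_eq_card fB) (card_presented bP).
by apply: (card_ker_ext_mx (chain F) _ gS MF l); rewrite /F; lia.
Qed.

(** If p^(F+1) kills H, this is [card_quo_by] transported to O. Otherwise H is neither an extension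
    of G nor a cokernel over O / p^(F+1), and both sides vanish. *)
Lemma card_quotient_class (c : isoclass p) :
  #|class_repr c| = (#|k| ^ j * #|G|)%N ->
  (quotient_count (class_repr c) * (#|automorphisms G| * #|Bq F| ^ N))%N =
  (#|automorphisms (class_repr c)| *
   #|[set l | class_presented c l]%SET|)%N.
Proof.
set H := class_repr c => HG.
have Htors : ptorsion p H := fmod_ptorsion _.
have [HF|nHF] := pselect (killed_by_exp p F.+1 H).
  have [MH [h [hB hl]]] := module_over_quot HF.
  have cMH : #|MH| = (#|k| ^ j * #|M|)%N.
    by rewrite -(bij_eq_card hB) -(bij_eq_card fB).
  have jF : (j <= F.+1)%N by rewrite /F; lia.
  have := card_quo_by (chain F) jF gS MF cMH.
  rewrite -(card_automorphisms_transport (to_quot_surjective (F := F)) fB fl).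
  rewrite -(card_automorphisms_transport (to_quot_surjective (F := F)) hB hl).
  have -> : #|[set y : MH | `[< quo_by M y >]]%SET| = quotient_count H.
    rewrite /quotient_count -[RHS](card_imset _ (bij_inj hB)).
    have qE y : mod_iso (Quotient.quot (cyclic_submod y)) G <-> quo_by M (h y).
      rewrite mod_iso_quo_by.
      exact: (quo_by_transport (to_quot_surjective (F := F)) hB hl fB fl).
    apply: eq_card => y; rewrite inE; apply/asboolP/imsetP => [|[x]].
      case: (hB) => i hK iK; rewrite -{1}[y]iK => /qE yG.
      by exists (i y); rewrite ?iK// inE; apply/asboolP.
    by rewrite inE => /asboolP/qE ? ->.
  move=> ->; congr (_ * _)%N; apply: eq_card => l; rewrite !inE.
  by apply/asboolP/idP => /(class_presentedP l hB hl).
have -> : quotient_count H = 0%N.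
  apply: eq_card0 => y; rewrite inE; apply/asboolP => /mod_iso_quo_by yG; apply: nHF.
  apply: killed_by_exp_le (leqnSn _) _.
  exact: extension_killed Htors Gm yG HG.
rewrite mul0n; apply/esym/eqP; rewrite muln_eq0; apply/orP; right.
rewrite cards_eq0; apply/eqP/setP => l; rewrite !inE.
apply/negP => /asboolP[H' [h [b [hB hl _]]]]; apply: nHF => a aF x.
apply: (bij_inj hB); rewrite (semilinearZ _ _ hl) (semilinear0 hl).
have -> : rB F a = 0 by apply/to_quot_eq0.
by rewrite scale0r.
Qed.

(** By [card_quotient_class] the weight of a class is proportional to the number of rows l whose
    cokernel lies in it. Every row belongs to exactly one class, so these numbers add up to
    |B|^N. *)
Lemma esum_quotient_class (z : R) : 0 <= z ->
  (\esum_(c in [set c : isoclass p | #|class_repr c| = (#|k| ^ j * #|G|)%N]%classic)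
    (z * ((quotient_count (class_repr c))%:R /
      #|automorphisms (class_repr c)|%:R))%:E =
   (z / #|automorphisms G|%:R)%:E)%E.
Proof.
move=> z0; set J := [set c | _]%classic.
have aut0 (K : finLmodType A) : #|automorphisms K|%:R != 0 :> R.
  rewrite pnatr_eq0 -lt0n; apply/card_gt0P; exists 1%g.
  by rewrite inE; apply/asboolP => a x y; rewrite !perm1.
have B0 : #|Bq F|%:R ^+ N != 0 :> R.
  by rewrite expf_neq0// pnatr_eq0 -lt0n; apply/card_gt0P; exists 0.
(* The contribution of a single row l. *)
pose kappa := z / (#|automorphisms G|%:R * #|Bq F|%:R ^+ N).
have kappa0 : 0 <= kappa by rewrite divr_ge0// mulr_ge0// exprn_ge0.
transitivity (\esum_(c in J)
    \sum_(l : 'rV[Bq F]_N) (kappa * (class_presented c l)%:R)%:E)%E.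
  apply: eq_esum => c Jc; rewrite sumEFin; congr (_%:E).
  rewrite -mulr_sumr -natr_sum.
  have -> : (\sum_(l : 'rV[Bq F]_N) class_presented c l)%N =
      #|[set l | class_presented c l]%SET|.
    by rewrite -sum1dep_card [RHS]big_mkcond; apply: eq_bigr => l _; case: ifP.
  have := congr1 (fun n => n%:R : R) (card_quotient_class Jc).
  rewrite /= !natrM natrX /kappa => e.
  apply: (mulIf (aut0 (class_repr c))); apply: (mulIf (aut0 G)); apply: (mulIf B0).
  transitivity (z * ((quotient_count (class_repr c))%:R *
      (#|automorphisms G|%:R * #|Bq F|%:R ^+ N))).
    by field; rewrite aut0.
  by rewrite e; field; rewrite aut0 B0.
rewrite esum_sum; last by move=> c l _ _; rewrite lee_fin mulr_ge0.
transitivity (\sum_(l : 'rV[Bq F]_N) kappa%:E)%E.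
  apply: eq_bigr => l _; have [c0 [c0l c0U]] := class_presented_unique l.
  have e0 : kappa%:E = (kappa * (class_presented c0 l)%:R)%:E by rewrite c0l mulr1.
  rewrite e0 -(esum_set1 (t := c0) (a := fun c => (kappa * (class_presented c l)%:R)%:E));
    last by rewrite lee_fin mulr_ge0.
  rewrite esum_mkcond [RHS]esum_mkcond; apply: eq_esum => c _.
  have [->|cc0] := eqVneq c c0.
    rewrite mem_set ?[X in _ = if X then _ else _]mem_set//.
    exact: card_class_presented c0l.
  rewrite [X in _ = if X then _ else _]memNset; last by move=> /= e; rewrite e eqxx in cc0.
  case: ifP => // _; case: (boolP (class_presented c l)) => [/c0U e|_].
    by rewrite e eqxx in cc0.
  by rewrite mulr0.
rewrite sumEFin; congr (_%:E); rewrite sumr_const card_mx mul1n.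
rewrite -[LHS]mulr_natr natrX /kappa; field; rewrite aut0 B0//.
Qed.
End ExtensionSum.

Lemma card_by_quotient (G H : finLmodType A) : ptorsion p H ->
  (0 < quotient_count G H)%N -> exists j, #|H| = (#|k| ^ j * #|G|)%N.
Proof.
move=> [K HK] /card_gt0P[y]; rewrite inE => /asboolP/mod_iso_quo_by yG.
have [M [f [fB fl]]] := module_over_quot (killed_by_exp_le (leqnSn K) HK).
have [e [_ _ ce _]] := card_cyclic_set (chain K) (f y).
by exists e; rewrite (quo_by_card fB fl yG) ce.
Qed.

Lemma esum_order_class (G : finLmodType A) j (z : R) : ptorsion p G -> 0 <= z ->
  (\esum_(c in [set c : isoclass p | #|class_repr c| = (#|k| ^ j * #|G|)%N]%classic)
    (z * ((quotient_count G (class_repr c))%:R /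
      #|automorphisms (class_repr c)|%:R))%:E =
   (z / #|automorphisms G|%:R)%:E)%E.
Proof.
move=> [m Gm] z0.
have GF : killed_by_exp p (m + j).+1 G by apply: killed_by_exp_le Gm; lia.
have [M [f [fB fl]]] := module_over_quot GF.
have [g [S gS]] := presents_exists (chain (m + j)) M.
exact: (esum_quotient_class Gm fB fl gS z0).
Qed.

Lemma esum_geometric (a x : R) : 0 <= a -> 0 <= x -> x < 1 ->
  (\esum_(j in [set: nat]%classic) (a * x ^+ j)%:E = (a / (1 - x))%:E)%E.
Proof.
move=> a0 x0 x1.
rewrite -nneseries_esumT; last by move=> n; rewrite lee_fin mulr_ge0// exprn_ge0.
have c : (series (geometric a x) n @[n --> \oo] --> a / (1 - x))%classic.
  by apply: cvg_geometric_series; rewrite ger0_norm.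
transitivity (limn (EFin \o series (geometric a x)))%classic.
  by congr (limn _); apply/funext => n; rewrite /= /series /= sumEFin.
by rewrite EFin_lim; [rewrite (cvg_lim _ c)|exact: cvgP c].
Qed.

(** Classes without a suitable y contribute 0. The others are sorted by j with |H| = q^j |G|; on
    such a layer the power of |H| is constant, and layer j sums to z (q^j |G|)^-(v+1) / |Aut G|. *)
Lemma esum_all_classes (G : finLmodType A) (z : R) v : ptorsion p G -> 0 <= z ->
  (\esum_(c in [set: isoclass p]%classic)
    (z / #|class_repr c|%:R ^+ v.+1 * ((quotient_count G (class_repr c))%:R /
      #|automorphisms (class_repr c)|%:R))%:E =
   (z / (1 - #|k|%:R ^- v.+1) / (#|G|%:R ^+ v.+1 * #|automorphisms G|%:R))%:E)%E.
Proof.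
move=> Gt z0; set a := (fun c => _).
have a0 c : (0 <= a c)%E.
  by rewrite lee_fin !mulr_ge0// ?invr_ge0 ?exprn_ge0.
pose J j := [set c : isoclass p | #|class_repr c| = (#|k| ^ j * #|G|)%N]%classic.
have G0 : (0 < #|G|)%N by apply/card_gt0P; exists 0.
have Jtriv : classical_sets.trivIset [set: nat]%classic J.
  move=> i j _ _ [c [/= ci cj]]; apply/eqP.
  by rewrite -(eqn_exp2l _ _ (card_field_gt1 k)) -(eqn_pmul2r G0) -ci cj.
transitivity (\esum_(c in (\bigcup_(j in [set: nat]) J j)%classic) a c)%E.
  rewrite [RHS]esum_mkcond; apply: eq_esum => c _; case: ifPn => // /negP cJ.
  rewrite /a; have -> : quotient_count G (class_repr c) = 0%N.
    apply/eqP; rewrite -leqn0 leqNgt; apply/negP => /card_by_quotient[|j cj].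
      exact: fmod_ptorsion.
    by apply: cJ; apply/mem_set; exists j.
  by rewrite mul0r mulr0.
rewrite esum_bigcupT//.
have q1 : 1 < #|k|%:R :> R by rewrite ltr1n card_field_gt1.
have q0 : 0 < #|k|%:R :> R by rewrite (lt_trans _ q1).
have GR : #|G|%:R != 0 :> R by rewrite pnatr_eq0 -lt0n.
have A0 : #|automorphisms G|%:R != 0 :> R.
  rewrite pnatr_eq0 -lt0n; apply/card_gt0P; exists 1%g.
  by rewrite inE; apply/asboolP => b x y; rewrite !perm1.
pose x : R := #|k|%:R ^- v.+1.
have x0 : 0 <= x by rewrite invr_ge0 exprn_ge0 // ltW.
have x1 : x < 1 by rewrite invf_lt1 ?exprn_gt0// exprn_egt1.
transitivity (\esum_(j in [set: nat]%classic)
   (z / (#|G|%:R ^+ v.+1 * #|automorphisms G|%:R) * x ^+ j)%:E)%E.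
  apply: eq_esum => j _; rewrite -[RHS](_ : (z / (#|k| ^ j * #|G|)%N%:R ^+ v.+1
      / #|automorphisms G|%:R)%:E = _)%E.
    rewrite -(@esum_order_class G j)//; last by rewrite divr_ge0// exprn_ge0.
    by apply: eq_esum => c /= cj; rewrite /a cj.
  congr (_%:E); rewrite natrM natrX exprMn -exprM mulnC exprM /x exprVn.
  by field; rewrite A0 !expf_neq0// gt_eqF.
rewrite esum_geometric//; last by rewrite divr_ge0// mulr_ge0// exprn_ge0.
by congr (_%:E); rewrite -/x mulrAC.
Qed.

(** The factor 1/|H| of the recursion raises the exponent of |H| from v to v + 1; summing the layers
    then divides by 1 - q^-(v+1), the new factor of [qfact]. *)
Lemma udistE v (G : finLmodType A) : ptorsion p G ->
  udist p (fun H : finLmodType A => (Pm R p 0 H)%:E) v G =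
  (qfact_oo R p / qfact R p v
     * (1 / (#|G|%:R ^+ v * #|automorphisms G|%:R)))%:E.
Proof.
have qfE : qfact R p = qpoch R k.
  by apply/funext => i; rewrite /qfact /qpoch residue_cardE.
rewrite /qfact_oo qfE; set Q := limn _.
have Q0 : 0 <= Q.
  rewrite /Q; apply: limr_ge; first by apply/cvg_ex; exists Q; exact: qpoch_cvg.
  by apply: nearW => i; apply/ltW/qpoch_gt0.
elim: v G => [|v IH] G Gt /=.
  by rewrite Pm0E// /qpoch big_geq// divr1 expr0 !mul1r.
transitivity (\esum_(c in [set: isoclass p]%classic)
    (Q / qpoch R k v / #|class_repr c|%:R ^+ v.+1 *
     ((quotient_count G (class_repr c))%:R /
      #|automorphisms (class_repr c)|%:R))%:E)%E.
  apply: eq_esum => c _; rewrite IH; last exact: fmod_ptorsion.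
  rewrite sumEFin sumr_const; congr (_%:E).
  transitivity (Q / qpoch R k v * (1 / (#|class_repr c|%:R ^+ v *
      #|automorphisms (class_repr c)|%:R)) / #|class_repr c|%:R *+
      quotient_count G (class_repr c)).
    by congr (_ *+ _); apply: eq_card => y; rewrite [in RHS]inE.
  by rewrite -mulr_natr div1r exprSr !invfM; ring.
rewrite esum_all_classes//; last by rewrite divr_ge0// ltW// qpoch_gt0.
congr (_%:E); rewrite qpochS; have := qpoch_gt0 R k v; have := qpoch_factor_gt0 R k (ltn0Sn v).
move=> h1 h2; rewrite div1r invfM; congr (_ * _).
by rewrite invfM mulrA.
Qed.
End PrimeModules.

Theorem theorem4p4 (R : realType) (L : fieldExtType rat)
    (p : prime_idealr (ringOfIntegers L))
    (p_neq0 : exists2 x, x \in (p : {pred ringOfIntegers L}) & x != 0)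
    (G : finLmodType (ringOfIntegers L)) (G_tors : ptorsion p G) (u : nat) :
  udist p (fun H : finLmodType (ringOfIntegers L) => (Pm R p 0 H)%:E) u G =
  (qfact_oo R p / qfact R p u
     * (1 / (#|G|%:R ^+ u * #|automorphisms G|%:R)))%:E.
Proof.
have [s sP] := residue_reps p_neq0.
have [w [v [wp vp vw w_exp]]] := uniformizer_exists p_neq0.
exact: (udistE R sP wp vp vw w_exp u G_tors).
Qed.
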